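(* Let $d,d_a,d_u\in\mathbb{N}$, $s>d/2$ and $s'\ge0$. Let the activation function $\sigma:\mathbb{R}\to\mathbb{R}$ be non-polynomial, globally Lipschitz continuous and of class $C^3$. Let $\mathcal{G}:H^{s}(\mathbb{T}^d;\mathbb{R}^{d_a})\to H^{s'}(\mathbb{T}^d;\mathbb{R}^{d_u})$ be a continuous operator and let $K\subset H^{s}(\mathbb{T}^d;\mathbb{R}^{d_a})$ be a compact subset. Then for any $\epsilon>0$ there exist $N\in\mathbb{N}$ and a $\Psi$-FNO $\mathcal{N}:L^2_N(\mathbb{T}^d;\mathbb{R}^{d_a})\to L^2_N(\mathbb{T}^d;\mathbb{R}^{d_u})$ with activation function $\sigma$ such that $$\sup_{a\in K}\Vert\mathcal{G}(a)-\mathcal{N}(a)\Vert_{H^{s'}}\le\epsilon.$$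
   Context: $\mathbb{T}^d$ is the periodic torus, identified with $[0,2\pi]^d$. Fourier transform: $\mathcal{F}(v)(k)=\hat v_k=(2\pi)^{-d}\int_{\mathbb{T}^d}v(x)e^{-i\langle k,x\rangle}dx$, $k\in\mathbb{Z}^d$; inverse: $\mathcal{F}^{-1}(\hat v)(x)=\sum_{k}\hat v_ke^{i\langle k,x\rangle}$. $H^s(\mathbb{T}^d)$ is the Sobolev space with norm $\Vert v\Vert_{H^s}^2=\frac{(2\pi)^d}{2}\sum_{k}(1+|k|^{2s})|\hat v_k|^2$. $L^2_N(\mathbb{T}^d)$ is the space of real-valued trigonometric polynomials $\sum_{|k|_\infty\le N}c_ke^{i\langle k,x\rangle}$ with the $L^2$-norm. $\mathcal{I}_N:C(\mathbb{T}^d)\to L^2_N(\mathbb{T}^d)$ is the pseudo-spectral projection: $\mathcal{I}_Nv$ is the unique element of $L^2_N$ with $\mathcal{I}_Nv(x_j)=v(x_j)$ at all grid points $x_j=2\pi j/(2N+1)$, $j\in\mathcal{J}_N=\{0,\dots,2N\}^d$ (componentwise for vector-valued functions). For $s>d/2$ it is defined on $H^s\subset C(\mathbb{T}^d)$. $\Psi$-FNO: a map of the form $\mathcal{N}(a)=\mathcal{Q}\circ\mathcal{I}_N\circ\mathcal{L}_L\circ\mathcal{I}_N\circ\dots\circ\mathcal{L}_1\circ\mathcal{I}_N\circ\mathcal{R}(a)$ for some $L\in\mathbb{N}$, $d_v\ge d_u$, $N\in\mathbb{N}$, where $\mathcal{R}(a)(x)=Ra(x)$, $R\in\mathbb{R}^{d_v\times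 d_a}$, $\mathcal{Q}(v)(x)=Qv(x)$, $Q\in\mathbb{R}^{d_u\times d_v}$, and $\mathcal{L}_\ell(v)(x)=\sigma\big(W_\ell v(x)+b_\ell(x)+\mathcal{F}^{-1}(P_\ell(k)\cdot\mathcal{F}(v)(k))(x)\big)$ for $\ell=1,\dots,L$, with $\sigma$ applied componentwise, $W_\ell\in\mathbb{R}^{d_v\times d_v}$, $b_\ell$ a (continuous) $\mathbb{R}^{d_v}$-valued bias function (only its grid values matter), and $P_\ell(k)\in\mathbb{C}^{d_v\times d_v}$, $|k|_\infty\le N$, with $P_\ell(-k)=\overline{P_\ell(k)}$. Such a map is defined on all continuous inputs $a$, depends only on $\mathcal{I}_Na$, and takes values in $L^2_N(\mathbb{T}^d;\mathbb{R}^{d_u})$; one writes ''$\mathcal{N}:L^2_N(\mathbb{T}^d;\mathbb{R}^{d_a})\to L^2_N(\mathbb{T}^d;\mathbb{R}^{d_u})$ is a $\Psi$-FNO'', and $\mathcal{N}(a)$ for $a\in H^s$, $s>d/2$, is given by the same formula. *)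

(* Defs.v *)
From HB Require Import structures.
From mathcomp Require Import all_boot all_order all_algebra.
From mathcomp Require Import complex.
From mathcomp Require Import all_classical all_reals all_analysis measurable_realfun.
From mathcomp Require Import ring.

Set Implicit Arguments.
Unset Strict Implicit.
Unset Printing Implicit Defensive.
Import Order.TTheory GRing.Theory Num.Theory.
Import numFieldNormedType.Exports.
Local Open Scope classical_set_scope.
Local Open Scope ring_scope.

Definition rV_display : measure_display. Proof. exact: default_measure_display. Qed.

(* The sigma-algebra on ['rV[R]_n] generated by the coordinates, i.e., the Borel
   sigma-algebra of R^n. *)
Section measurable_rV.
Context {R : realType} (n : nat).

Let coord : 'I_n -> 'rV[R]_n -> measurableTypeR R := fun i x => x 0 i.

Let rV_set0 : g_sigma_preimage coord set0.
Proof. exact: sigma_algebra0. Qed.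

Let rV_setC A : g_sigma_preimage coord A -> g_sigma_preimage coord (~` A).
Proof. exact: sigma_algebraC. Qed.

Let rV_bigcup (F : (set 'rV[R]_n)^nat) : (forall i, g_sigma_preimage coord (F i)) ->
  g_sigma_preimage coord (\bigcup_i (F i)).
Proof. exact: sigma_algebra_bigcup. Qed.

HB.instance Definition _ := @isMeasurable.Build rV_display
  'rV[R]_n (g_sigma_preimage coord) rV_set0 rV_setC rV_bigcup.

End measurable_rV.

Lemma measurable_coord {R : realType} n (i : 'I_n) :
  measurable_fun [set: 'rV[R]_n] (fun x => x 0 i : measurableTypeR R).
Proof.
move=> _ Y mY; rewrite setTI; apply: sub_sigma_algebra => /=.
rewrite -bigcup_seq/=; exists i => /=; first by rewrite mem_index_enum.
by exists Y => //; rewrite setTI.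
Qed.

Lemma measurable_fun_rV {R : realType} d (T : measurableType d) n
    (f : T -> 'rV[R]_n) :
  (forall i, measurable_fun [set: T] (fun t => f t 0 i : measurableTypeR R)) ->
  measurable_fun [set: T] f.
Proof.
move=> mf.
suff mfV Y : measurable Y -> measurable (f @^-1` Y).
  by move=> _ Y mY; rewrite setTI; exact: mfV.
move: Y; apply: smallest_sub => /=.
  split=> [|A mA|F mF] /=.
  - by rewrite preimage_set0.
  - by rewrite setTD preimage_setC; exact: measurableC.
  - by rewrite preimage_bigcup; apply: bigcupT_measurable => k; exact: mF.
move=> A; rewrite -bigcup_seq/= => -[i _ [B mB <-]]; rewrite /= setTI.
by have := mf i measurableT B mB; rewrite setTI.
Qed.

(* The torus T^n is identified with [0, 2 pi]^n: functions on T^n are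
   represented by functions on R^n, and [torus_measure n] is the n-dimensional
   Lebesgue measure restricted to [0, 2 pi]^n, built as an iterated product. *)
Section torus_measure.
Context {R : realType}.

Let circle : set (measurableTypeR R) := `[0, 2 * pi]%classic.

Let measurable_circle : measurable circle. Proof. exact: measurable_itv. Qed.

Let circle_fin : (lebesgue_measure circle < +oo)%E.
Proof.
by rewrite /circle lebesgue_measure_itv/=; case: ifPn => // _; rewrite -EFinB ltry.
Qed.

Let circle_measure := mfrestr measurable_circle circle_fin.

Section step.
Variable (n : nat) (mu : {finite_measure set 'rV[R]_n -> \bar R}).

Let rV_cons (p : measurableTypeR R * 'rV[R]_n) : 'rV[R]_n.+1 :=
  row_mx (const_mx p.1 : 'rV[R]_1) p.2.

Let measurable_rV_cons : measurable_fun [set: _] rV_cons.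
Proof.
apply: measurable_fun_rV => i; rewrite /rV_cons.
have <- : fintype.unsplit (fintype.split (i : 'I_(1 + n))) = i by exact: fintype.splitK.
case: (fintype.split _) => j /=.
  rewrite [X in measurable_fun _ X](_ : _ = fst); first exact: measurable_fst.
  by apply/funext => p; rewrite [LHS](row_mxEl (const_mx p.1) p.2) mxE.
rewrite [X in measurable_fun _ X](_ : _ =
    (fun x : 'rV[R]_n => x 0 j : measurableTypeR R) \o snd).
  by apply: measurableT_comp; [exact: measurable_coord|exact: measurable_snd].
by apply/funext => p; rewrite [LHS](row_mxEr (const_mx p.1) p.2).
Qed.

HB.instance Definition _ :=
  isMeasurableFun.Build _ _ _ _ rV_cons measurable_rV_cons.

Definition torus_measureS := pushforward (circle_measure \x mu)%E rV_cons.

Let torus_measureS0 : torus_measureS set0 = 0%E.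
Proof. by rewrite /torus_measureS /pushforward preimage_set0 measure0. Qed.

Let torus_measureS_ge0 A : (0 <= torus_measureS A)%E.
Proof. exact: measure_ge0. Qed.

Let torus_measureS_sigma_additive : semi_sigma_additive torus_measureS.
Proof. exact: measure_semi_sigma_additive. Qed.

HB.instance Definition _ := isMeasure.Build _ _ _ torus_measureS
  torus_measureS0 torus_measureS_ge0 torus_measureS_sigma_additive.

Let torus_measureS_fin : fin_num_fun torus_measureS.
Proof.
move=> A mA; rewrite ge0_fin_numE ?measure_ge0//.
apply: (@le_lt_trans _ _ (torus_measureS setT)).
  by apply: le_measure; rewrite ?inE.
rewrite /torus_measureS /pushforward preimage_setT -setXTT.
rewrite product_measure1E// lte_mul_pinfty// ?fin_num_measure//.
by rewrite ltey_eq fin_num_measure.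
Qed.

HB.instance Definition _ :=
  Measure_isFinite.Build _ _ _ torus_measureS torus_measureS_fin.

End step.

Fixpoint torus_measure n : {finite_measure set 'rV[R]_n -> \bar R} :=
  if n is n'.+1 then torus_measureS (torus_measure n') else \d_(0 : 'rV[R]_0).

End torus_measure.

Section fourier.
Context {R : realType}.

Definition dotZ d (k : 'rV[int]_d) (x : 'rV[R]_d) : R :=
  \sum_(i < d) (k 0 i)%:~R * x 0 i.

(* e^(i t) *)
Definition expi (t : R) : R[i] := Complex (cos t) (sin t).

Definition cintegral d (f : 'rV[R]_d -> R[i]) : R[i] :=
  Complex (\int[torus_measure d]_x complex.Re (f x))
          (\int[torus_measure d]_x complex.Im (f x)).

Definition fourier d (v : 'rV[R]_d -> R) (k : 'rV[int]_d) : R[i] :=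
  ((2 * pi) ^- d)%:C%C * cintegral (fun x => (v x)%:C%C * expi (- dotZ k x)).

Definition fourier_vec d m (v : 'rV[R]_d -> 'cV[R]_m) (k : 'rV[int]_d) :
    'cV[R[i]]_m :=
  \col_i fourier (fun x => v x i 0) k.

Definition enorm d (k : 'rV[int]_d) : R :=
  Num.sqrt (\sum_(i < d) (k 0 i)%:~R ^+ 2).

(* [powR] satisfies [0 `^ 0 = 1], so that for [s = 0] every mode, including
   [k = 0], has weight [2] and the norm is the L^2-norm. *)
Definition sobolev_norm d m (s : R) (v : 'rV[R]_d -> 'cV[R]_m) : \bar R :=
  sqrte (((2 * pi) ^+ d / 2)%:E *
    \esum_(k in [set: 'rV[int]_d])
      ((1 + enorm k `^ (2 * s)) *
       \sum_(i < m) Normc.normc (fourier_vec v k i 0) ^+ 2)%:E)%E.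

End fourier.

(* H^s(T^d; R^m): vectors of genuine L^2 classes (almost everywhere equality is
   quotiented out) whose Sobolev norm is finite.  The norm only depends on the
   classes, so it is computed on their chosen representatives. *)
Record sobolev (R : realType) (d m : nat) (s : R) := Sobolev {
  sobolev_class : 'I_m -> LspaceType2 (@torus_measure R d) ;
  sobolev_finite :
    (sobolev_norm s (fun x => \col_i sobolev_class i x) < +oo)%E }.

Definition sobolev_fun (R : realType) d m (s : R) (u : sobolev d m s) (x : 'rV[R]_d) :
    'cV[R]_m :=
  \col_i sobolev_class u i x.
Coercion sobolev_fun : sobolev >-> Funclass.

(* H^s carries the metric [sobolev_norm s (u - v)]; [continuous] and [compact]
   on [sobolev d m s] refer to the resulting pseudoMetricType structure. *)
Section sobolev_topology.
Context {R : realType} {d m : nat} {s : R}.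
Local Notation mu := (@torus_measure R d).

Let torus_measurable_dotZ (k : 'rV[int]_d) :
  measurable_fun [set: 'rV[R]_d] (dotZ k).
Proof.
apply: measurable_sum => i; apply: measurable_funM; first exact: measurable_cst.
exact: measurable_coord.
Qed.

Let L2_integrable (f : LspaceType2 mu) : mu.-integrable setT (EFin \o f).
Proof.
apply/Lfun1_integrable; apply: Lfun_subset12; first exact: fin_num_measure.
rewrite inE; apply/andP; split; rewrite inE /=.
  exact: (@measurable_funPT _ _ _ _ (repr (f : {mfun_ mu, _ >-> measurableTypeR R}))).

exact: Lebesgue_finite.
Qed.

Let integrable_mul (f : LspaceType2 mu) (h : 'rV[R]_d -> R) :
  measurable_fun setT h -> (forall x, `|h x| <= 1) ->
  mu.-integrable setT (EFin \o (fun x => f x * h x)).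
Proof.
move=> mh h1.
have := @integrableMl _ _ _ mu setT measurableT _ h (L2_integrable f) mh.
apply; exists 1; split=> // M M1 x _ /=; apply: le_trans (h1 x) _; exact: ltW.
Qed.

Let fourierB (f g : LspaceType2 mu) k :
  fourier (fun x => f x - g x) k = fourier f k - fourier g k.
Proof.
have mc : measurable_fun setT (fun x : 'rV[R]_d => cos (- dotZ k x)).
  apply: (measurableT_comp (continuous_measurable_fun (@continuous_cos R))).
  exact: measurableT_comp.
have ms : measurable_fun setT (fun x : 'rV[R]_d => sin (- dotZ k x)).
  apply: (measurableT_comp (continuous_measurable_fun (@continuous_sin R))).
  exact: measurableT_comp.
rewrite /fourier -mulrBr; congr (_ * _); rewrite /cintegral.
have E (h : 'rV[R]_d -> R) : 
  (\int[mu]_x complex.Re ((h x)%:C%C * expi (- dotZ k x)) =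
     \int[mu]_x (h x * cos (- dotZ k x))) *
  (\int[mu]_x complex.Im ((h x)%:C%C * expi (- dotZ k x)) =
     \int[mu]_x (h x * sin (- dotZ k x))).
  by split; apply: eq_Rintegral => x _ /=; rewrite mul0r ?subr0 ?addr0.
rewrite !E; congr Complex.
  rewrite -RintegralB//; last 2 first.
  - by apply: integrable_mul => // x; exact: cos_max.
  - by apply: integrable_mul => // x; exact: cos_max.
  by apply: eq_Rintegral => x _; rewrite mulrBl.
rewrite -RintegralB//; last 2 first.
- by apply: integrable_mul => // x; exact: sin_max.
- by apply: integrable_mul => // x; exact: sin_max.
by apply: eq_Rintegral => x _; rewrite mulrBl.
Qed.

Let normc_sqr (z : R[i]) :
  Normc.normc z ^+ 2 = complex.Re z ^+ 2 + complex.Im z ^+ 2.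
Proof. by case: z => x y; rewrite sqr_sqrtr// addr_ge0// sqr_ge0. Qed.

Let sqrD_le (t x y : R) : 0 < t ->
  (x + y) ^+ 2 <= (1 + t) * x ^+ 2 + (1 + t^-1) * y ^+ 2.
Proof.
move=> t0; rewrite -subr_ge0.
have -> : (1 + t) * x ^+ 2 + (1 + t^-1) * y ^+ 2 - (x + y) ^+ 2 =
          t * (x - t^-1 * y) ^+ 2 by field; rewrite gt_eqF.
by rewrite mulr_ge0 ?sqr_ge0// ltW.
Qed.

Let normc_sqrD_le (t : R) (z w : R[i]) : 0 < t ->
  Normc.normc (z + w) ^+ 2 <=
  (1 + t) * Normc.normc z ^+ 2 + (1 + t^-1) * Normc.normc w ^+ 2.
Proof.
move=> t0; rewrite !normc_sqr !raddfD/=.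
have := lerD (sqrD_le (complex.Re z) (complex.Re w) t0)
             (sqrD_le (complex.Im z) (complex.Im w) t0).
move/le_trans; apply; rewrite le_eqVlt; apply/orP; left; apply/eqP; ring.
Qed.

Let weight (k : 'rV[int]_d) : R := 1 + enorm k `^ (2 * s).

Let weight_ge0 k : 0 <= weight k.
Proof. by rewrite addr_ge0// powR_ge0. Qed.

Let mass (c : 'rV[int]_d -> 'cV[R[i]]_m) (k : 'rV[int]_d) : R :=
  weight k * \sum_(i < m) Normc.normc (c k i 0) ^+ 2.

Let mass_ge0 c k : 0 <= mass c k.
Proof. by rewrite mulr_ge0// sumr_ge0// => i _; rewrite sqr_ge0. Qed.

Let massD_le (t : R) c c' k : 0 < t ->
  mass (fun k => c k + c' k) k <= (1 + t) * mass c k + (1 + t^-1) * mass c' k.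
Proof.
move=> t0; rewrite /mass !(mulrCA _ (weight k)) -mulrDr ler_wpM2l//.
rewrite !mulr_sumr -big_split ler_sum//= => i _.
by rewrite mxE normc_sqrD_le.
Qed.

Let energy c : \bar R :=
  (((2 * pi) ^+ d / 2)%:E * \esum_(k in [set: 'rV[int]_d]) (mass c k)%:E)%E.

Let vol_gt0 : 0 < (2 * pi) ^+ d / 2 :> R.
Proof. by rewrite divr_gt0// exprn_gt0// mulr_gt0// pi_gt0. Qed.

Let energy_ge0 c : (0 <= energy c)%E.
Proof.
rewrite mule_ge0 ?lee_fin ?(ltW vol_gt0)//.
by apply: esum_ge0 => k _; rewrite lee_fin.
Qed.

Let esumZ_le (a : R) (f : 'rV[int]_d -> R) : 0 <= a -> (forall k, 0 <= f k) ->
  (\esum_(k in [set: 'rV[int]_d]) (a * f k)%:E <=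
   a%:E * \esum_(k in [set: 'rV[int]_d]) (f k)%:E)%E.
Proof.
move=> a0 f0; apply: ub_ereal_sup => _ [A [finA AT] <-].
rewrite [leLHS](_ : _ = (a%:E * \sum_(k \in A) (f k)%:E)%E); last first.
  by rewrite ge0_mule_fsumr// => k; rewrite lee_fin.
by apply: lee_wpmul2l; rewrite ?lee_fin//; apply: ereal_sup_ubound; exists A.
Qed.

Let energyD_le (t : R) (c c' : 'rV[int]_d -> 'cV[R[i]]_m) : 0 < t ->
  (energy (fun k => c k + c' k)%R <=
   (1 + t)%:E * energy c + (1 + t^-1)%:E * energy c')%E.
Proof.
move=> t0; have t1 : 0 <= 1 + t by rewrite addr_ge0// ltW.
have t1' : 0 <= 1 + t^-1 by rewrite addr_ge0// invr_ge0 ltW.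
rewrite /energy !(muleCA (1 + _)%:E) -ge0_muleDr; last 2 first.
- by rewrite mule_ge0 ?lee_fin//; apply: esum_ge0 => k _; rewrite lee_fin.
- by rewrite mule_ge0 ?lee_fin//; apply: esum_ge0 => k _; rewrite lee_fin.
apply: lee_wpmul2l; first by rewrite lee_fin ltW.
apply: le_trans (leeD (esumZ_le t1 (mass_ge0 c)) (esumZ_le t1' (mass_ge0 c'))).
rewrite -esumD; last 2 first.
- by move=> k _; rewrite lee_fin mulr_ge0.
- by move=> k _; rewrite lee_fin mulr_ge0.
by apply: le_esum => k _; rewrite -EFinD lee_fin massD_le.
Qed.

Let sqrte_lt (x : \bar R) (e : R) : (0 <= x)%E ->
  (sqrte x < e%:E)%E <-> 0 < e /\ (x < (e ^+ 2)%:E)%E.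
Proof.
case: x => [r r0|_|//]; last by split=> [|[_]]; rewrite /= ltNge ?leey.
rewrite /= !lte_fin; rewrite lee_fin in r0; split=> [re|[e0 re]].
  have e0 : 0 < e by apply: le_lt_trans re; exact: sqrtr_ge0.
  by split=> //; rewrite -(sqr_sqrtr r0) ltr_pXn2r// ?nnegrE ?sqrtr_ge0// ltW.
by rewrite -(ger0_norm (ltW e0)) -sqrtr_sqr ltr_sqrt// exprn_gt0.
Qed.

Let sobolev_diff (u v : sobolev d m s) (x : 'rV[R]_d) : 'cV[R]_m := u x - v x.

Let coef (u : sobolev d m s) (k : 'rV[int]_d) := fourier_vec u k.

Let mxB (S : zmodType) (A B : 'cV[S]_m) i : (A - B) i 0 = A i 0 - B i 0.
Proof. by rewrite !mxE. Qed.

Let coefE u k i : coef u k i 0 = fourier (sobolev_class u i) k.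
Proof. by rewrite mxE; congr (fourier _ k); apply/funext => x; rewrite mxE. Qed.

Let sobolev_diffE u v :
  sobolev_norm s (sobolev_diff u v) = sqrte (energy (fun k => coef u k - coef v k)).
Proof.
congr (sqrte (_ * _))%E; apply: eq_esum => k _; congr (_ * _)%:E.
apply: eq_bigr => i _; congr (Normc.normc _ ^+ 2).
apply: etrans (esym (mxB (coef u k) (coef v k) i)).
transitivity (fourier (sobolev_class u i) k - fourier (sobolev_class v i) k);
  last by congr (_ - _); exact/esym/coefE.
apply: etrans (fourierB (sobolev_class u i) (sobolev_class v i) k).
rewrite mxE; congr (fourier _ k); apply/funext => x.
by rewrite [LHS](mxB (u x) (v x) i); congr (_ - _); rewrite mxE.
Qed.

Let sob_ball (u : sobolev d m s) (e : R) : set (sobolev d m s) :=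
  [set v | (sobolev_norm s (fun x => u x - v x)%R < e%:E)%E].

Let sob_ballE u e v : sob_ball u e v <->
  0 < e /\ (energy (fun k => coef u k - coef v k)%R < (e ^+ 2)%:E)%E.
Proof.
by rewrite /sob_ball /= -[X in sobolev_norm _ X]/(sobolev_diff u v) sobolev_diffE;
  exact: sqrte_lt.
Qed.

Let sob_ball_center u (e : R) : 0 < e -> sob_ball u e u.
Proof.
move=> e0; apply/sob_ballE; split=> //.
rewrite /energy esum1 ?mule0 ?lte_fin ?exprn_gt0// => k _.
by rewrite /mass big1 ?mulr0// => i _; rewrite subrr mxE Normc.normc0 expr0n.
Qed.

Let energy_sym (c c' : 'rV[int]_d -> 'cV[R[i]]_m) :
  energy (fun k => c k - c' k) = energy (fun k => c' k - c k).
Proof.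
rewrite /energy; congr mule; apply: eq_esum => k _; congr EFin.
rewrite /mass; congr (_ * _); apply: eq_bigr => i _.
by rewrite !mxB -opprB !normc_sqr !raddfN/= !sqrrN.
Qed.

Let sob_ball_sym u v (e : R) : sob_ball u e v -> sob_ball v e u.
Proof. by move=> /sob_ballE uv; apply/sob_ballE; rewrite (energy_sym (coef v) (coef u)). Qed.

Let sob_ball_triangle u v w (e1 e2 : R) :
  sob_ball u e1 v -> sob_ball v e2 w -> sob_ball u (e1 + e2) w.
Proof.
move=> /sob_ballE[e10 uv] /sob_ballE[e20 vw]; apply/sob_ballE.
split; first exact: addr_gt0.
have t0 : 0 < e2 / e1 by exact: divr_gt0.
have -> : (fun k => coef u k - coef w k) =
    (fun k => (coef u k - coef v k) + (coef v k - coef w k)).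
  by apply/funext => k; rewrite addrA subrK.
apply: le_lt_trans (energyD_le _ _ t0) _.
have -> : ((e1 + e2) ^+ 2)%:E = ((1 + e2 / e1)%:E * (e1 ^+ 2)%:E +
    (1 + (e2 / e1)^-1)%:E * (e2 ^+ 2)%:E)%E.
  by rewrite -!EFinM -EFinD; congr EFin; field; rewrite !gt_eqF.
apply: lteD; rewrite lte_pmul2l// lte_fin addr_gt0// ?invr_gt0//.
Qed.

HB.instance Definition _ := gen_eqMixin (sobolev d m s).
HB.instance Definition _ := gen_choiceMixin (sobolev d m s).

Let sob_ent : set_system (sobolev d m s * sobolev d m s) := entourage_ sob_ball.
Let sob_nbhs (u : sobolev d m s) : set_system (sobolev d m s) := nbhs_ sob_ent u.

HB.instance Definition _ := hasNbhs.Build (sobolev d m s) sob_nbhs.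

HB.instance Definition _ := @Nbhs_isPseudoMetric.Build R (sobolev d m s)
  sob_ent erefl sob_ball sob_ball_center sob_ball_sym sob_ball_triangle erefl.

Lemma sobolev_ballE (u v : sobolev d m s) (e : R) :
  ball u e v = (sobolev_norm s (fun x => u x - v x)%R < e%:E)%E.
Proof. by []. Qed.

End sobolev_topology.

Section psi_fno.
Context {R : realType}.

Definition torus_periodic d (T : Type) (v : 'rV[R]_d -> T) : Prop :=
  forall (x : 'rV[R]_d) (k : 'rV[int]_d),
    v (x + \row_i (2 * pi * (k 0 i)%:~R)) = v x.

(* C(T^d; R^m) *)
Definition continuous_torus d m : set ('rV[R]_d -> 'cV[R]_m) :=
  [set v | continuous v /\ torus_periodic v].

(* The embedding of H^s in C(T^d) for s > d / 2: the unique continuous periodic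
   function in the class of [u] (junk when there is none). *)
Definition continuous_repr d m (s : R) (u : sobolev d m s) :
    'rV[R]_d -> 'cV[R]_m :=
  xget (fun=> 0) [set v | @continuous_torus d m v /\
                          {ae torus_measure d, forall x, v x = u x}].

(* |k|_oo <= N *)
Definition box d (N : nat) : set 'rV[int]_d :=
  [set k : 'rV[int]_d | forall i, (`|k 0%R i| <= N)%N].

(* L^2_N(T^d): real-valued trigonometric polynomials of degree at most N. *)
Definition trig_poly d (N : nat) : set ('rV[R]_d -> R) :=
  [set p | exists c : 'rV[int]_d -> R[i], forall x,
     (p x)%:C%C = \sum_(k \in box N) c k * expi (dotZ k x)].

Definition grid d (N : nat) (j : 'rV['I_(2 * N).+1]_d) : 'rV[R]_d :=
  \row_i (2 * pi * (j 0 i)%:R / (2 * N).+1%:R).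

(* The pseudo-spectral projection I_N, first for scalar functions and then
   componentwise: the unique element of L^2_N that agrees with [v] on the grid. *)
Definition interp1 d (N : nat) (v : 'rV[R]_d -> R) : 'rV[R]_d -> R :=
  xget (fun=> 0) [set p | @trig_poly d N p /\
                          forall j, p (@grid d N j) = v (grid j)].

Definition interp d m (N : nat) (v : 'rV[R]_d -> 'cV[R]_m) (x : 'rV[R]_d) :
    'cV[R]_m :=
  \col_i interp1 N (fun y => v y i 0) x.

End psi_fno.

(* Only the values of [layer_P] on [box N] are used; the symmetry hypothesis makes
   the inverse Fourier transform in [layer_eval] real-valued, so that taking the
   real part there is a mere change of type. *)
Record fno_layer (R : realType) (d dv N : nat) := FnoLayer {
  layer_W : 'M[R]_dv ;
  layer_b : 'rV[R]_d -> 'cV[R]_dv ;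
  layer_b_continuous : continuous_torus layer_b ;
  layer_P : 'rV[int]_d -> 'M[R[i]]_dv ;
  layer_P_herm :
    forall k, box N k -> layer_P (- k) = map_mx conjc (layer_P k) }.

Definition layer_eval (R : realType) d dv N (sigma : R -> R)
    (l : fno_layer R d dv N) (v : 'rV[R]_d -> 'cV[R]_dv) (x : 'rV[R]_d) :
    'cV[R]_dv :=
  map_mx sigma (layer_W l *m v x + layer_b l x +
    map_mx (@complex.Re R)
      (\sum_(k \in box N) expi (dotZ k x) *: (layer_P l k *m fourier_vec v k))).

Record psi_fno (R : realType) (d da du N : nat) := PsiFno {
  fno_dv : nat ;
  fno_dv_ge : (du <= fno_dv)%N ;
  fno_R : 'M[R]_(fno_dv, da) ;
  fno_layers : seq (fno_layer R d fno_dv N) ;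
  fno_depth : (0 < size fno_layers)%N ;
  fno_Q : 'M[R]_(du, fno_dv) }.

(* Q o I_N o L_L o I_N o ... o L_1 o I_N o R; the head of [fno_layers] is L_1. *)
Definition fno_eval (R : realType) d da du N (sigma : R -> R)
    (net : psi_fno R d da du N) (a : 'rV[R]_d -> 'cV[R]_da) (x : 'rV[R]_d) :
    'cV[R]_du :=
  fno_Q net *m
    foldl (fun v l => interp N (layer_eval sigma l v))
          (interp N (fun y => fno_R net *m a y)) (fno_layers net) x.

Definition class_C (R : realType) (n : nat) (f : R -> R) : Prop :=
  (forall j, (j < n)%N -> forall x, derivable (derive1n j f) x 1) /\
  continuous (derive1n n f).

(* Main.v *)
(* One hidden layer suffices.  K and its image G(K) are compact, so finitely many Fourier
   coefficients of G(a) determine it up to a small H^s' error, uniformly in a in K.  Each of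
   these coefficients is a continuous function on K.  Linear combinations of functions
   exp(sum_q c_q a_(i_q)(x_q)), with points x_q of the grids of size 3^n, form an algebra;
   these grids are nested with dense union, so by the Sobolev embedding this algebra
   separates K, and Stone-Weierstrass applies.
   The locally uniform closure of the span of the functions t -> sigma(al t + be) contains
   the monomials, as derivatives in al of mollified units, and hence the exponential.
   An FNO layer of order N reads I_N a at arbitrary translates of the grid (a translation is
   a Fourier multiplier), and the values needed at a node are isolated by a bias.  A
   trigonometric polynomial of degree N that is small on the grid has small coefficients,
   which bounds the H^s' error of the network once N is fixed. *)

(* The network sees [a] only through its interpolant, yet no interpolation error is ever estimated:
   the exponential sums use values of [continuous_repr a] at grid points, where the interpolant
   agrees with [a] exactly. These sums must be found before the order of the network is known;
   nested grids allow the order to be raised afterwards without moving the points. The exponential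
   is chosen because one hidden unit acts on a single linear functional of [a], while
   Stone-Weierstrass needs products: exp turns a product of two such ridge functions into another
   one. Mollification is integration over a segment of length [h], so the derivative in [al] becomes
   the difference [g (x + h) - g x], which is again Lipschitz when [g] is, and the step can be
   iterated. The Sobolev embedding rests on the uniqueness of Fourier coefficients of integrable
   functions. It is obtained by showing that multiplication by the indicator of any measurable set
   preserves the functions with zero coefficients, and then multiplying such a function by its own
   sign. *)
Require Import Defs.
From HB Require Import structures.
From mathcomp Require Import all_boot all_order all_algebra.
From mathcomp Require Import complex.
From mathcomp Require Import all_classical all_reals all_analysis measurable_realfun.
From mathcomp Require Import ring lra zify.
Import Order.TTheory GRing.Theory Num.Theory.
Import numFieldNormedType.Exports.
Local Open Scope classical_set_scope.
Local Open Scope ring_scope.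
Set Implicit Arguments.
Unset Strict Implicit.
Unset Printing Implicit Defensive.

(** * Stone-Weierstrass *)

Section stone_weierstrass.
Context {R : realType}.

(* Increases to |t| uniformly on [-1, 1]: this puts |f| in the closure of the algebra. *)
Fixpoint abs_iter (n : nat) (t : R) : R :=
  if n is n'.+1 then abs_iter n' t + (t ^+ 2 - abs_iter n' t ^+ 2) / 2 else 0.

(** With [s] the absolute value and [y] the iterate, one step multiplies the error [e = s - y] by
    [1 - (s + y) / 2], which is at most [1 - e / 2] because [y >= 0]. The sequence [q = 2 / n.+2]
    satisfies [q * (1 - q / 2) <= 2 / n.+3], and [x * (1 - x / 2)] increases on [0, 1]. *)
Lemma abs_iter_bound n (t : R) : `|t| <= 1 ->
  0 <= abs_iter n t <= `|t| /\ `|t| - abs_iter n t <= 2 / n.+2%:R.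
Proof.
move=> t1.
elim: n => [|n [/andP[y0 yt] ye]].
  by rewrite /= lexx normr_ge0 subr0 divff ?pnatr_eq0.
rewrite [abs_iter _ _]/= -[t ^+ 2]real_normK ?num_real//.
move: (normr_ge0 t) t1 ye yt y0; set y := abs_iter n t; set s := `|t| => s0 t1 ye yt y0.
have sy : 0 <= (s - y) * (2 - s - y) by rewrite mulr_ge0//; lra.
have sy' : 0 <= (s - y) * (s + y) by rewrite mulr_ge0//; lra.
have n0 : 0 < n.+2%:R :> R by rewrite ltr0n.
have n3 : n.+3%:R = n.+2%:R + 1 :> R by rewrite -natr1.
split; first by apply/andP; split; nra.
set e := s - y in ye *; have e0 : 0 <= e by rewrite subr_ge0.
have e1 : e <= 1 by rewrite /e; lra.
have -> : s - (y + (s ^+ 2 - y ^+ 2) / 2) = e * (1 - (s + y) / 2) by rewrite /e; field.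
apply: (@le_trans _ _ (e * (1 - e / 2))).
  by rewrite ler_wpM2l// /e; lra.
set q := 2 / n.+2%:R in ye.
have q1 : q <= 1 by rewrite /q ler_pdivrMr// mul1r ler_nat.
apply: (@le_trans _ _ (q * (1 - q / 2))); first by nra.
have nn0 : n.+2%:R != 0 :> R by rewrite gt_eqF.
have nn1 : n.+2%:R + 1 != 0 :> R by rewrite gt_eqF// addr_gt0.
rewrite n3 -subr_ge0.
have -> : 2 / (n.+2%:R + 1) - q * (1 - q / 2) =
    2 / (n.+2%:R ^+ 2 * (n.+2%:R + 1)).
  by rewrite /q; move: (n.+2%:R : R) nn0 nn1 => m m0 m1; field; rewrite m0 m1.
by rewrite divr_ge0// mulr_ge0 ?exprn_ge0// ?ltW// addr_gt0.
Qed.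

Context {T : topologicalType}.

Lemma compact_fun_bounded (K : set T) (f : T -> R) : compact K -> continuous f ->
  exists2 B, 0 < B & forall x, K x -> `|f x| <= B.
Proof.
move=> cK cf.
have : compact (f @` K) by apply: continuous_compact => //; exact: continuous_subspaceT.
move=> /compact_bounded[M [_ /(_ (`|M| + 1))]].
have -> : M < `|M| + 1 by rewrite (le_lt_trans (ler_norm _))// ltrDl.
move=> /(_ isT) H; exists (`|M| + 1); first by rewrite ltr_wpDl.
by move=> x Kx; apply: H; exists x.
Qed.

(** Near each point of [K] some member of [S] beats [g], and so does every member above it. The
    upper sets of [S] generate a filter because [S] is closed under max; with it the near-covering
    form of compactness replaces the choice of a finite subcover. *)
Lemma compact_max_gt (K : set T) (g : T -> R) (S : set (T -> R)) :
  compact K -> K !=set0 -> continuous g ->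
  (forall f, S f -> continuous f) ->
  (forall f h, S f -> S h -> S (fun x => Num.max (f x) (h x))) ->
  (forall x, K x -> exists2 f, S f & g x < f x) ->
  exists2 f, S f & forall x, K x -> g x < f x.
Proof.
move=> cK [x0 Kx0] cg cS Smax H.
have [f0 Sf0 _] := H _ Kx0.
pose F : set_system (T -> R) :=
  [set B | exists2 f, S f & forall h, S h -> (forall z, f z <= h z) -> B h].
have FF : Filter F.
  split=> [|B C [f Sf fB] [h Sh hC]|B C BC [f Sf fB]].
  - by exists f0.
  - exists (fun x => Num.max (f x) (h x)); first exact: Smax.
    by move=> k Sk fhk; split; [apply: fB|apply: hC] => // z;
      rewrite (le_trans _ (fhk z))// le_max lexx ?orbT.
  - by exists f => // h Sh fh; apply: BC; exact: fB.
have /compact_near_coveringP/(_ _ F (fun h z => S h -> g z < h z) FF) := cK.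
case=> [x Kx|f Sf fP]; last first.
  by exists f => // x Kx; exact: (fP f Sf (fun=> lexx _)).
have [f Sf gf] := H _ Kx.
have fgt : \forall z \near x, g z < f z.
  have cfg : {for x, continuous (f \- g)} by apply: continuousB; [exact: cS|exact: cg].
  have : \forall z \near x, 0 < (f \- g) z by apply: (cvgr_gt _ cfg); rewrite /= subr_gt0.
  by apply: filterS => z /=; rewrite subr_gt0.
exists ([set z | g z < f z], [set h | forall z, f z <= h z]).
  by split=> //; exists f.
by move=> [z h] /= [gfz fh] Sh; exact: lt_le_trans gfz (fh z).
Qed.

Variables (K : set T) (A : set (T -> R)).
Hypothesis K_compact : compact K.
Hypothesis A_continuous : forall f, A f -> continuous f.
Hypothesis A_cst : forall c, A (fun=> c).
Hypothesis A_add : forall f g, A f -> A g -> A (fun x => f x + g x).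
Hypothesis A_mul : forall f g, A f -> A g -> A (fun x => f x * g x).

Let cl : set (T -> R) := [set f | continuous f /\
  forall e, 0 < e -> exists2 a, A a & forall x, K x -> `|f x - a x| <= e].

Let subA f : A f -> cl f.
Proof.
move=> Af; split; first exact: A_continuous.
by move=> e e0; exists f => // x _; rewrite subrr normr0 ltW.
Qed.

Let cl_lim f : continuous f ->
  (forall e, 0 < e -> exists2 g, cl g & forall x, K x -> `|f x - g x| <= e) -> cl f.
Proof.
move=> cf H; split=> // e e0.
have e20 : 0 < e / 2 by rewrite divr_gt0.
have [g [_ /(_ _ e20)[a Aa ga]] fg] := H _ e20.
exists a => // x Kx; rewrite (splitr e).
by rewrite (le_trans (ler_distD (g x) _ _))// lerD ?fg ?ga.
Qed.

Let clD f g : cl f -> cl g -> cl (fun x => f x + g x).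
Proof.
move=> [cf Hf] [cg Hg]; split; first by move=> x; apply: continuousD; [exact: cf|exact: cg].
move=> e e0; have e20 : 0 < e / 2 by rewrite divr_gt0.
have [a Aa fa] := Hf _ e20; have [b Ab gb] := Hg _ e20.
exists (fun x => a x + b x); first exact: A_add.
move=> x Kx; rewrite opprD addrACA (splitr e).
by rewrite (le_trans (ler_normD _ _))// lerD ?fa ?gb.
Qed.

Let clZ c f : cl f -> cl (fun x => c * f x).
Proof.
move=> [cf Hf]; split; first by move=> x; apply: continuousM; [exact: cvg_cst|exact: cf].
move=> e e0; have e20 : 0 < e / (`|c| + 1) by rewrite divr_gt0// ltr_wpDl.
have [a Aa fa] := Hf _ e20; exists (fun x => c * a x); first exact: A_mul.
move=> x Kx; rewrite -mulrBr normrM.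
apply: le_trans (_ : (`|c| + 1) * (e / (`|c| + 1)) <= _); last first.
  by rewrite mulrC divfK// gt_eqF// ltr_wpDl.
by rewrite ler_pM ?fa// lerDl.
Qed.

Let clabs f : cl f -> cl (fun x => `|f x|).
Proof.
move=> [cf Hf]; apply: cl_lim => [x|e /Hf[a Aa fa]].
  by apply: continuous_comp; [exact: cf|exact: norm_continuous].
exists (fun x => `|a x|); last first.
  by move=> x Kx; rewrite (le_trans (ler_dist_dist _ _))// fa.
split=> [x|{fa e} e e0].
  by apply: continuous_comp; [exact: A_continuous|exact: norm_continuous].
have [B B0 aB] := compact_fun_bounded K_compact (A_continuous Aa).
have [n Hn] : exists n, B * (2 / n.+2%:R) < e.
  have Be0 : 0 < e / (B * 2) by rewrite divr_gt0// mulr_gt0.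
  have [n _ /(_ n (leqnn n))/= H] := near_infty_natSinv_lt (PosNum Be0).
  exists n; rewrite mulrA mulrC -ltr_pdivlMr ?mulr_gt0//.
  by apply: le_lt_trans H; rewrite lef_pV2 ?posrE ?ltr0n// ler_nat.
have An : A (fun x => abs_iter n (a x / B)).
  have Ab : A (fun x => a x / B) by apply: A_mul.
  elim: n {Hn} => [|n IH] /=; first exact: A_cst.
  apply: A_add => //; apply: (@A_mul _ (fun=> 2^-1)) => //.
  apply: (@A_add _ (fun x => - abs_iter n (a x / B) ^+ 2)); first exact: A_mul.
  rewrite (_ : (fun x => _) = fun x => -1 * (abs_iter n (a x / B) * abs_iter n (a x / B))).
    by apply: A_mul => //; apply: A_mul.
  by apply/funext => x; rewrite mulN1r.
exists (fun x => B * abs_iter n (a x / B)); first exact: A_mul.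
move=> x Kx; have aB1 : `|a x / B| <= 1.
  by rewrite normrM normfV (gtr0_norm B0) ler_pdivrMr// mul1r aB.
have [/andP[y0 yt] ye] := abs_iter_bound n aB1.
have -> : `|a x| = B * `|a x / B|.
  by rewrite normrM normfV (gtr0_norm B0) mulrC divfK// gt_eqF.
rewrite -mulrBr normrM (gtr0_norm B0) ger0_norm ?subr_ge0//.
by apply: le_trans (ltW Hn); rewrite ler_pM2l.
Qed.

Let clN f : cl f -> cl (fun x => - f x).
Proof. by move=> /(clZ (-1)); under eq_fun do rewrite mulN1r. Qed.

Let clmax f g : cl f -> cl g -> cl (fun x => Num.max (f x) (g x)).
Proof.
move=> Hf Hg.
rewrite (_ : (fun x => _) = fun x => 2^-1 * ((f x + g x) + `|f x + - g x|)).
  apply: clZ; apply: clD; first exact: clD.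
  by apply: clabs; apply: clD => //; exact: clN.
by apply/funext => x; rewrite maxr_absE mulrC.
Qed.

(** Separation is asked only for pairs of points at which [g] differs. This form suits the
    pseudometric space [sobolev]: two elements at distance zero are separated by no continuous
    function, but a continuous [g] agrees on them. *)
Theorem stone_weierstrass (g : T -> R) : continuous g ->
  (forall p q, K p -> K q -> (exists2 f, A f & f p != f q) \/ g p = g q) ->
  forall e, 0 < e -> exists2 f, A f & forall x, K x -> `|g x - f x| <= e.
Proof.
move=> cg sep e e0.
have [K0|/set0P/negP/negPn/eqP K0] := pselect (K !=set0); last first.
  by exists (fun=> 0) => // x; rewrite K0.
have interp p q : K p -> K q -> exists f, [/\ A f, f p = g p & f q = g q].
  move=> Kp Kq; have [[f Af fpq]|gpq] := sep _ _ Kp Kq; last first.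
    by exists (fun=> g p).
  exists (fun x => g q + (f x + - f q) * ((g p - g q) / (f p - f q))).
  split; [by apply: A_add => //; apply: A_mul => //; apply: A_add| |].
    by rewrite mulrCA divff ?subr_eq0// mulr1 addrC subrK.
  by rewrite subrr mul0r addr0.
have e20 : 0 < e / 2 by rewrite divr_gt0.
have cgD c : continuous (fun x => g x + c).
  by move=> x; apply: continuousD; [exact: cg|exact: cvg_cst].
have cgN c : continuous (fun x => - (g x + c)).
  by move=> x; apply: cvgN; exact: cgD.
(* A minimum, over finitely many [q], of functions that interpolate [g] at [p] and [q]; it is
   obtained by maximizing their negatives. *)
have below p : K p -> exists2 f, cl f /\ f p = g p & forall x, K x -> f x < g x + e / 2.
  move=> Kp.
  have [|||f [Hf fp] fg] := @compact_max_gt K (fun x => - (g x + e / 2))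
    [set f | cl (fun x => - f x) /\ f p = - g p] K_compact K0 (cgN (e / 2)).
  - move=> f [[cf _] _] x.
    rewrite (_ : f = fun x => - - f x); first exact: cvgN (cf x).
    by apply/funext => z; rewrite opprK.
  - move=> f h [Hf fp] [Hh hp]; split; last by rewrite fp hp maxxx.
    rewrite (_ : (fun x => _) = fun x => Num.min (- f x) (- h x)); last first.
      by apply/funext => x; rewrite oppr_max.
    have := clmax (clN Hf) (clN Hh); move/clN.
    by under eq_fun do rewrite oppr_max !opprK; under eq_fun do rewrite ?opprK.
  - move=> q Kq; have [f [Af fp fq]] := interp _ _ Kp Kq.
    exists (fun x => - f x); last by rewrite fq ltrN2 ltrDl.
    by split; [under eq_fun do rewrite opprK; exact: subA|rewrite fp].
  exists (fun x => - f x); first by split=> //; rewrite fp opprK.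
  by move=> x Kx; rewrite ltrNl fg.
(* A maximum over finitely many [p] of the functions just built keeps the upper bound and exceeds
   [g - e / 2] on all of [K]. *)
have [|||f [Hf fg] gf] := @compact_max_gt K (fun x => g x - e / 2)
  [set f | cl f /\ forall x, K x -> f x < g x + e / 2] K_compact K0 (cgD (- (e / 2))).
- by move=> f [[]].
- move=> f h [Hf fp] [Hh hp]; split; first exact: clmax.
  by move=> x Kx; rewrite gt_max fp ?hp.
- move=> p Kp; have [f [Hf fp] fg] := below _ Kp; exists f => //.
  by rewrite fp ltrBlDr ltrDl.
have [_ /(_ _ e20)[a Aa fa]] := Hf; exists a => // x Kx.
rewrite (splitr e) (le_trans (ler_distD (f x) _ _))// lerD ?fa// ler_norml.
by have := fg _ Kx; have := gf _ Kx; rewrite ltrBlDr -ltrBlDl => h1 h2; apply/andP; split; lra.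
Qed.

End stone_weierstrass.

(** * Ridge functions *)

Section ridge_density.
Context {R : realType}.

(** By the mean value theorem the increment of the integral [G] is [g c * (y - x)] with [c] between
    [x] and [y], and replacing [c] by [x] costs [L * |y - x| ^+ 2]. This one estimate controls both
    the Riemann sums and the difference quotients in [ridge_weightS]. *)
Lemma lipschitz_antiderivative (g : R -> R) (L B : R) :
  (forall x y, `|g x - g y| <= L * `|x - y|) ->
  exists G : R -> R, forall x y, `|x| <= B -> `|y| <= B ->
    `|G y - G x - g x * (y - x)| <= L * `|y - x| ^+ 2.
Proof.
move=> Lg.
have [B0|B0] := ltP B 0.
  by exists g => x y /(le_trans (normr_ge0 _)); rewrite leNgt B0.
have cg : continuous g.
  move=> x; apply/cvgrPdist_le => e e0.
  have L1 : 0 < `|L| + 1 by rewrite ltr_wpDl.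
  near=> y; apply: le_trans (Lg x y) _.
  apply: (@le_trans _ _ ((`|L| + 1) * `|x - y|)).
    by rewrite ler_wpM2r// (le_trans (ler_norm _))// lerDl.
  rewrite mulrC -ler_pdivlMr//; near: y.
  by apply: cvgr_dist_le; [exact: cvg_id|rewrite divr_gt0].
(* One unit of room on each side puts all of [[-B, B]] inside the open interval where the
   fundamental theorem of calculus applies. *)
pose a := - B - 1; pose b := B + 1.
have ig : lebesgue_measure.-integrable `[a, b] (EFin \o g).
  by apply: continuous_compact_integrable; [exact: segment_compact|exact: continuous_subspaceT].
have [G dG] : exists G : R -> R, forall x, a < x < b -> is_derive x 1 G (g x).
  pose G (x : R) : R := \int[lebesgue_measure]_(t in `[a, x]) g t.
  exists G => x /andP[ax xb].
  have [dx GE] : derivable (G : R -> R) x 1 /\ derive1 (G : R -> R) x = g x.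
    exact: (@continuous_FTC1 R g (BLeft a) x b xb ig ax (cg x)).
  by apply: DeriveDef; [exact: dx|rewrite -derive1E; exact: GE].
exists G.
have mvt x y : `|x| <= B -> `|y| <= B -> x <= y ->
    exists2 c, x <= c <= y & G y - G x = g c * (y - x).
  rewrite !ler_norml => /andP[x1 x2] /andP[y1 y2] xy.
  have D z : z \in `[x, y] -> is_derive z 1 G (g z).
    by rewrite in_itv/= => /andP[xz zy]; apply: dG; apply/andP; split; rewrite /a /b; lra.
  have D' z : z \in `]x, y[ -> is_derive z 1 G (g z).
    by move=> zxy; apply: D; exact: subset_itv_oo_cc.
  have cG : {within `[x, y], continuous G}.
    by apply: derivable_within_continuous => z /D[].
  have [c + ->] := MVT_segment xy D' cG.
  by rewrite in_itv/= => cxy; exists c.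
have key x c y : `|c - x| <= `|y - x| ->
    `|g c * (y - x) - g x * (y - x)| <= L * `|y - x| ^+ 2.
  move=> cx; rewrite -mulrBl normrM expr2 mulrA ler_wpM2r//.
  have [L0|L0] := leP 0 L; first by rewrite (le_trans (Lg _ _))// ler_wpM2l.
  have gE u v : g u = g v.
    apply/eqP; rewrite -subr_eq0 -normr_le0 (le_trans (Lg _ _))//.
    by rewrite nmulr_rle0.
  have [->|/eqP nxy] := eqVneq y x; first by rewrite subrr normr0 mulr0 (gE c x) subrr normr0.
  have := Lg x y; rewrite (gE x y) subrr normr0 pmulr_lge0.
    by rewrite leNgt L0.
  by rewrite normr_gt0 subr_eq0; apply/eqP => h; apply: nxy.
move=> x y xB yB; have [xy|/ltW yx] := leP x y.
  have [c /andP[xc cy] ->] := mvt _ _ xB yB xy; apply: key.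
  by rewrite !ger0_norm ?subr_ge0// ?lerB// (le_trans xc).
have [c /andP[xc cy] h] := mvt _ _ yB xB yx.
have -> : G y - G x = g c * (y - x) by rewrite -opprB h -mulrN opprB.
apply: key; rewrite !ler0_norm ?subr_le0// ?lerN2 ?lerB// (le_trans xc)//.
Unshelve. all: by end_near. Qed.

Definition difference (h : R) (g : R -> R) : R -> R := fun x => g (x + h) - g x.

Definition lipschitz_fun (g : R -> R) := exists L, forall x y, `|g x - g y| <= L * `|x - y|.

Lemma difference_lipschitz h g : lipschitz_fun g -> lipschitz_fun (difference h g).
Proof.
move=> [L Lg]; exists (L + L) => x y; rewrite /difference.
have -> : g (x + h) - g x - (g (y + h) - g y) = (g (x + h) - g (y + h)) - (g x - g y) by ring.
rewrite (le_trans (ler_normB _ _))// mulrDl lerD//.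
by have := Lg (x + h) (y + h); rewrite opprD addrACA subrr addr0.
Qed.

Variable sigma : R -> R.
Hypothesis sigma_lip : lipschitz_fun sigma.

Definition ridge_sum (s : seq (R * R * R)) (t : R) : R :=
  \sum_(p <- s) p.1.1 * sigma (p.1.2 * t + p.2).

Definition ridge_limit (f : R -> R) : Prop := forall A e, 0 < A -> 0 < e ->
  exists s, forall t, `|t| <= A -> `|f t - ridge_sum s t| <= e.

Lemma ridge_limit_lim (f : R -> R) : (forall A e, 0 < A -> 0 < e ->
    exists2 g, ridge_limit g & forall t, `|t| <= A -> `|f t - g t| <= e) ->
  ridge_limit f.
Proof.
move=> H A e A0 e0; have e20 : 0 < e / 2 by rewrite divr_gt0.
have [g /(_ A (e / 2) A0 e20)[s gs] fg] := H A (e / 2) A0 e20.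
exists s => t tA; rewrite (splitr e) (le_trans (ler_distD (g t) _ _))//.
by rewrite lerD ?fg ?gs.
Qed.

Lemma ridge_limitD f g : ridge_limit f -> ridge_limit g -> ridge_limit (fun t => f t + g t).
Proof.
move=> Hf Hg A e A0 e0; have e20 : 0 < e / 2 by rewrite divr_gt0.
have [s fs] := Hf A (e / 2) A0 e20; have [r gr] := Hg A (e / 2) A0 e20.
exists (s ++ r) => t tA; rewrite /ridge_sum big_cat/= opprD addrACA (splitr e).
by rewrite (le_trans (ler_normD _ _))// lerD ?fs ?gr.
Qed.

Lemma ridge_limitZ c f : ridge_limit f -> ridge_limit (fun t => c * f t).
Proof.
move=> Hf A e A0 e0; have e20 : 0 < e / (`|c| + 1) by rewrite divr_gt0// ltr_wpDl.
have [s fs] := Hf A _ A0 e20; exists [seq (c * p.1.1, p.1.2, p.2) | p <- s] => t tA.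
rewrite /ridge_sum big_map/=; under eq_bigr do rewrite -mulrA.
rewrite -mulr_sumr -mulrBr normrM.
apply: le_trans (_ : (`|c| + 1) * (e / (`|c| + 1)) <= _); last first.
  by rewrite mulrC divfK// gt_eqF// ltr_wpDl.
by rewrite ler_pM ?fs// lerDl.
Qed.

Lemma ridge_limit_sum n (f : nat -> R -> R) : (forall i, (i < n)%N -> ridge_limit (f i)) ->
  ridge_limit (fun t => \sum_(i < n) f i t).
Proof.
elim: n => [_ A e A0 e0|n IH H].
  by exists [::] => t _; rewrite /ridge_sum big_nil big_ord0 subr0 normr0 ltW.
under eq_fun do rewrite big_ord_recr /=.
by apply: ridge_limitD; [apply: IH => i ni; apply: H; exact: ltnW|exact: H].
Qed.

(** All slopes and biases are quantified because the induction on [m] perturbs the slope [al] and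
    shifts the bias [be]. *)
Definition ridge_weight (m : nat) (g : R -> R) :=
  forall al be, ridge_limit (fun t => t ^+ m * g (al * t + be)).

Lemma ridge_weight0 : ridge_weight 0 sigma.
Proof.
move=> al be A e A0 e0; exists [:: (1, al, be)] => t _.
by rewrite /ridge_sum big_seq1 expr0 subrr normr0 ltW.
Qed.

(* [t ^+ m.+1 * difference h g (al * t + be)] is the derivative in [al] of the
   integral of [t ^+ m * g] over a segment of length [h] starting at [al * t + be],
   and that integral is a limit of Riemann sums. *)
Lemma ridge_weightS m g h : lipschitz_fun g -> ridge_weight m g ->
  ridge_weight m.+1 (difference h g).
Proof.
move=> [L0 Lg0] wg al be.
pose L := `|L0|; have Lg x y : `|g x - g y| <= L * `|x - y|.
  by rewrite (le_trans (Lg0 _ _))// ler_wpM2r// ler_norm.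
have L_ge0 : 0 <= L by exact: normr_ge0.
apply: ridge_limit_lim => A e A0 e0.
(* Bounds all arguments [t * (al + eta) + be] with [|eta| <= 1] and [|t| <= A], with room for shifts
   by [h]. *)
pose B := (`|al| + 1) * A + `|be| + 2 * `|h| + 1.
have [G HG] := lipschitz_antiderivative B Lg.
(* [t ^+ m] times the integral of [g] over the segment of length [h] starting at
   [t * (al + eta) + be], written with the primitive [G]. *)
pose F eta t := t ^+ m * (G (t * (al + eta) + be + h) - G (t * (al + eta) + be)).
have Bb eta t : `|eta| <= 1 -> `|t| <= A -> `|t * (al + eta) + be| <= B - 2 * `|h| - 1.
  move=> eta1 tA; have -> : B - 2 * `|h| - 1 = (`|al| + 1) * A + `|be| by rewrite /B; ring.
  rewrite (le_trans (ler_normD _ _))// lerD2r normrM mulrC.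
  by rewrite ler_pM// (le_trans (ler_normD _ _))// lerD2l.
have Bh (x y : R) : `|x| <= B - 2 * `|h| - 1 -> `|y| <= `|h| -> `|x + y| <= B.
  by move=> xB yh; rewrite (le_trans (ler_normD _ _))//; have := normr_ge0 h; lra.
(* Left Riemann sums: each of the [n.+1] steps of length [|d|] costs [L * |d| ^+ 2]. *)
have riemann n x : `|x| <= B - 2 * `|h| - 1 ->
    `|G (x + h) - G x - \sum_(i < n.+1) h / n.+1%:R * g (x + i%:R * (h / n.+1%:R))|
     <= L * h ^+ 2 / n.+1%:R.
  move=> xB; set d := h / n.+1%:R.
  have n0 : 0 < n.+1%:R :> R by rewrite ltr0n.
  have hE : h = n.+1%:R * d by rewrite /d mulrC divfK// gt_eqF.
  have -> : G (x + h) - G x = \sum_(i < n.+1) (G (x + i.+1%:R * d) - G (x + i%:R * d)).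
    rewrite -(big_mkord xpredT (fun i => G (x + i.+1%:R * d) - G (x + i%:R * d))).
    by rewrite telescope_sumr// mul0r addr0 -hE.
  rewrite -sumrB; apply: le_trans (ler_norm_sum _ _ _) _.
  apply: (@le_trans _ _ (\sum_(i < n.+1) L * `|d| ^+ 2)); last first.
    rewrite sumr_const card_ord -[leLHS]mulr_natl real_normK ?num_real// /d.
    rewrite le_eqVlt; apply/orP; left; apply/eqP; field.
    by rewrite addrC natr1 gt_eqF.
  apply: ler_sum => i _.
  have step j : (j <= n.+1)%N -> `|x + j%:R * d| <= B.
    move=> jn; apply: Bh => //; rewrite normrM ger0_norm//.
    have -> : `|h| = n.+1%:R * `|d| by rewrite {1}hE normrM (ger0_norm (ltW n0)).
    by rewrite ler_wpM2r// ler_nat.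
  have := HG _ _ (step i (ltnW (ltn_ord i))) (step i.+1 (ltn_ord i)).
  rewrite [x + i.+1%:R * d - _](_ : _ = d); first by rewrite [g _ * d]mulrC.
  by rewrite -natr1; ring.
have wFA eta : `|eta| <= 1 -> forall e', 0 < e' ->
    exists2 f, ridge_limit f & forall t, `|t| <= A -> `|F eta t - f t| <= e'.
  move=> eta1 e' e'0.
  pose C := A ^+ m * (L * h ^+ 2) + 1.
  have C0 : 0 < C.
    by rewrite ltr_wpDl// (mulr_ge0 (exprn_ge0 _ (ltW A0)) (mulr_ge0 L_ge0 (sqr_ge0 _))).
  have [n _ /(_ n (leqnn n))/= Hn] := near_infty_natSinv_lt (PosNum (divr_gt0 e'0 C0)).
  exists (fun t => \sum_(i < n.+1) h / n.+1%:R *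
    (t ^+ m * g ((al + eta) * t + (be + i%:R * (h / n.+1%:R))))).
    apply: (@ridge_limit_sum n.+1 (fun i t => h / n.+1%:R *
      (t ^+ m * g ((al + eta) * t + (be + i%:R * (h / n.+1%:R)))))) => i _.
    exact/ridge_limitZ/wg.
  move=> t tA; under eq_bigr do rewrite mulrCA.
  rewrite -mulr_sumr -mulrBr normrM normrX.
  under eq_bigr do rewrite addrA (mulrC _ t).
  apply: (@le_trans _ _ (A ^+ m * (L * h ^+ 2 / n.+1%:R))).
    by rewrite ler_pM ?exprn_ge0 ?lerXn2r ?nnegrE ?(ltW A0)//; exact/riemann/Bb.
  rewrite mulrA; apply: (@le_trans _ _ (C / n.+1%:R)).
    by rewrite ler_wpM2r ?invr_ge0 ?ler0n// lerDl.
  by move: Hn; rewrite ltr_pdivlMr// mulrC => /ltW.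
(* [D * eta] bounds the distance from [(F eta t - F 0 t) / eta] to the target, since the remainders
   at the two ends of the segment are at most [L * (eta * A) ^+ 2] each. [F] itself is approximated
   within [e / 4 * eta], because the division by [eta] magnifies that error. *)
pose D := A ^+ m * (2 * L * A ^+ 2) + 1.
have D0 : 0 < D.
  rewrite ltr_wpDl// (mulr_ge0 (exprn_ge0 _ (ltW A0)))//.
  by rewrite (mulr_ge0 _ (exprn_ge0 _ (ltW A0)))// mulr_ge0.
pose eta := Num.min 1 (e / 2 / D).
have eta0 : 0 < eta by rewrite lt_min ltr01 !divr_gt0.
have eta1 : `|eta| <= 1 by rewrite gtr0_norm// ge_min lexx.
have etaD : D * eta <= e / 2 by rewrite mulrC -ler_pdivlMr// ge_min lexx orbT.
have ee : 0 < e / 4 * eta by rewrite mulr_gt0// divr_gt0.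
have [f1 wf1 Ff1] := wFA eta eta1 _ ee.
have z1 : `|0 : R| <= 1 by rewrite normr0.
have [f0 wf0 Ff0] := wFA 0 z1 _ ee.
exists (fun t => eta^-1 * (f1 t + -1 * f0 t)).
  by apply: ridge_limitZ; apply: ridge_limitD => //; exact: ridge_limitZ.
move=> t tA.
rewrite (splitr e) mulN1r (le_trans (ler_distD (eta^-1 * (F eta t - F 0 t)) _ _))// lerD//.
  apply: le_trans etaD; rewrite -(ler_pM2l eta0).
  rewrite -[X in X * `|_|](gtr0_norm eta0) -normrM mulrBr mulVKf ?gt_eqF//.
  rewrite /F addr0 -mulrBr.
  set x := t * al + be.
  have xE : t * (al + eta) + be = x + eta * t by rewrite /x; ring.
  have x0B : `|x| <= B - 2 * `|h| - 1.
    by have := Bb 0 t; rewrite addr0 normr0 ler01; apply.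
  have x1B : `|x + eta * t| <= B - 2 * `|h| - 1 by rewrite -xE; exact: Bb.
  rewrite xE [al * t]mulrC -/x /difference.
  have h0 : `|0 : R| <= `|h| by rewrite normr0.
  have := HG x (x + eta * t); rewrite -[X in `|X| <= B](addr0 x) -[X in _ -> `|X| <= B -> _]addr0.
  move=> /(_ (Bh _ _ x0B h0) (Bh _ _ x1B h0)) E0.
  have := HG (x + h) (x + eta * t + h) (Bh _ _ x0B (lexx _)) (Bh _ _ x1B (lexx _)) => E1.
  rewrite [x + eta * t - x](_ : _ = eta * t) in E0; last by ring.
  rewrite [x + eta * t + h - _](_ : _ = eta * t) in E1; last by ring.
  rewrite [X in `|X|](_ : _ = t ^+ m *
     ((G (x + eta * t) - G x - g x * (eta * t)) -
      (G (x + eta * t + h) - G (x + h) - g (x + h) * (eta * t)))); last by rewrite exprS; ring.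
  rewrite normrM normrX.
  apply: (@le_trans _ _ (A ^+ m * (2 * L * A ^+ 2) * (eta ^+ 2))); last first.
    rewrite [leRHS](_ : _ = D * eta ^+ 2); last by ring.
    by rewrite ler_wpM2r ?sqr_ge0// lerDl.
  rewrite -!mulrA ler_pM ?exprn_ge0 ?lerXn2r ?nnegrE ?(ltW A0)//.
  apply: le_trans (ler_normB _ _) _; apply: le_trans (lerD E0 E1) _.
  rewrite [leLHS](_ : _ = 2 * (L * `|eta * t| ^+ 2)); last by ring.
  rewrite (mulrA A) -expr2 ler_wpM2l// ler_wpM2l//.
  rewrite normrM (gtr0_norm eta0) exprMn mulrC ler_wpM2r ?sqr_ge0//.
  by rewrite lerXn2r// nnegrE// ltW.
rewrite -mulrBr normrM gtr0_norm ?invr_gt0// mulrC ler_pdivrMr//.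
have -> : F eta t - F 0 t - (f1 t - f0 t) = (F eta t - f1 t) - (F 0 t - f0 t) by ring.
rewrite (le_trans (ler_normB _ _))// (le_trans (lerD (Ff1 _ tA) (Ff0 _ tA)))//; lra.
Qed.

Hypothesis sigma_nonaffine : ~ exists c0 c1, forall x, sigma x = c0 + c1 * x.

(** [f x - f 1 * x] is additive and vanishes at the integers, so it depends only on the fractional
    part of [x] and is bounded by the Lipschitz condition. Its values at the multiples [n * x] then
    show that it is zero. *)
Lemma lipschitz_additive_linear (f : R -> R) : lipschitz_fun f ->
  (forall x y, f (x + y) = f x + f y) -> forall x, f x = f 1 * x.
Proof.
move=> [L Lf] fD.
have f0 : f 0 = 0 by apply: (addrI (f 0)); rewrite -fD !addr0.
have fn n x : f (n%:R * x) = n%:R * f x.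
  elim: n => [|n IH]; first by rewrite !mul0r f0.
  by rewrite -natr1 !mulrDl !mul1r fD IH.
have fN x : f (- x) = - f x by apply: (addrI (f x)); rewrite -fD !subrr f0.
have fz (z : int) : f z%:~R = z%:~R * f 1.
  case: z => n; first by rewrite -[X in f X]mulr1 fn.
  by rewrite NegzE !mulrNz fN mulNr; congr (- _); rewrite -[X in f X]mulr1 fn.
pose C := `|L| + `|f 1|.
have bnd x : `|f x - f 1 * x| <= C.
  pose y := x - (Num.floor x)%:~R.
  have /andP[fl1 fl2] := real_floor_itv (num_real x).
  rewrite intrD in fl2.
  have y0 : `|y| <= 1 by rewrite ler_norml /y; apply/andP; split; lra.
  have -> : f x - f 1 * x = f y - f 1 * y.
    have {1}-> : x = y + (Num.floor x)%:~R by rewrite /y subrK.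
    by rewrite fD fz /y; ring.
  apply: le_trans (ler_normB _ _) _; apply: lerD.
    rewrite -[f y]subr0 -f0 (le_trans (Lf _ _))// subr0 -[leRHS]mulr1.
    by rewrite (le_trans (ler_norm _))// normrM ler_wpM2l// normr_id.
  by rewrite normrM -[leRHS]mulr1 ler_wpM2l.
move=> x; apply/eqP; rewrite -subr_eq0 -normr_le0 leNgt; apply/negP => u0.
have C1 : 0 < C + 1 by rewrite ltr_wpDl// addr_ge0.
have [n _ /(_ n (leqnn n))/= Hn] := near_infty_natSinv_lt (PosNum (divr_gt0 u0 C1)).
have := bnd (n.+1%:R * x); rewrite fn mulrCA -mulrBr normrM ger0_norm//.
move: Hn; rewrite ltr_pdivlMr// mulrC ltr_pdivrMr ?ltr0n// mulrC => h1 h2.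
by have := lt_le_trans h1 h2; rewrite gtrDl ltr10.
Qed.

(** If all second differences vanished, [f = sigma - sigma 0] would satisfy the midpoint equation;
    it would then be additive and, being Lipschitz, linear. *)
Lemma second_difference_neq0 : exists h x, difference h (difference h sigma) x != 0.
Proof.
apply: contrapT => H; apply: sigma_nonaffine.
have D0 h x : difference h (difference h sigma) x = 0.
  by apply: contrapT => /eqP Hn; apply: H; exists h, x.
pose f x := sigma x - sigma 0.
have [L Lf] := sigma_lip.
have lf : lipschitz_fun f by exists L => x y; rewrite /f opprB addrA subrK.
have dbl x h : f (x + h + h) + f x = 2 * f (x + h).
  have := D0 h x; rewrite /difference /f; lra.
have fD x y : f (x + y) = f x + f y.
  have f0 : f 0 = 0 by rewrite /f subrr.
  (* The pairs [x, y] and [0, x + y] have the same midpoint [x + h]. *)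
  pose h := (y - x) / 2.
  have e1 : x + h + h = y by rewrite /h; field.
  have e2 : 0 + (x + h) + (x + h) = x + y by rewrite /h; field.
  have := dbl x h; have := dbl 0 (x + h); rewrite e1 e2 f0 add0r; lra.
exists (sigma 0), (f 1) => x.
by rewrite -(lipschitz_additive_linear lf fD) /f addrC subrK.
Qed.

Lemma iter_difference_lipschitz h m : lipschitz_fun (iter m (difference h) sigma).
Proof. by elim: m => //= m; exact: difference_lipschitz. Qed.

Lemma difference_bounded h g : lipschitz_fun g -> exists C, forall x, `|difference h g x| <= C.
Proof.
move=> [L Lg]; exists (L * `|h|) => x; apply: le_trans (Lg _ _) _.
by rewrite [x + h]addrC addrK.
Qed.

(** Along the progression [x + n * h] the function [u] grows by the constant [difference h u x] at
    each step, so boundedness forces this constant to be zero. *)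
Lemma bounded_difference_eq0 h u : (exists C, forall x, `|u x| <= C) ->
  (forall x, difference h (difference h u) x = 0) -> forall x, difference h u x = 0.
Proof.
move=> [C uC] D0 x.
have step n : difference h u (x + n%:R * h) = difference h u x.
  elim: n => [|n <-]; first by rewrite mul0r addr0.
  apply/eqP; rewrite -subr_eq0; apply/eqP.
  by rewrite -[RHS](D0 (x + n%:R * h)) /difference -natr1 mulrDl mul1r addrA.
have lin n : u (x + n%:R * h) = u x + n%:R * difference h u x.
  elim: n => [|n IH]; first by rewrite !mul0r !addr0.
  have := step n; rewrite [LHS]/difference IH -natr1 !mulrDl !mul1r addrA.
  by set D := difference h u x; lra.
apply/eqP; rewrite -normr_le0 leNgt; apply/negP => u0.
have C0 : 0 <= C by rewrite (le_trans _ (uC 0)).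
have C1 : 0 < 2 * C + 1 by rewrite ltr_wpDl// mulr_ge0.
have [n _ /(_ n (leqnn n))/= Hn] := near_infty_natSinv_lt (PosNum (divr_gt0 u0 C1)).
have e1 : n.+1%:R * difference h u x = u (x + n.+1%:R * h) - u x.
  by rewrite lin addrC addKr.
have := le_trans (ler_normB _ _) (lerD (uC (x + n.+1%:R * h)) (uC x)).
rewrite -e1 normrM (ger0_norm (ler0n _ _)).
move: Hn; rewrite ltr_pdivlMr// mulrC ltr_pdivrMr ?ltr0n// mulrC => h1 h2.
lra.
Qed.

(** One [h] serves all [m]. Differences of Lipschitz functions are bounded, so an iterate of order
    at least 3 that vanishes identically makes the preceding one vanish, down to order 2, which the
    choice of [h] excludes. From orders 0 and 1 the vanishing propagates upwards to order 2. *)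
Lemma iter_difference_neq0 : exists h, forall m, exists x, iter m (difference h) sigma x != 0.
Proof.
have [h [x0 hx0]] := second_difference_neq0; exists h => m; apply: contrapT => H.
have {}H x : iter m (difference h) sigma x = 0.
  by apply: contrapT => /eqP Hn; apply: H; exists x.
have down n : (forall x, iter n.+3 (difference h) sigma x = 0) ->
    forall x, iter n.+2 (difference h) sigma x = 0.
  apply: bounded_difference_eq0; apply: difference_bounded.
  exact: iter_difference_lipschitz.
have up n : (forall x, iter n (difference h) sigma x = 0) ->
    forall x, iter n.+1 (difference h) sigma x = 0.
  by move=> Hn x; rewrite iterS {1}/difference !Hn subrr.
suff D2 x : iter 2 (difference h) sigma x = 0 by have := D2 x0 => /eqP; rewrite (negbTE hx0).
move: H x; case: m => [|[|n]].
- by move=> /up/up.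
- by move=> /up.
- by elim: n => [//|n IH] /down.
Qed.

Lemma ridge_limit_monomial m : ridge_limit (fun t => t ^+ m).
Proof.
have [h Hh] := iter_difference_neq0; have [x0 hx0] := Hh m.
have w : ridge_weight m (iter m (difference h) sigma).
  elim: m {hx0 Hh} => [|m IH]; first exact: ridge_weight0.
  exact: ridge_weightS (iter_difference_lipschitz _ _) IH.
(* Slope 0 and bias [x0] freeze the difference at a nonzero value, leaving a multiple of
   [t ^+ m]. *)
have := ridge_limitZ (iter m (difference h) sigma x0)^-1 (w 0 x0).
congr ridge_limit; apply/funext => t.
by rewrite mul0r add0r mulrCA mulVf// mulr1.
Qed.

Theorem ridge_limit_expR : ridge_limit expR.
Proof.
apply: ridge_limit_lim => A e A0 e0.
have cvgA : series (exp_coeff A) @ \oo --> expR A.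
  exact: is_cvg_series_exp_coeff.
have [n _ Hn] : \forall n \near \oo, `|expR A - series (exp_coeff A) n| <= e.
  by apply: cvgr_dist_le.
have {}Hn := Hn n (leqnn n).
exists (fun t => \sum_(i < n) i`!%:R^-1 * t ^+ i).
  apply: (@ridge_limit_sum n (fun i t => i`!%:R^-1 * t ^+ i)) => i _.
  exact/ridge_limitZ/ridge_limit_monomial.
move=> t tA.
have -> : \sum_(i < n) i`!%:R^-1 * t ^+ i = series (exp_coeff t) n.
  by rewrite /series/= big_mkord; apply: eq_bigr => i _; rewrite /exp_coeff/= mulrC.
have cvgt : `|series (exp_coeff t) N - series (exp_coeff t) n| @[N --> \oo] -->
    `|expR t - series (exp_coeff t) n|.
  by apply: cvg_norm; apply: cvgB; [exact: is_cvg_series_exp_coeff|exact: cvg_cst].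
have cvgA' : `|series (exp_coeff A) N - series (exp_coeff A) n| @[N --> \oo] -->
    `|expR A - series (exp_coeff A) n|.
  by apply: cvg_norm; apply: cvgB; [exact: is_cvg_series_exp_coeff|exact: cvg_cst].
(* For [|t| <= A] each term of the Taylor tail at [t] is dominated by the one at [A], so one [n]
   works for the whole interval. *)
apply: le_trans Hn; apply: (ler_cvg_to cvgt cvgA').
exists n => // N /= nN; rewrite !sub_series_geq//.
apply: le_trans (ler_norm_sum _ _ _) _; apply: le_trans (ler_norm _).
apply: ler_sum => i _; rewrite /exp_coeff/= normrM normrX normfV.
rewrite (ger0_norm (ler0n _ i`!)) ler_wpM2r ?invr_ge0 ?ler0n//.
by rewrite lerXn2r ?nnegrE// ltW.
Qed.

End ridge_density.

(** * Integration on the torus *)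

Section torus_integral.
Context {R : realType}.

(** [circle_measure] and [rV_cons] are copies, up to conversion, of section-local constants inside
    [torus_measure]; naming them exposes its product structure to Fubini. *)
Definition circle_measure : {finite_measure set (measurableTypeR R) -> \bar R} :=
  mfrestr (@Defs.measurable_circle_subproof R) (@Defs.circle_fin_subproof R).

Definition rV_cons n (p : measurableTypeR R * 'rV[R]_n) : 'rV[R]_n.+1 :=
  row_mx (const_mx p.1 : 'rV[R]_1) p.2.

Lemma torus_measureSE n (A : set 'rV[R]_n.+1) :
  torus_measure n.+1 A = (circle_measure \x torus_measure n)%E (@rV_cons n @^-1` A).
Proof. by []. Qed.

Lemma rV_cons0 n p : @rV_cons n p 0 ord0 = p.1.
Proof.
rewrite /rV_cons.
have -> : ord0 = lshift n (ord0 : 'I_1) :> 'I_(1 + n) by exact: val_inj.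
by rewrite [LHS](row_mxEl (const_mx p.1) p.2) mxE.
Qed.

Lemma rV_consS n p i : @rV_cons n p 0 (lift ord0 i) = p.2 0 i.
Proof.
rewrite /rV_cons.
have -> : lift ord0 i = rshift 1 i :> 'I_(1 + n) by exact: val_inj.
by rewrite [LHS](row_mxEr (const_mx p.1) p.2).
Qed.

Lemma measurable_rV_cons n : measurable_fun [set: _] (@rV_cons n).
Proof.
apply: measurable_fun_rV => i; have [j ->|->] := unliftP ord0 i.
  rewrite (_ : (fun _ => _) = (fun x : 'rV[R]_n => x 0 j : measurableTypeR R) \o snd).
    by apply: measurableT_comp; [exact: measurable_coord|exact: measurable_snd].
  by apply/funext => p; rewrite rV_consS.
rewrite (_ : (fun _ => _) = fst); first exact: measurable_fst.
by apply/funext => p; rewrite rV_cons0.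
Qed.

HB.instance Definition _ n :=
  isMeasurableFun.Build _ _ _ _ (@rV_cons n) (@measurable_rV_cons n).

Lemma torus_RintegralS n (f : 'rV[R]_n.+1 -> R) :
  measurable_fun setT f -> (exists B, forall x, `|f x| <= B) ->
  \int[torus_measure n.+1]_x f x =
  \int[circle_measure]_t \int[torus_measure n]_y f (rV_cons (t, y)).
Proof.
move=> mf [B fB].
have mfc : measurable_fun setT (f \o @rV_cons n).
  by apply: measurableT_comp => //; exact: measurable_rV_cons.
have bnd (T : Type) (h : T -> R) : (forall x, `|h x| <= B) -> [bounded h x | x in setT].
  by move=> hB; exists B; split=> [|M BM]; [exact: num_real|]; move=> x _; rewrite /= (le_trans (hB _))// ltW.
have ifc : (circle_measure \x torus_measure n)%E.-integrable setT (EFin \o (f \o @rV_cons n)).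
  apply: measurable_bounded_integrable => //; last by apply: bnd => x; exact: fB.
  apply: (@le_lt_trans _ _ (torus_measure n.+1 [set: 'rV[R]_n.+1])).
    by rewrite torus_measureSE.
  by rewrite ltey_eq fin_num_measure.
rewrite /Rintegral.
have -> : (\int[torus_measure n.+1]_x (f x)%:E =
    \int[circle_measure \x torus_measure n]_x (f (rV_cons x))%:E)%E.
  transitivity (\int[pushforward (circle_measure \x torus_measure n)%E (@rV_cons n)]_x (f x)%:E)%E.
    by apply: (eq_measure_integral (pushforward (circle_measure \x torus_measure n)%E (@rV_cons n))).
  rewrite [LHS](integral_pushforward (@measurable_rV_cons n) _ ifc)//.
  exact/measurable_EFinP.
rewrite -(integral12_prod_meas1 ifc); congr fine; apply: eq_integral => t _.
rewrite /fubini_F fineK// integrable_fin_num//.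
apply: measurable_bounded_integrable => //; last by apply: bnd => x; exact: fB.
  by rewrite ltey_eq fin_num_measure.
apply: measurableT_comp mf _.
by apply: measurableT_comp; [exact: measurable_rV_cons|exact: measurable_pair1].
Qed.

(** [circle_measure] is a measure on the whole line that vanishes off [0, 2 pi]; dropping the
    complement gives access to the fundamental theorem of calculus. *)
Lemma circle_RintegralE (f : R -> R) : continuous f ->
  \int[circle_measure]_t f t = \int[lebesgue_measure]_(t in `[0, 2 * pi]) f t.
Proof.
move=> cf; have mf : measurable_fun setT f by exact: continuous_measurable_fun.
rewrite /Rintegral; congr fine.
pose D : set (measurableTypeR R) := `[0, 2 * pi]%classic.
have mD : measurable D by exact: measurable_itv.
have N0 : circle_measure (~` D) = 0%E.
  by rewrite /circle_measure/= /mfrestr /mrestr setICl measure0.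
have mfE A : measurable_fun A (EFin \o f : measurableTypeR R -> \bar R).
  by apply/measurable_EFinP; exact: measurable_funTS.
have DD : [disjoint D & ~` D] by rewrite disj_set2E; apply/eqP; exact: setICr.
rewrite -(setUv D) (integral_setU _ mD (measurableC mD) (mfE _) DD).
rewrite [X in (_ + X)%E](null_set_integral (measurableC mD) (mfE _) N0) adde0.
apply: eq_measure_integral => A mA AD.
by rewrite /circle_measure/= /mfrestr /mrestr setIidl.
Qed.

Lemma circle_Rintegral_derive (f F : R -> R) : continuous f ->
  (forall x, is_derive x (1 : R) F (f x)) ->
  \int[circle_measure]_t f t = F (2 * pi) - F 0.
Proof.
move=> cf dF; rewrite circle_RintegralE// /Rintegral.
have cF x : {for x, continuous F}.
  by apply: differentiable_continuous; apply/derivable1_diffP; have [] := dF x.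
rewrite (@continuous_FTC2 _ f F)//=.
- by rewrite mulr_gt0// pi_gt0.
- exact: continuous_subspaceT.
- split=> [x _||]; first by have [] := dF x.
  + by apply: cvg_at_right_filter; exact: cF.
  + by apply: cvg_at_left_filter; exact: cF.
- by move=> x _; rewrite derive1E; have [] := dF x.
Qed.




Lemma sin_cos_2pi_int (k : int) : (sin (k%:~R * (2 * pi)) = 0 :> R) * (cos (k%:~R * (2 * pi)) = 1 :> R).
Proof.
have nat_case n : sin (n%:R * (2 * pi)) = 0 :> R /\ cos (n%:R * (2 * pi)) = 1 :> R.
  elim: n => [|n [IHs IHc]]; first by rewrite mul0r sin0 cos0.
  have -> : n.+1%:R * (2 * pi) = n%:R * (2 * pi) + pi + pi :> R by rewrite -natr1; ring.
  by rewrite !sinDpi !cosDpi !opprK IHs IHc.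
case: k => n; first by have [-> ->] := nat_case n.
rewrite NegzE mulrNz mulNr sinN cosN.
by have [-> ->] := nat_case n.+1; rewrite oppr0.
Qed.

Lemma circle_Rintegral_trig (k : int) :
  (\int[circle_measure]_t cos (k%:~R * t) = if k == 0 then 2 * pi else 0 :> R) *
  (\int[circle_measure]_t sin (k%:~R * t) = 0 :> R).
Proof.
have ck : continuous (fun t : R => k%:~R * t) by move=> x; apply: mulrl_continuous.
have cc : continuous (fun t : R => cos (k%:~R * t)).
  by move=> x; apply: continuous_comp; [exact: ck|exact: continuous_cos].
have cs : continuous (fun t : R => sin (k%:~R * t)).
  by move=> x; apply: continuous_comp; [exact: ck|exact: continuous_sin].
have [k0|k0] := eqVneq k 0.
  have D1 x : is_derive x (1 : R) id (cos (k%:~R * x)).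
    by rewrite k0 mul0r cos0; exact: is_derive_id.
  have D0 x : is_derive x (1 : R) (cst (0 : R)) (sin (k%:~R * x)).
    by rewrite k0 mul0r sin0; exact: is_derive_cst.
  by rewrite (circle_Rintegral_derive cc D1) (circle_Rintegral_derive cs D0) !subr0.
have kR0 : k%:~R != 0 :> R by rewrite intr_eq0.
have dk x : is_derive x (1 : R) (fun t : R => k%:~R * t) k%:~R.
  have := @is_deriveZ _ _ _ id k%:~R x 1 1 (is_derive_id x 1).
  by rewrite /GRing.scale/= mulr1.
have Ds x : is_derive x (1 : R) (fun t => k%:~R^-1 * sin (k%:~R * t)) (cos (k%:~R * x)).
  have := @is_deriveZ _ _ _ (sin \o (fun t : R => k%:~R * t)) k%:~R^-1 x 1 _
    (is_derive1_comp (is_derive_sin _) (dk x)).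
  by rewrite /GRing.scale/= mulrCA mulVf// mulr1.
have Dc x : is_derive x (1 : R) (fun t => - k%:~R^-1 * cos (k%:~R * t)) (sin (k%:~R * x)).
  rewrite -[sin (k%:~R * x)](_ : - k%:~R^-1 *: (- sin (k%:~R * x) * k%:~R) = _); last first.
    by rewrite /GRing.scale/=; field.
  exact: (@is_deriveZ _ _ _ (cos \o (fun t : R => k%:~R * t)) (- k%:~R^-1) x 1 _
    (is_derive1_comp (is_derive_cos _) (dk x))).
rewrite (circle_Rintegral_derive cc Ds) (circle_Rintegral_derive cs Dc).
by rewrite !sin_cos_2pi_int !mulr0 sin0 cos0 mulr0 !subrr.
Qed.

Lemma measurable_dotZ n (k : 'rV[int]_n) : measurable_fun setT (@dotZ R n k).
Proof.
apply: measurable_sum => i; apply: measurable_funM; first exact: measurable_cst.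
exact: measurable_coord.
Qed.

Lemma measurable_cos_dotZ n (k : 'rV[int]_n) : measurable_fun setT (fun x => cos (@dotZ R n k x)).
Proof.
apply: (measurableT_comp (continuous_measurable_fun (@continuous_cos R))).
exact: measurable_dotZ.
Qed.

Lemma measurable_sin_dotZ n (k : 'rV[int]_n) : measurable_fun setT (fun x => sin (@dotZ R n k x)).
Proof.
apply: (measurableT_comp (continuous_measurable_fun (@continuous_sin R))).
exact: measurable_dotZ.
Qed.

Lemma bounded_integrable d (T : measurableType d) (mu : {finite_measure set T -> \bar R})
  (f : T -> R) : measurable_fun setT f -> (exists B, forall x, `|f x| <= B) ->
  mu.-integrable setT (EFin \o f).
Proof.
move=> mf [B fB]; apply: measurable_bounded_integrable => //.
  by rewrite ltey_eq fin_num_measure.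
by exists B; split=> [|M BM]; [exact: num_real|]; move=> x _; rewrite /= (le_trans (fB _))// ltW.
Qed.

Lemma integrable_cos_dotZ n (k : 'rV[int]_n) :
  (torus_measure n).-integrable setT (EFin \o (fun x => cos (@dotZ R n k x))).
Proof.
by apply: bounded_integrable; [exact: measurable_cos_dotZ|exists 1 => x; exact: cos_max].
Qed.

Lemma integrable_sin_dotZ n (k : 'rV[int]_n) :
  (torus_measure n).-integrable setT (EFin \o (fun x => sin (@dotZ R n k x))).
Proof.
by apply: bounded_integrable; [exact: measurable_sin_dotZ|exists 1 => x; exact: sin_max].
Qed.

Definition tailZ n (k : 'rV[int]_n.+1) : 'rV[int]_n := \row_i k 0 (lift ord0 i).

Lemma dotZ_cons n (k : 'rV[int]_n.+1) p :
  dotZ k (@rV_cons n p) = (k 0 ord0)%:~R * p.1 + dotZ (tailZ k) p.2.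
Proof.
rewrite /dotZ big_ord_recl rV_cons0; congr (_ + _); apply: eq_bigr => i _.
by rewrite rV_consS mxE.
Qed.

Lemma tailZ_eq0 n (k : 'rV[int]_n.+1) : (k == 0) = (k 0 ord0 == 0) && (tailZ k == 0).
Proof.
apply/eqP/andP => [->|[/eqP k0 /eqP/rowP kt]].
  by split; apply/eqP; [rewrite mxE|apply/rowP => i; rewrite !mxE].
apply/rowP => i; rewrite mxE; have [j ->|->] := unliftP ord0 i; last exact: k0.
by have := kt j; rewrite !mxE.
Qed.

(** Induction on the dimension by the addition formulas. Cosine and sine go together: the term with
    the sine integral over the remaining coordinates vanishes, which leaves a product. *)
Lemma torus_Rintegral_trig n (k : 'rV[int]_n) :
  (\int[torus_measure n]_x cos (dotZ k x) = if k == 0 then (2 * pi) ^+ n else 0 :> R) *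
  (\int[torus_measure n]_x sin (dotZ k x) = 0 :> R).
Proof.
elim: n k => [|n IH] k.
  have k0 : k = 0 by apply/rowP; case.
  rewrite k0 eqxx expr0; have d0 x : @dotZ R 0 0 x = 0 by rewrite /dotZ big_ord0.
  have T0 : torus_measure 0 [set: 'rV[R]_0] = 1%E by rewrite [LHS]diracE in_setT.
  split; under eq_Rintegral do rewrite d0.
    apply: etrans (Rintegral_cst _ measurableT _) _.
    by rewrite cos0 mul1r; exact: (congr1 fine T0).
  by apply: etrans (Rintegral_cst _ measurableT _) _; rewrite sin0 mul0r.
have [Ec Es] := IH (tailZ k); have [ec es] := circle_Rintegral_trig (k 0 ord0).
have cm (f : R -> R) : continuous f -> measurable_fun [set: measurableTypeR R] f.
  by move=> cf; exact: continuous_measurable_fun.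
have ck : continuous (fun t : R => (k 0 ord0)%:~R * t) by move=> x; apply: mulrl_continuous.
have cc : continuous (fun t : R => cos ((k 0 ord0)%:~R * t)).
  by move=> x; apply: continuous_comp; [exact: ck|exact: continuous_cos].
have cs : continuous (fun t : R => sin ((k 0 ord0)%:~R * t)).
  by move=> x; apply: continuous_comp; [exact: ck|exact: continuous_sin].
have ic : circle_measure.-integrable setT (EFin \o (fun t => cos ((k 0 ord0)%:~R * t))).
  by apply: bounded_integrable; [exact: cm|exists 1 => x; exact: cos_max].
have is_ : circle_measure.-integrable setT (EFin \o (fun t => sin ((k 0 ord0)%:~R * t))).
  by apply: bounded_integrable; [exact: cm|exists 1 => x; exact: sin_max].
have ZI a (f : 'rV[R]_n -> R) : (torus_measure n).-integrable setT (EFin \o f) ->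
  (torus_measure n).-integrable setT (EFin \o (fun x => a * f x)).
  by move=> fi; have := integrableZl measurableT a fi.
have Ic := integrable_cos_dotZ (tailZ k); have Is := integrable_sin_dotZ (tailZ k).
split; rewrite torus_RintegralS; try by [exact: measurable_cos_dotZ|
   exact: measurable_sin_dotZ|exists 1 => x; exact: cos_max|exists 1 => x; exact: sin_max].
- transitivity (\int[circle_measure]_t ((\int[torus_measure n]_x cos (dotZ (tailZ k) x)) * cos ((k 0 ord0)%:~R * t))).
    apply: eq_Rintegral => t _.
    under eq_Rintegral do rewrite dotZ_cons/= cosD.
    rewrite RintegralB//; [|exact: ZI|exact: ZI].
    by rewrite !RintegralZl// Es mulr0 subr0 mulrC.
  rewrite RintegralZl// Ec ec tailZ_eq0.
  by case: (k 0 ord0 == 0); case: (tailZ k == 0) => //=; rewrite ?mulr0 ?mul0r// exprSr.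
- transitivity (\int[circle_measure]_t ((\int[torus_measure n]_x cos (dotZ (tailZ k) x)) * sin ((k 0 ord0)%:~R * t))).
    apply: eq_Rintegral => t _.
    under eq_Rintegral do rewrite dotZ_cons/= sinD.
    rewrite RintegralD//; [|exact: ZI|exact: ZI].
    by rewrite !RintegralZl// Es mulr0 addr0 mulrC.
  by rewrite RintegralZl// es mulr0.
Qed.

(** Trigonometric functions do not tell the faces [x_i = 0] and [x_i = 2 pi] apart; discarding them
    lets [multiplier_coord_gt] work on the open interval. *)
Lemma torus_boundary0 n (i : 'I_n) :
  torus_measure n [set x : 'rV[R]_n | ~ (0 < x 0 i < 2 * pi)] = 0%E.
Proof.
elim: n i => [[]//|n IH] i.
rewrite torus_measureSE; have [j ->|->] := unliftP ord0 i.
  rewrite (_ : _ @^-1` _ = setT `*` [set x : 'rV[R]_n | ~ (0 < x 0 j < 2 * pi)]).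
    suff mj : measurable [set x : 'rV[R]_n | ~ (0 < x 0 j < 2 * pi)].
      by rewrite product_measure1E// [X in (_ * X)%E](IH j) mule0.
    rewrite (_ : [set _ | _] = ~` ((fun x : 'rV[R]_n => x 0 j : measurableTypeR R) @^-1` `]0, 2 * pi[%classic)).
      apply: measurableC; rewrite -[_ @^-1` _]setTI; apply: measurable_coord => //.
    by apply/seteqP; split=> x /=; rewrite in_itv.
  by apply/seteqP; split=> -[t x] /=; rewrite rV_consS//= => -[].
rewrite (_ : _ @^-1` _ = (~` `]0, 2 * pi[%classic) `*` setT).
  have mc : measurable (~` `]0, 2 * pi[%classic : set (measurableTypeR R)).
    by apply: measurableC; exact: measurable_itv.
  rewrite product_measure1E//.
  rewrite [X in (X * _)%E](_ : _ = 0%E) ?mul0e//.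
  rewrite /circle_measure/= /mfrestr /mrestr.
  apply/eqP; rewrite eq_le measure_ge0 andbT.
  apply: (@le_trans _ _ (lebesgue_measure ([set 0] `|` [set 2 * pi : R]))).
    apply: le_measure; rewrite ?inE.
    - by apply: measurableI; [exact: measurableC|exact: measurable_itv].
    - by apply: measurableU; exact: measurable_set1.
    move=> x [/= /negP]; rewrite !in_itv/= negb_and -!leNgt => /orP[x0|x0] /andP[x1 x2].
      by left; apply/eqP; rewrite eq_le x0 x1.
    by right; apply/eqP; rewrite eq_le x0 x2.
  apply: le_trans (measureU2 _ _ _) _; try exact: measurable_set1.
  by rewrite [X in (X + _)%E](lebesgue_measure_set1 (0 : R))
    [X in (_ + X)%E](lebesgue_measure_set1 (2 * pi : R)) adde0.
by apply/seteqP; split=> -[t x] /=; rewrite rV_cons0/= in_itv//= => -[].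
Qed.

Lemma measurable_rV_box n (a b : 'I_n -> R) :
  measurable [set x : 'rV[R]_n | forall i, (a i <= x 0 i <= b i)%R].
Proof.
rewrite (_ : [set _ | _] = \bigcap_(i in [set: 'I_n])
    ((fun x : 'rV[R]_n => x 0 i : measurableTypeR R) @^-1` `[a i, b i]%classic)).
  apply: fin_bigcap_measurable => // i _.
  by rewrite -[_ @^-1` _]setTI; apply: measurable_coord => //; exact: measurable_itv.
apply/seteqP; split=> x /= H i; first by move=> _; rewrite /= in_itv/= H.
by have := H i I; rewrite /= in_itv.
Qed.

(** This is what turns an almost everywhere equality of continuous periodic functions into an
    equality. *)
Lemma torus_box_gt0 n (a b : 'I_n -> R) : (forall i, 0 <= a i) -> (forall i, a i < b i) ->
  (forall i, b i <= 2 * pi) ->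
  (0 < torus_measure n [set x : 'rV[R]_n | forall i, (a i <= x 0 i <= b i)%R])%E.
Proof.
elim: n a b => [|n IH] a b a0 ab b2.
  rewrite (_ : [set _ | _] = setT); first by rewrite /= diracE in_setT lte_fin ltr01.
  by apply/seteqP; split=> x //= _ [].
rewrite torus_measureSE.
rewrite (_ : _ @^-1` _ = `[a ord0, b ord0]%classic `*` [set x : 'rV[R]_n | forall i, (a (lift ord0 i) <= x 0 i <= b (lift ord0 i))%R]).
  have mb := @measurable_rV_box n (fun i => a (lift ord0 i)) (fun i => b (lift ord0 i)).
  have mc : measurable (`[a ord0, b ord0]%classic : set (measurableTypeR R)).
    exact: measurable_itv.
  rewrite product_measure1E//.
  rewrite mule_gt0//; last by apply: IH.
  rewrite /circle_measure/= /mfrestr /mrestr setIidl.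
    by rewrite lebesgue_measure_itv/= lte_fin ab// -EFinB lte_fin subr_gt0 ab.
  by move=> x /=; rewrite !in_itv/= => /andP[x1 x2]; rewrite (le_trans (a0 _) x1) (le_trans x2).
apply/seteqP; split=> -[t x] /= H.
  split; first by rewrite in_itv/=; have := H ord0; rewrite rV_cons0.
  by move=> i; have := H (lift ord0 i); rewrite rV_consS.
case: H => H1 H2 i; have [j ->|->] := unliftP ord0 i; first by rewrite rV_consS; exact: H2.
by rewrite rV_cons0; move: H1; rewrite in_itv.
Qed.

End torus_integral.

Lemma norm_lim_le {R : realType} (u : nat -> R) (l B : R) :
  u m @[m --> \oo] --> l -> (forall m, `|u m| <= B) -> `|l| <= B.
Proof.
move=> ul uB; apply: (@cvgr_to_le _ \oo _ _ (fun m => `|u m|) _ _ (cvg_norm ul)).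
by near=> m; exact: uB.
Unshelve. all: by end_near. Qed.

(** * Uniqueness of the Fourier coefficients of integrable functions *)

Section fourier_completeness.
Context {R : realType} {n : nat}.
Local Notation T := 'rV[R]_n.
Local Notation mu := (@torus_measure R n).

Definition bounded_measurable (h : T -> R) :=
  measurable_fun setT h /\ exists B, forall x, `|h x| <= B.

Lemma bounded_measurable_integrable h : bounded_measurable h -> mu.-integrable setT (EFin \o h).
Proof. by move=> [mh bh]; exact: bounded_integrable. Qed.

Lemma bounded_measurableM h g : bounded_measurable h -> bounded_measurable g ->
  bounded_measurable (fun x => h x * g x).
Proof.
move=> [mh [B hB]] [mg [C gC]]; split; first exact: measurable_funM.
by exists (B * C) => x; rewrite normrM ler_pM.
Qed.

Lemma bounded_measurableD h g : bounded_measurable h -> bounded_measurable g ->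
  bounded_measurable (fun x => h x + g x).
Proof.
move=> [mh [B hB]] [mg [C gC]]; split; first exact: measurable_funD.
by exists (B + C) => x; rewrite (le_trans (ler_normD _ _))// lerD.
Qed.

Lemma bounded_measurable_cst c : bounded_measurable (fun=> c).
Proof. by split; [exact: measurable_cst|exists `|c|]. Qed.

Lemma bounded_measurable_cos (k : 'rV[int]_n) : bounded_measurable (fun x => cos (dotZ k x)).
Proof. by split; [exact: measurable_cos_dotZ|exists 1 => x; exact: cos_max]. Qed.

Lemma bounded_measurable_sin (k : 'rV[int]_n) : bounded_measurable (fun x => sin (dotZ k x)).
Proof. by split; [exact: measurable_sin_dotZ|exists 1 => x; exact: sin_max]. Qed.

Lemma integrable_mul (f h : T -> R) : mu.-integrable setT (EFin \o f) -> bounded_measurable h ->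
  mu.-integrable setT (EFin \o (fun x => f x * h x)).
Proof.
move=> fi [mh [B hB]]; have := @integrableMl _ _ _ mu setT measurableT _ h fi mh; apply.
by exists B; split=> [|M BM x _]; [exact: num_real|rewrite /= (le_trans (hB _))// ltW].
Qed.

Lemma Rintegral_cvg (f : T -> R) (h_ : nat -> T -> R) (h : T -> R) (B : R) :
  mu.-integrable setT (EFin \o f) ->
  (forall m, measurable_fun setT (h_ m)) -> (forall m x, `|h_ m x| <= B) ->
  (forall x, h_ m x @[m --> \oo] --> h x) ->
  measurable_fun setT h /\
  (\int[mu]_x (f x * h_ m x)) @[m --> \oo] --> \int[mu]_x (f x * h x).
Proof.
move=> fi mh_ hB hcvg.
have mh : measurable_fun setT h by apply: (measurable_fun_cvg mh_) => x _; exact: hcvg.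
have mf : measurable_fun setT f by apply/measurable_EFinP; exact: (measurable_int _ fi).
have hB' x : `|h x| <= B.
  exact: (norm_lim_le (hcvg x)).
split=> //.
have B0 : 0 <= B by exact: le_trans (hB 0%N 0).
have [|||||_ _] := @dominated_convergence _ _ _ mu setT measurableT
   (fun m x => (f x * h_ m x)%:E) (fun x => (f x * h x)%:E) (fun x => (B * `|f x|)%:E).
- by move=> m; apply/measurable_EFinP; exact: measurable_funM.
- by apply/measurable_EFinP; exact: measurable_funM.
- apply: aeW => x _; apply: cvg_EFin; first by near=> m.
  by apply: cvgMr; exact: hcvg.
- exact: (integrableZl measurableT B (integrable_abse fi)).
- by apply: aeW => x m _; rewrite lee_fin normrM mulrC ler_wpM2r.
move=> H; apply: (@fine_cvg _ _ _ _ (fun m => \int[mu]_x (f x * h_ m x)%:E)%E).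
rewrite fineK; first exact: H.
by apply: integrable_fin_num => //; apply: integrable_mul => //; split=> //; exists B.
Unshelve. all: by end_near. Qed.

Definition annihilated (f : T -> R) := mu.-integrable setT (EFin \o f) /\
  forall k, \int[mu]_x (f x * cos (dotZ k x)) = 0 /\ \int[mu]_x (f x * sin (dotZ k x)) = 0.

(* The functions whose multiplication preserves the integrable functions with zero
   Fourier coefficients: an algebra closed under bounded limits. *)
Definition multiplier (h : T -> R) := bounded_measurable h /\
  forall f, annihilated f -> annihilated (fun x => f x * h x).

Lemma annihilatedD f g : annihilated f -> annihilated g -> annihilated (fun x => f x + g x).
Proof.
move=> [fi f0] [gi g0]; split; first by have := integrableD measurableT fi gi.
move=> k; have [fc fs] := f0 k; have [gc gs] := g0 k.
have bc := bounded_measurable_cos k; have bs := bounded_measurable_sin k.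
split.
  under eq_Rintegral do rewrite mulrDl.
  by rewrite RintegralD ?fc ?gc ?addr0//; exact: integrable_mul.
under eq_Rintegral do rewrite mulrDl.
by rewrite RintegralD ?fs ?gs ?addr0//; exact: integrable_mul.
Qed.

Lemma annihilatedZ c f : annihilated f -> annihilated (fun x => c * f x).
Proof.
move=> [fi f0]; split; first exact: (integrableZl measurableT c fi).
move=> k; have [fc fs] := f0 k.
have bc := bounded_measurable_cos k; have bs := bounded_measurable_sin k.
split.
  under eq_Rintegral do rewrite -mulrA.
  by rewrite RintegralZl ?fc ?mulr0//; exact: integrable_mul.
under eq_Rintegral do rewrite -mulrA.
by rewrite RintegralZl ?fs ?mulr0//; exact: integrable_mul.
Qed.

Lemma multiplierD h g : multiplier h -> multiplier g -> multiplier (fun x => h x + g x).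
Proof.
move=> [bh mh] [bg mg]; split; first exact: bounded_measurableD.
move=> f af; under eq_fun do rewrite mulrDr.
by apply: annihilatedD; [exact: mh|exact: mg].
Qed.

Lemma multiplierM h g : multiplier h -> multiplier g -> multiplier (fun x => h x * g x).
Proof.
move=> [bh mh] [bg mg]; split; first exact: bounded_measurableM.
by move=> f af; under eq_fun do rewrite mulrA; apply: mg; exact: mh.
Qed.

Lemma multiplier_cst c : multiplier (fun=> c).
Proof.
split; first exact: bounded_measurable_cst.
by move=> f af; under eq_fun do rewrite mulrC; exact: annihilatedZ.
Qed.

Lemma multiplierZ c h : multiplier h -> multiplier (fun x => c * h x).
Proof. by apply: multiplierM; exact: multiplier_cst. Qed.

Lemma multiplierN h : multiplier h -> multiplier (fun x => - h x).
Proof. by move=> /(multiplierZ (-1)); under eq_fun do rewrite mulN1r. Qed.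

Lemma multiplierX h m : multiplier h -> multiplier (fun x => h x ^+ m).
Proof.
move=> mh; elim: m => [|m IH]; first exact: multiplier_cst.
by under eq_fun do rewrite exprS; exact: multiplierM.
Qed.

Lemma dotZD (k l : 'rV[int]_n) (x : T) : dotZ (k + l) x = dotZ k x + dotZ l x.
Proof. by rewrite /dotZ -big_split; apply: eq_bigr => i _; rewrite mxE intrD mulrDl. Qed.

Lemma dotZN (k : 'rV[int]_n) (x : T) : dotZ (- k) x = - dotZ k x.
Proof. by rewrite /dotZ -sumrN; apply: eq_bigr => i _; rewrite mxE mulrNz mulNr. Qed.

(** Product-to-sum formulas: the coefficients at [k] of the product with a mode [l] are combinations
    of coefficients of [f] at [k + l] and [k - l]. *)
Lemma multiplier_trig l : multiplier (fun x => cos (dotZ l x)) /\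
  multiplier (fun x => sin (dotZ l x)).
Proof.
have half (f a b c : T -> R) : mu.-integrable setT (EFin \o f) ->
    bounded_measurable a -> bounded_measurable b ->
    \int[mu]_x (f x * a x) = 0 -> \int[mu]_x (f x * b x) = 0 ->
    (forall x, c x = 2^-1 * (a x + b x)) -> \int[mu]_x (f x * c x) = 0.
  move=> fi ba bb a0 b0 cE; under eq_Rintegral do rewrite cE mulrCA mulrDr.
  have fa := integrable_mul fi ba; have fb := integrable_mul fi bb.
  rewrite RintegralZl//; first by rewrite RintegralD// a0 b0 addr0 mulr0.
  by have := integrableD measurableT fa fb.
have bc := bounded_measurable_cos; have bs := bounded_measurable_sin.
have bN g : bounded_measurable g -> bounded_measurable (fun x => - g x).
  move=> bg; under eq_fun do rewrite -mulN1r.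
  by apply: bounded_measurableM => //; exact: bounded_measurable_cst.
have i0N f g : mu.-integrable setT (EFin \o f) -> bounded_measurable g ->
    \int[mu]_x (f x * g x) = 0 -> \int[mu]_x (f x * - g x) = 0.
  move=> fi bg fg; under eq_Rintegral do rewrite mulrN -mulN1r.
  by rewrite RintegralZl// ?fg ?mulr0//; exact: integrable_mul.
split; (split; first by [exact: bc|exact: bs]); move=> f [fi f0];
  (split; first exact: integrable_mul); move=> k;
  have [pc ps] := f0 (k + l); have [mc ms] := f0 (k - l); split;
  under eq_Rintegral do rewrite -mulrA.
- apply: half (bc (k + l)) (bc (k - l)) pc mc _ => // x.
  by rewrite !dotZD dotZN cosD cosB; field.
- apply: half (bs (k + l)) (bs (k - l)) ps ms _ => // x.
  by rewrite !dotZD dotZN sinD sinD sinN cosN; field.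
- apply: half (bs (k + l)) (bN _ (bs (k - l))) ps (i0N _ _ fi (bs _) ms) _ => // x.
  by rewrite !dotZD dotZN sinD sinD sinN cosN; field.
- apply: half (bc (k - l)) (bN _ (bc (k + l))) mc (i0N _ _ fi (bc _) pc) _ => // x.
  by rewrite !dotZD dotZN !cosD sinN cosN; field.
Qed.

Lemma multiplier_lim (h_ : nat -> T -> R) (h : T -> R) (B : R) :
  (forall m, multiplier (h_ m)) -> (forall m x, `|h_ m x| <= B) ->
  (forall x, h_ m x @[m --> \oo] --> h x) -> multiplier h.
Proof.
move=> mh hB hcvg.
have mh_ m : measurable_fun setT (h_ m) by have [[]] := mh m.
have hB' x : `|h x| <= B.
  exact: (norm_lim_le (hcvg x)).
have bh : bounded_measurable h.
  split; last by exists B.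
  by apply: (measurable_fun_cvg mh_) => x _; exact: hcvg.
have key f g : (forall m, \int[mu]_x (f x * h_ m x * g x) = 0) ->
    mu.-integrable setT (EFin \o f) -> bounded_measurable g ->
    \int[mu]_x (f x * h x * g x) = 0.
  move=> f0 fi bg; have [_] := Rintegral_cvg (integrable_mul fi bg) mh_ hB hcvg.
  under eq_cvg do under eq_Rintegral do rewrite mulrAC.
  under eq_Rintegral do rewrite mulrAC.
  under eq_cvg do rewrite f0.
  by move=> /(cvg_unique _ (cvg_cst _)) <-.
split=> // f af; have [fi f0] := af; split; first exact: integrable_mul.
move=> k; split; apply: key => //.
- by move=> m; have [_ /(_ f af)[_ /(_ k)[]]] := mh m.
- exact: bounded_measurable_cos.
- by move=> m; have [_ /(_ f af)[_ /(_ k)[]]] := mh m.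
- exact: bounded_measurable_sin.
Unshelve. all: by end_near. Qed.

Lemma multiplier_scaled h : multiplier h ->
  exists2 B, 0 < B & multiplier (fun x => h x / B) /\ forall x, `|h x / B| <= 1.
Proof.
move=> mh; have [[_ [B hB]] _] := mh.
have B1 : 0 < `|B| + 1 by rewrite ltr_wpDl.
exists (`|B| + 1) => //; split.
  by under eq_fun do rewrite mulrC; exact: multiplierZ.
move=> x; rewrite normrM normfV (gtr0_norm B1) ler_pdivrMr// mul1r.
by rewrite (le_trans (hB _))// (le_trans (ler_norm _))// lerDl.
Qed.

Lemma multiplier_norm h : multiplier h -> multiplier (fun x => `|h x|).
Proof.
move=> /multiplier_scaled[B B0 [mh h1]].
rewrite (_ : (fun x => _) = fun x => B * `|h x / B|); last first.
  by apply/funext => x; rewrite normrM normfV (gtr0_norm B0) mulrC divfK// gt_eqF.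
apply: multiplierZ; apply: (@multiplier_lim (fun m x => abs_iter m (h x / B)) _ 1).
- elim=> [|m IH] /=; first exact: multiplier_cst.
  apply: multiplierD => //; under eq_fun do rewrite mulrC.
  apply: multiplierZ; apply: multiplierD; first exact: multiplierX.
  by apply: multiplierN; exact: multiplierX.
- move=> m x; have [/andP[y0 y1] _] := abs_iter_bound m (h1 x).
  by rewrite ger0_norm// (le_trans y1).
move=> x; apply/cvgrPdist_le => e e0.
have e20 : 0 < e / 2 by rewrite divr_gt0.
have [m _ Hm] := near_infty_natSinv_lt (PosNum e20).
exists m => // k mk; have [/andP[y0 y1] y2] := abs_iter_bound k (h1 x).
rewrite ger0_norm ?subr_ge0// (le_trans y2)// mulrC -ler_pdivlMr//.
apply: le_trans (ltW (Hm k mk)) => /=.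
by rewrite lef_pV2 ?posrE ?ltr0n// ler_nat.
Qed.

(** The function [q] is a multiple of the positive part of [h] with values in [0, 1], and
    [1 - (1 - q) ^+ m] tends boundedly to the indicator of [q > 0]. *)
Lemma multiplier_gt0 h : multiplier h -> multiplier (fun x => (0 < h x)%R%:R).
Proof.
move=> mh; have mp : multiplier (fun x => h x + `|h x|).
  by apply: multiplierD => //; exact: multiplier_norm.
have [B B0 [mq q1]] := multiplier_scaled mp.
pose q x := (h x + `|h x|) / B.
have q0 x : 0 <= q x.
  by rewrite divr_ge0 ?(ltW B0)//; have := ler_norm (- h x); rewrite normrN; lra.
have q1' x : q x <= 1 by exact: le_trans (ler_norm _) (q1 x).
have qE x : (0 < h x) = (0 < q x).
  rewrite /q pmulr_lgt0 ?invr_gt0//; have [h0|h0] := ltP 0 (h x).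
    by rewrite addr_gt0// normr_gt0 gt_eqF.
  by rewrite ler0_norm// subrr ltxx.
apply: (@multiplier_lim (fun m x => 1 - (1 - q x) ^+ m) _ 1).
- move=> m; apply: multiplierD; first exact: multiplier_cst.
  apply: multiplierN; apply: multiplierX; apply: multiplierD; first exact: multiplier_cst.
  exact: multiplierN.
- move=> m x; have := q0 x; have := q1' x => qa qb.
  have p0 : 0 <= (1 - q x) ^+ m by rewrite exprn_ge0// subr_ge0.
  have p1 : (1 - q x) ^+ m <= 1 by rewrite exprn_ile1// ?subr_ge0// gerBl.
  by rewrite ger0_norm ?subr_ge0// gerBl.
move=> x; rewrite qE; have [qx|qx] := ltP 0 (q x).
  rewrite [X in _ --> X](_ : _ = 1 - 0 :> R); last by rewrite subr0.
  apply: cvgB; first exact: cvg_cst.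
  have := @cvg_geometric R 1 (1 - q x); rewrite /geometric/=.
  under eq_fun do rewrite mul1r; apply.
  by rewrite ger0_norm ?subr_ge0// gtrBl.
have -> : q x = 0 by apply/eqP; rewrite eq_le qx q0.
under eq_cvg do rewrite subr0 expr1n subrr.
exact: cvg_cst.
Qed.

Lemma multiplier_ae h g : multiplier h -> bounded_measurable g ->
  (\forall x \ae mu, h x = g x) -> multiplier g.
Proof.
move=> [bh mh] bg hg; split=> // f af; have [fi f0] := af.
have afh := mh f af; split; first exact: integrable_mul.
have [fhi fh0] := afh.
have key k : bounded_measurable k ->
    \int[mu]_x (f x * g x * k x) = \int[mu]_x (f x * h x * k x).
  move=> bk; rewrite /Rintegral; congr fine; apply: ae_eq_integral => //.
  - by apply: (measurable_int _ (integrable_mul (integrable_mul fi bg) bk)).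
  - by apply: (measurable_int _ (integrable_mul fhi bk)).
  by apply: filterS hg => x /= -> _.
move=> k; rewrite !key; first exact: fh0.
- exact: bounded_measurable_sin.
- exact: bounded_measurable_cos.
Qed.

Definition multiplier_set (A : set T) := measurable A /\ multiplier (fun x => (x \in A)%:R : R).

Lemma bounded_measurable_indic (A : set T) : measurable A ->
  bounded_measurable (fun x => (x \in A)%:R).
Proof.
move=> mA; split; last by exists 1 => x; case: (x \in A); rewrite ?normr1 ?normr0.
by have := @measurable_indic _ T R setT A mA; under eq_fun do rewrite -indicE.
Qed.

(** The union of two sets with indicators [a] and [b] has indicator [a + b - a * b], again a
    multiplier; a countable union is the bounded limit of finite ones. *)
Lemma multiplier_set_sigma_algebra : sigma_algebra setT multiplier_set.
Proof.
have setC_in A x : (x \in ~` A)%:R = 1 - (x \in A)%:R :> R.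
  by rewrite in_setC; case: (x \in A); rewrite ?subrr ?subr0.
split=> [|A [mA hA]|F hF] /=.
- split; first exact: measurable0.
  rewrite (_ : (fun x => _) = fun=> 0); first exact: multiplier_cst.
  by apply/funext => x; rewrite in_set0.
- rewrite setTD; split; first exact: measurableC.
  under eq_fun do rewrite setC_in.
  by apply: multiplierD; [exact: multiplier_cst|exact: multiplierN].
split; first by apply: bigcupT_measurable => k; have [] := hF k.
pose U m := \bigcup_(k in [set k | (k < m)%N]) F k.
have hU m : multiplier (fun x => (x \in U m)%:R : R).
  elim: m => [|m IH].
    rewrite (_ : (fun x => _) = fun=> 0); first exact: multiplier_cst.
    by apply/funext => x; rewrite /U (_ : [set k | _] = set0) ?bigcup_set0 ?in_set0//;
      apply/seteqP; split.
  rewrite (_ : (fun x => _) = fun x => (x \in U m)%:R + (x \in F m)%:R +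
      - ((x \in U m)%:R * (x \in F m)%:R)).
    have hm : multiplier (fun x => (x \in F m)%:R : R) by have [] := hF m.
    by apply: multiplierD; [exact: multiplierD|apply: multiplierN; exact: multiplierM].
  apply/funext => x; rewrite (_ : x \in U m.+1 = (x \in U m) || (x \in F m)).
    by case: (x \in U m); case: (x \in F m); rewrite /= ?mulr1 ?mulr0 ?addr0 ?add0r ?oppr0 ?addrK ?subrr ?addr0.
  apply/idP/orP; rewrite !inE.
    move=> [k /= km Fk]; have [<-|nk] := eqVneq k m; first by right.
    by left; exists k => //=; rewrite ltn_neqAle nk -ltnS.
  by move=> [[k /= km Fk]|Fm]; [exists k => //=; exact: ltnW|exists m => /=].
apply: (multiplier_lim (B := 1) hU) => [m x|x].
  by case: (x \in U m); rewrite ?normr1 ?normr0.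
have [xF|xF] := boolP (x \in \bigcup_k F k).
  apply: cvg_near_cst; move: xF; rewrite inE => -[k _ Fk].
  by exists k.+1 => // m /= km; rewrite (_ : x \in U m)// inE; exists k.
apply: cvg_near_cst; apply: nearW => m; rewrite (_ : x \in U m = false)//.
apply/negbTE; apply: contra xF; rewrite !inE => -[k _ Fk]; by exists k.
Qed.

(** The identity [cos (c / 2) - cos (x_i - c / 2) = 2 sin (x_i / 2) sin ((x_i - c) / 2)] gives a
    trigonometric polynomial with the sign of [x_i - c] on [0 < x_i < 2 pi], where [sin (x_i / 2)]
    is positive. This covers [0 <= c < 2 pi]; for other [c] the half-space is full or empty up to a
    null set. *)
Lemma multiplier_coord_gt (i : 'I_n) (c : R) : multiplier_set [set x | c < x 0 i].
Proof.
have mS : measurable [set x : T | c < x 0 i].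
  rewrite (_ : [set x | _] = setT `&` (fun x : T => x 0 i : measurableTypeR R) @^-1` `]c, +oo[%classic).
    by apply: measurable_coord => //; exact: measurable_itv.
  by rewrite setTI; apply/seteqP; split=> x /=; rewrite in_itv/= andbT.
split=> //; have bS := bounded_measurable_indic mS.
have B0 : \forall x \ae mu, 0 < (x : T) 0 i < 2 * pi.
  exists [set x : T | ~ (0 < x 0 i < 2 * pi)]; split=> //; last exact: torus_boundary0.
  rewrite (_ : [set _ | _] = ~` (setT `&` (fun x : T => x 0 i : measurableTypeR R) @^-1` `]0, 2 * pi[%classic)).
    by apply: measurableC; apply: measurable_coord => //; exact: measurable_itv.
  by rewrite setTI; apply/seteqP; split=> x /=; rewrite in_itv.
have [c0|c0] := ltP c 0.
  apply: (multiplier_ae (multiplier_cst 1)) => //.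
  apply: filterS B0 => x /andP[x0 _].
  by rewrite (_ : x \in _)// inE /= (lt_trans c0).
have [c2|c2] := leP (2 * pi) c.
  apply: (multiplier_ae (multiplier_cst 0)) => //.
  apply: filterS B0 => x /andP[_ x2].
  by rewrite (_ : x \in _ = false)//; apply/negbTE/negP; rewrite inE /= ltNge (ltW (lt_le_trans x2 c2)).
pose e : 'rV[int]_n := delta_mx 0 i.
have eE (x : T) : dotZ e x = x 0 i.
  rewrite /dotZ (bigD1 i)//= big1 ?addr0 => [|j ji]; first by rewrite mxE !eqxx mul1r.
  by rewrite mxE (negbTE ji) andbF mul0r.
have [mc ms] := multiplier_trig e.
pose h (x : T) := cos (c / 2) + - (cos (c / 2) * cos (dotZ e x) + sin (c / 2) * sin (dotZ e x)).
have mh : multiplier h.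
  apply: multiplierD; first exact: multiplier_cst.
  by apply: multiplierN; apply: multiplierD; exact: multiplierZ.
apply: (multiplier_ae (multiplier_gt0 mh)) => //.
apply: filterS B0 => x /andP[x0 x2].
have hE : h x = 2 * sin (x 0 i / 2) * sin ((x 0 i - c) / 2).
  rewrite /h eE; pose u := x 0 i / 2; pose v := (x 0 i - c) / 2.
  have -> : c / 2 = u - v by rewrite /u /v; field.
  have -> : cos (u - v) * cos (x 0 i) + sin (u - v) * sin (x 0 i) = cos (u + v).
    by rewrite -cosB -cosN; congr cos; rewrite /u /v; field.
  by rewrite -/u -/v cosB cosD; ring.
have su : 0 < sin (x 0 i / 2).
  by apply: sin_gt0_pi; rewrite divr_gt0//= ltr_pdivrMr// mulrC.
have two_pi : (x 0 i - c) / 2 < pi by rewrite ltr_pdivrMr// mulrC ltrBlDr ltr_wpDr.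
congr (nat_of_bool _)%:R; rewrite hE pmulr_rgt0 ?mulr_gt0//.
apply/idP/idP; rewrite inE /= => cx; last first.
  by apply: sin_gt0_pi; rewrite two_pi andbT divr_gt0// subr_gt0.
rewrite ltNge; apply/negP => xc; move: cx.
have -> : (x 0 i - c) / 2 = - ((c - x 0 i) / 2) by field.
rewrite sinN oppr_gt0 ltNge sin_ge0_pi// divr_ge0 ?subr_ge0//= ler_pdivrMr// mulrC.
by rewrite lerBlDr (le_trans (ltW c2))// lerDl ltW.
Qed.

Lemma multiplier_measurable (A : set T) : measurable A -> multiplier_set A.
Proof.
have [S0 SC SU] := multiplier_set_sigma_algebra.
have {}SC B : multiplier_set B -> multiplier_set (~` B) by rewrite -setTD; exact: SC.
have SI B C : multiplier_set B -> multiplier_set C -> multiplier_set (B `&` C).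
  move=> [mB hB] [mC hC]; split; first exact: measurableI.
  rewrite (_ : (fun x => _) = fun x => (x \in B)%:R * (x \in C)%:R); first exact: multiplierM.
  by apply/funext => x; rewrite in_setI; case: (x \in B); rewrite /= ?mul1r ?mul0r.
suff H i (B : set (measurableTypeR R)) : measurable B ->
    multiplier_set ((fun x : T => x 0 i : measurableTypeR R) @^-1` B).
  apply: smallest_sub => /=; first exact: multiplier_set_sigma_algebra.
  by move=> C; rewrite -bigcup_seq/= => -[i _ [B mB <-]]; rewrite setTI; exact: H.
move: B; apply: (@smallest_sub _ _ _ [set B | multiplier_set
  ((fun x : T => x 0 i : measurableTypeR R) @^-1` B)]) => /=.
  split=> [|B hB|F hF] /=; first by rewrite preimage_set0.
    by rewrite setTD preimage_setC; exact: SC.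
  by rewrite preimage_bigcup; exact: SU.
move=> _ [[a b] _ <-] /=.
rewrite (_ : _ @^-1` _ = [set x : T | a < x 0 i] `&` ~` [set x : T | b < x 0 i]).
  by apply: SI; [|apply: SC]; exact: multiplier_coord_gt.
apply/seteqP; split=> x /=; first by rewrite in_itv/= => /andP[-> xb]; split=> //; apply/negP; rewrite -leNgt.
by move=> [ax /negP]; rewrite -leNgt in_itv/= ax.
Qed.

(** The sign of [f] is a combination of indicators, hence a multiplier; the coefficient of the
    product at mode 0 is the integral of [|f|]. *)
Theorem annihilated_ae_eq0 (f : T -> R) : annihilated f -> \forall x \ae mu, f x = 0.
Proof.
move=> af; have [fi _] := af.
have mf : measurable_fun setT f by apply/measurable_EFinP; exact: (measurable_int _ fi).
pose A := [set x | 0 <= f x].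
have mA : measurable A.
  rewrite (_ : A = setT `&` f @^-1` `[0, +oo[%classic).
    by apply: mf => //; exact: measurable_itv.
  by rewrite setTI; apply/seteqP; split=> x /=; rewrite /A/= in_itv/= andbT.
have [_ mulA] := multiplier_measurable mA.
have mh : multiplier (fun x => 2 * (x \in A)%:R + - 1).
  by apply: multiplierD; [exact: multiplierZ|exact: multiplier_cst].
have [_ /(_ f af)[fhi /(_ 0)[f0 _]]] := mh.
have absE x : f x * (2 * (x \in A)%:R + - 1) = `|f x|.
  have [|fx] := boolP (x \in A); rewrite ?inE /A/=.
    by move=> fx; rewrite ger0_norm//; ring.
  by rewrite ltr0_norm ?ltNge; [ring|move: fx; rewrite notin_setE /A/= => /negP].
have dot0 x : @dotZ R n 0 x = 0 by rewrite /dotZ big1// => i _; rewrite mxE mul0r.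
have {}f0 : \int[mu]_x `|f x| = 0.
  by rewrite -f0; apply: eq_Rintegral => x _; rewrite absE dot0 cos0 mulr1.
have fi0 : (\int[mu]_x `|(f x)%:E| = 0)%E.
  by move/eqP: f0; rewrite /Rintegral fine_eq0 ?(integrable_fin_num _ (integrable_abse fi))// => /eqP.
have /(ae_eq_integral_abs mu measurableT (measurable_int _ fi)) := fi0.
by apply: filterS => x /(_ I) /= [].
Qed.

End fourier_completeness.

(** * Trigonometric polynomials *)

Section box_sequence.

(** The modes of the box are indexed by the type of the grid nodes, shifted by [N], so the
    orthogonality relations over nodes and over modes both reduce to [sum_expi_grid]. *)
Definition box_index d N (j : 'rV['I_(2 * N).+1]_d) : 'rV[int]_d :=
  \row_i (Posz (j 0 i) - Posz N).

Definition box_seq d N : seq 'rV[int]_d :=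
  [seq box_index j | j <- enum 'rV['I_(2 * N).+1]_d].

Lemma box_index_inj d N : injective (@box_index d N).
Proof.
move=> j l /rowP e; apply/rowP => i; have := e i; rewrite !mxE => /addIr[].
by move=> h; exact: val_inj.
Qed.

Lemma box_seq_uniq d N : uniq (box_seq d N).
Proof. by rewrite map_inj_uniq ?enum_uniq//; exact: box_index_inj. Qed.

Lemma mem_box_seq d N (k : 'rV[int]_d) :
  (k \in box_seq d N) = [forall i, (absz (k 0%R i) <= N)%N].
Proof.
apply/mapP/forallP => [[j _ ->] i|H].
  by rewrite mxE; have := ltn_ord (j 0 i); move: (nat_of_ord (j 0 i)) => m; lia.
exists (\row_i inord (absz (k 0 i + Posz N))); first by rewrite mem_enum.
apply/rowP => i; rewrite !mxE; move: (k 0 i) (H i) => z hz; rewrite inordK; lia.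
Qed.

Lemma box_seqE d N : [set` box_seq d N] = box N.
Proof.
apply/seteqP; split=> k /=; rewrite mem_box_seq; first by move/forallP.
by move=> H; apply/forallP.
Qed.

Lemma box_sumE (M : nmodType) d N (F : 'rV[int]_d -> M) :
  \sum_(k \in box N) F k = \sum_(k <- box_seq d N) F k.
Proof. by rewrite -box_seqE; exact/esym/fsbig_seq/box_seq_uniq. Qed.

Lemma box_seqN d N k : (- k \in box_seq d N) = (k \in box_seq d N).
Proof. by rewrite !mem_box_seq; apply: eq_forallb => i; rewrite mxE abszN. Qed.

Lemma perm_box_seqN d N : perm_eq [seq - k | k <- box_seq d N] (box_seq d N).
Proof.
apply: uniq_perm; rewrite ?(map_inj_uniq oppr_inj) ?box_seq_uniq//.
move=> k; apply/mapP/idP => [[l lN ->]|kN]; first by rewrite box_seqN.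
by exists (- k); rewrite ?opprK// box_seqN.
Qed.

Lemma sum_box_seqN (M : nmodType) d N (F : 'rV[int]_d -> M) :
  \sum_(k <- box_seq d N) F (- k) = \sum_(k <- box_seq d N) F k.
Proof.
transitivity (\sum_(k <- [seq - k | k <- box_seq d N]) F k); first by rewrite [RHS]big_map.
exact: perm_big (perm_box_seqN d N).
Qed.

Lemma sum_box_seq1 (M : nmodType) d N (F : 'rV[int]_d -> M) l :
  \sum_(k <- box_seq d N) (if k == l then F k else 0) =
  if l \in box_seq d N then F l else 0.
Proof.
rewrite -big_mkcond/=; have [lN|lN] := boolP (l \in box_seq d N).
  rewrite -big_filter (_ : [seq k <- box_seq d N | k == l] = [:: l]) ?big_seq1//.
  exact: (filter_pred1_uniq (box_seq_uniq d N) lN).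
by rewrite big_seq_cond big1// => k /andP[+ /eqP kl]; rewrite kl (negbTE lN).
Qed.

End box_sequence.

Section trigonometric_polynomials.
Context {R : realType}.
Implicit Types (d N : nat).

Lemma expiD (s t : R) : expi (s + t) = expi s * expi t.
Proof. by rewrite /expi cosD sinD; congr Complex; rewrite addrC [cos s * _]mulrC. Qed.

Lemma expi0 : expi (0 : R) = 1.
Proof. by rewrite /expi cos0 sin0. Qed.

Lemma conjcM (z w : R[i]) : conjc (z * w) = conjc z * conjc w.
Proof. exact: (rmorphM (@conjc R)). Qed.

Lemma expiN (t : R) : expi (- t) = conjc (expi t).
Proof. by rewrite /expi cosN sinN. Qed.

Lemma normc_expi (t : R) : Normc.normc (expi t) = 1.
Proof. by rewrite /expi /Normc.normc cos2sin2 subrK sqrtr1. Qed.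

Lemma expi_sum (I : Type) (r : seq I) (F : I -> R) :
  expi (\sum_(i <- r) F i) = \prod_(i <- r) expi (F i).
Proof. exact: (big_morph _ expiD expi0). Qed.

Lemma expi_natmul n (t : R) : expi (n%:R * t) = expi t ^+ n.
Proof.
elim: n => [|n IH]; first by rewrite mul0r expi0.
by rewrite -natr1 mulrDl mul1r expiD IH exprSr.
Qed.

Lemma expi_2pi_int (k : int) : expi (k%:~R * (2 * pi)) = 1 :> R[i].
Proof. by rewrite /expi !sin_cos_2pi_int. Qed.

Lemma expi_neq1 (t : R) : 0 < t < 2 * pi -> expi t != 1.
Proof.
move=> /andP[t0 t2]; apply/negP => /eqP[ct _].
have s0 : 0 < sin (t / 2) by apply: sin_gt0_pi; rewrite divr_gt0//= ltr_pdivrMr// mulrC.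
have := cosD (t / 2) (t / 2); rewrite -splitr ct.
have := cos2sin2 (t / 2); rewrite expr2 => ->; rewrite -expr2 => e.
have : sin (t / 2) ^+ 2 = 0 by lra.
by move/eqP; rewrite expf_eq0/= gt_eqF.
Qed.

(** A geometric sum over an [n]-th root of unity, which differs from 1 when [0 < |m| < n]. *)
Lemma sum_expi_root n (m : int) : (`|m| < n)%N ->
  \sum_(j < n) expi (j%:R * (m%:~R * (2 * pi) / n%:R)) = if m == 0 then n%:R else 0 :> R[i].
Proof.
move=> mn; have n0 : n%:R != 0 :> R by rewrite pnatr_eq0 -lt0n; lia.
under eq_bigr do rewrite expi_natmul.
have [->|m0] := eqVneq m 0.
  by under eq_bigr do rewrite !mul0r expi0 expr1n; rewrite sumr_const card_ord.
set z := expi _; have zn : z ^+ n = 1.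
  by rewrite -expi_natmul mulrCA divff// mulr1 expi_2pi_int.
have z1 : z != 1.
  have n0' : 0 < n%:R :> R by rewrite lt0r n0/=.
  have pos (k : nat) : (0 < k < n)%N -> expi (k%:R * (2 * pi) / n%:R) != 1 :> R[i].
    move=> /andP[k0 kn]; apply: expi_neq1; rewrite divr_gt0// ?mulr_gt0 ?ltr0n ?pi_gt0//=.
    by rewrite ltr_pdivrMr// mulrC ltr_pM2l ?mulr_gt0 ?pi_gt0// ltr_nat.
  rewrite /z; case: m m0 mn {z zn} => k m0 mn; first by apply: pos; lia.
  rewrite NegzE mulrNz !mulNr expiN.
  rewrite -conjc1 (inj_eq (can_inj (@conjcK R))).
  by apply: pos; lia.
have := subrX1 z n; rewrite zn subrr => /esym/eqP.
by rewrite mulf_eq0 subr_eq0 (negbTE z1) => /eqP.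
Qed.

Lemma sum_expi_grid d n (m : 'I_d -> int) : (forall i, (`|m i| < n)%N) ->
  \sum_(j : 'rV['I_n]_d) expi (\sum_i (j 0 i)%:R * ((m i)%:~R * (2 * pi) / n%:R)) =
  if [forall i, m i == 0] then n%:R ^+ d else 0 :> R[i].
Proof.
move=> mn.
rewrite (reindex (fun f : {ffun 'I_d -> 'I_n} => \row_i f i)) /=; last first.
  exists (fun j : 'rV['I_n]_d => [ffun i => j 0 i]) => x _.
    by apply/ffunP => i; rewrite ffunE mxE.
  by apply/rowP => i; rewrite mxE ffunE.
transitivity (\sum_(f : {ffun 'I_d -> 'I_n})
    \prod_i (expi ((f i)%:R * ((m i)%:~R * (2 * pi) / n%:R)) : R[i])).
  by apply: eq_bigr => f _; rewrite expi_sum; apply: eq_bigr => i _; rewrite mxE.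
rewrite -(bigA_distr_bigA (fun i (j : 'I_n) => expi (j%:R * ((m i)%:~R * (2 * pi) / n%:R)) : R[i])).
under eq_bigr do rewrite sum_expi_root//.
case: ifPn => [/forallP m0|]; first by under eq_bigr do rewrite m0; rewrite prodr_const card_ord.
by rewrite negb_forall => /existsP[i mi]; rewrite (bigD1 i)//= (negbTE mi) mul0r.
Qed.

(** Differences of two modes of the box satisfy the bound [2 * N]. It stays below the number
    [2 * N + 1] of nodes per direction, so no aliasing occurs. *)
Lemma sum_grid_expi d N (k : 'rV[int]_d) : (forall i, (absz (k 0%R i) <= 2 * N)%N) ->
  \sum_j expi (dotZ k (@grid R d N j)) = if k == 0 then (2 * N).+1%:R ^+ d else 0 :> R[i].
Proof.
move=> kN; have := @sum_expi_grid d (2 * N).+1 (fun i => k 0 i) kN.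
have -> : [forall i, k 0 i == 0] = (k == 0).
  apply/forallP/eqP => [H|-> i]; last by rewrite mxE.
  by apply/rowP => i; rewrite mxE; exact/eqP.
move=> <-; apply: eq_bigr => j _; congr expi; apply: eq_bigr => i _.
by rewrite mxE; ring.
Qed.

Lemma sum_box_expi d N (l j : 'rV['I_(2 * N).+1]_d) :
  \sum_(k <- box_seq d N) expi (dotZ k (grid l) - dotZ k (grid j)) =
  if l == j then (2 * N).+1%:R ^+ d else 0 :> R[i].
Proof.
pose m i : int := Posz (l 0 i) - Posz (j 0 i).
have mn i : (`|m i| < (2 * N).+1)%N.
  by have := ltn_ord (l 0 i); have := ltn_ord (j 0 i); rewrite /m; lia.
have lj : [forall i, m i == 0] = (l == j).
  apply/forallP/eqP => [H|e i]; last by rewrite /m e subrr.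
  by apply/rowP => i; apply: val_inj; move: (H i); rewrite subr_eq0 => /eqP[].
rewrite -lj /box_seq big_map big_enum /=.
(* Phase due to the modes starting at [-N] instead of 0; it is 1 when [l = j]. *)
pose c : R[i] := expi (- \sum_i N%:R * ((m i)%:~R * (2 * pi) / (2 * N).+1%:R)).
transitivity (\sum_(x : 'rV['I_(2 * N).+1]_d) c *
  expi (\sum_i (x 0 i)%:R * ((m i)%:~R * (2 * pi) / (2 * N).+1%:R))).
  apply: eq_bigr => x _; rewrite /c -expiD; congr expi.
  rewrite /dotZ -!sumrN -!big_split/=; apply: eq_bigr => i _.
  by rewrite !mxE /m !intrD !mulrNz; ring.
rewrite -mulr_sumr sum_expi_grid//; case: ifPn => [/forallP m0|_]; last by rewrite mulr0.
rewrite /c big1 ?oppr0 ?expi0 ?mul1r// => i _.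
by rewrite (eqP (m0 i)) !mul0r mulr0.
Qed.

(** No symmetry is asked of [c]: taking the real part replaces [c] by [hermitian_part c].
    Coefficients can therefore be approximated one by one. *)
Definition trig_sum d N (c : 'rV[int]_d -> R[i]) (x : 'rV[R]_d) : R :=
  \sum_(k <- box_seq d N) (complex.Re (c k) * cos (dotZ k x) - complex.Im (c k) * sin (dotZ k x)).

Lemma trig_sumE d N c (x : 'rV[R]_d) :
  trig_sum N c x = complex.Re (\sum_(k <- box_seq d N) c k * expi (dotZ k x)).
Proof. by rewrite raddf_sum; apply: eq_bigr => k _; case: (c k). Qed.

Definition hermitian_part d (c : 'rV[int]_d -> R[i]) k : R[i] := (c k + conjc (c (- k))) / 2.

Lemma hermitian_part_trig_sum d N c (x : 'rV[R]_d) :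
  (trig_sum N c x)%:C%C = \sum_(k <- box_seq d N) hermitian_part c k * expi (dotZ k x).
Proof.
rewrite trig_sumE ReJ_add rmorph_sum/=.
rewrite -[X in _ + X](sum_box_seqN N (fun k => conjc (c k * expi (dotZ k x)))).
rewrite -big_split/= mulr_suml; apply: eq_bigr => k _.
by rewrite conjcM dotZN expiN conjcK /hermitian_part; ring.
Qed.

Lemma trig_polyP d N (p : 'rV[R]_d -> R) :
  trig_poly N p <-> exists c, p = trig_sum N c.
Proof.
split=> [[c pE]|[c ->]].
  exists c; apply/funext => x; rewrite trig_sumE -box_sumE.
  by have := congr1 (@complex.Re R) (pE x).
by exists (hermitian_part c) => x; rewrite hermitian_part_trig_sum box_sumE.
Qed.

Lemma fourierE d (v : 'rV[R]_d -> R) k : (torus_measure d).-integrable setT (EFin \o v) ->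
  fourier v k = Complex ((2 * pi) ^- d * \int[torus_measure d]_x (v x * cos (dotZ k x)))
    (- ((2 * pi) ^- d * \int[torus_measure d]_x (v x * sin (dotZ k x)))).
Proof.
move=> iv; rewrite /fourier /cintegral.
have -> : \int[torus_measure d]_x complex.Re ((v x)%:C%C * expi (- dotZ k x)) =
    \int[torus_measure d]_x (v x * cos (dotZ k x)).
  by apply: eq_Rintegral => x _ /=; rewrite cosN mul0r subr0.
have -> : \int[torus_measure d]_x complex.Im ((v x)%:C%C * expi (- dotZ k x)) =
    - \int[torus_measure d]_x (v x * sin (dotZ k x)).
  rewrite -mulN1r -RintegralZl//; last exact: integrable_mul (bounded_measurable_sin _).
  by apply: eq_Rintegral => x _ /=; rewrite sinN mul0r addr0 mulrN mulN1r.
by congr Complex; rewrite mul0r ?subr0 ?addr0// mulrN.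
Qed.

Lemma Rintegral_box_sum d N (F : 'rV[int]_d -> 'rV[R]_d -> R) :
  (forall k, bounded_measurable (F k)) ->
  bounded_measurable (fun x => \sum_(k <- box_seq d N) F k x) /\
  \int[torus_measure d]_x (\sum_(k <- box_seq d N) F k x) =
  \sum_(k <- box_seq d N) \int[torus_measure d]_x F k x.
Proof.
move=> bF; elim: (box_seq d N) => [|k s [bs IH]].
  under eq_fun do rewrite big_nil; rewrite big_nil; split; first exact: bounded_measurable_cst.
  by apply: etrans (Rintegral_cst _ measurableT _) _; rewrite mul0r.
split; first by under eq_fun do rewrite big_cons; exact: bounded_measurableD.
under eq_Rintegral do rewrite big_cons.
by rewrite RintegralD ?big_cons ?IH//; exact: bounded_measurable_integrable.
Qed.

Lemma bounded_measurable_trig_term d (k : 'rV[int]_d) (a b : R) :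
  bounded_measurable (fun x => a * cos (dotZ k x) - b * sin (dotZ k x)).
Proof.
rewrite (_ : (fun x => _) = fun x => a * cos (dotZ k x) + - b * sin (dotZ k x)).
  apply: bounded_measurableD; apply: bounded_measurableM; try exact: bounded_measurable_cst.
    exact: bounded_measurable_cos.
  exact: bounded_measurable_sin.
by apply/funext => x; rewrite mulNr.
Qed.

Lemma bounded_measurable_trig_sum d N (c : 'rV[int]_d -> R[i]) :
  bounded_measurable (trig_sum N c).
Proof.
exact: (Rintegral_box_sum N (fun k => bounded_measurable_trig_term k _ _)).1.
Qed.

(** In real form both [l] and [- l] contribute; at [l = 0] the two cases coincide and the halves add
    up or cancel. *)
Lemma Rintegral_trig_prod d (k l : 'rV[int]_d) (a b : R) :
  (\int[torus_measure d]_x ((a * cos (dotZ k x) - b * sin (dotZ k x)) * cos (dotZ l x)) =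
   (2 * pi) ^+ d * ((if k == l then a / 2 else 0) + (if k == - l then a / 2 else 0))) *
  (\int[torus_measure d]_x ((a * cos (dotZ k x) - b * sin (dotZ k x)) * sin (dotZ l x)) =
   (2 * pi) ^+ d * ((if k == - l then b / 2 else 0) - (if k == l then b / 2 else 0))).
Proof.
have comb (F : 'rV[R]_d -> R) (c1 s1 c2 s2 : R) :
  (forall x, F x = (c1 * cos (dotZ (k - l) x) - s1 * sin (dotZ (k - l) x)) +
                   (c2 * cos (dotZ (k + l) x) - s2 * sin (dotZ (k + l) x))) ->
  \int[torus_measure d]_x F x = (2 * pi) ^+ d *
    ((if k == l then c1 else 0) + (if k == - l then c2 else 0)).
  move=> FE; under eq_Rintegral do rewrite FE.
  have I m (c s : R) : \int[torus_measure d]_x (c * cos (dotZ m x) - s * sin (dotZ m x)) =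
      (2 * pi) ^+ d * (if m == 0 then c else 0).
    have ic := integrable_cos_dotZ m; have is_ := integrable_sin_dotZ m.
    have ZI a' (f : 'rV[R]_d -> R) : (torus_measure d).-integrable setT (EFin \o f) ->
        (torus_measure d).-integrable setT (EFin \o (fun x => a' * f x)).
      by move=> fi; have := integrableZl measurableT a' fi.
    rewrite RintegralB//; [|exact: ZI|exact: ZI].
    rewrite !RintegralZl// !torus_Rintegral_trig mulr0 subr0.
    by case: ifP => _; rewrite ?mulr0// mulrC.
  rewrite RintegralD//; [|exact/bounded_measurable_integrable/bounded_measurable_trig_term
    |exact/bounded_measurable_integrable/bounded_measurable_trig_term].
  by rewrite !I subr_eq0 addr_eq0 -mulrDr.
split.
  apply: (comb _ (a / 2) (b / 2) (a / 2) (b / 2)) => x.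
  by rewrite !dotZD dotZN !cosD !sinD cosN sinN; field.
rewrite (comb _ (- (b / 2)) (a / 2) (b / 2) (- (a / 2))) => [|x].
  congr (_ * _); rewrite addrC; congr (_ + _).
  by case: (k == l); rewrite ?oppr0.
by rewrite !dotZD dotZN !cosD !sinD cosN sinN; field.
Qed.

Lemma sum_if_hermitian d N (c : 'rV[int]_d -> R) l :
  \sum_(k <- box_seq d N) ((if k == l then c k / 2 else 0) + (if k == - l then c k / 2 else 0)) =
  (if l \in box_seq d N then (c l + c (- l)) / 2 else 0) /\
  \sum_(k <- box_seq d N) ((if k == - l then c k / 2 else 0) - (if k == l then c k / 2 else 0)) =
  (if l \in box_seq d N then (c (- l) - c l) / 2 else 0).
Proof.
rewrite big_split/= sumrB !(sum_box_seq1 N (fun k => c k / 2)) box_seqN.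
by case: ifP => _; rewrite ?addr0 ?subr0// mulrDl mulrBl.
Qed.

Lemma fourier_trig_sum d N (c : 'rV[int]_d -> R[i]) l :
  fourier (trig_sum N c) l = if l \in box_seq d N then hermitian_part c l else 0.
Proof.
rewrite fourierE; last exact/bounded_measurable_integrable/bounded_measurable_trig_sum.
have V0 : (2 * pi) ^+ d != 0 :> R by rewrite expf_neq0// mulf_neq0// gt_eqF// pi_gt0.
have bt k := bounded_measurable_trig_term k (complex.Re (c k)) (complex.Im (c k)).
have -> : \int[torus_measure d]_x (trig_sum N c x * cos (dotZ l x)) = (2 * pi) ^+ d *
    (if l \in box_seq d N then (complex.Re (c l) + complex.Re (c (- l))) / 2 else 0).
  under eq_Rintegral do rewrite /trig_sum mulr_suml.
  rewrite (Rintegral_box_sum N (fun k => bounded_measurableM (bt k) (bounded_measurable_cos l))).2.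
  under eq_bigr do rewrite Rintegral_trig_prod.
  by rewrite -mulr_sumr (sum_if_hermitian N (fun k => complex.Re (c k)) l).1.
have -> : \int[torus_measure d]_x (trig_sum N c x * sin (dotZ l x)) = (2 * pi) ^+ d *
    (if l \in box_seq d N then (complex.Im (c (- l)) - complex.Im (c l)) / 2 else 0).
  under eq_Rintegral do rewrite /trig_sum mulr_suml.
  rewrite (Rintegral_box_sum N (fun k => bounded_measurableM (bt k) (bounded_measurable_sin l))).2.
  under eq_bigr do rewrite Rintegral_trig_prod.
  by rewrite -mulr_sumr (sum_if_hermitian N (fun k => complex.Im (c k)) l).2.
rewrite !mulKf//; case: ifP => _; last by rewrite oppr0.
rewrite /hermitian_part -[2^-1 in RHS](_ : (2^-1)%:C%C = _); last first.
  by rewrite fmorphV rmorph_nat.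
case: (c l) => a b; case: (c (- l)) => a' b' /=.
by congr Complex; rewrite mulr0 ?subr0 ?add0r ?addr0//; ring.
Qed.

Lemma bounded_measurable_trig_poly d N (p : 'rV[R]_d -> R) : trig_poly N p -> bounded_measurable p.
Proof. by move=> /trig_polyP[c ->]; exact: bounded_measurable_trig_sum. Qed.

Lemma trig_poly_fourier d N (p : 'rV[R]_d -> R) : trig_poly N p ->
  (forall x, (p x)%:C%C = \sum_(k <- box_seq d N) fourier p k * expi (dotZ k x)) /\
  (forall k, k \notin box_seq d N -> fourier p k = 0).
Proof.
move=> /trig_polyP[c ->]; split=> [x|k kN]; last by rewrite fourier_trig_sum (negbTE kN).
rewrite hermitian_part_trig_sum big_seq [RHS]big_seq; apply: eq_bigr => k kN.
by rewrite fourier_trig_sum kN.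
Qed.

(** The coefficients are the discrete Fourier transform of [g], inverted at the nodes by
    [sum_box_expi]. *)
Lemma trig_poly_interpolation d N (g : 'rV['I_(2 * N).+1]_d -> R) :
  exists2 p : 'rV[R]_d -> R, trig_poly N p & forall j, p (grid j) = g j.
Proof.
pose n : R[i] := (2 * N).+1%:R ^+ d.
have n0 : n != 0 by rewrite expf_neq0// pnatr_eq0.
pose c k : R[i] := \sum_j n^-1 * ((g j)%:C%C * expi (- dotZ k (grid j))).
exists (trig_sum N c); first by apply/trig_polyP; exists c.
move=> l; rewrite trig_sumE.
have -> : \sum_(k <- box_seq d N) c k * expi (dotZ k (grid l)) = (g l)%:C%C.
  under eq_bigr do rewrite mulr_suml; rewrite exchange_big/=.
  transitivity (\sum_j n^-1 * (g j)%:C%C *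
      \sum_(k <- box_seq d N) expi (dotZ k (grid l) - dotZ k (grid j))).
    apply: eq_bigr => j _; rewrite mulr_sumr; apply: eq_bigr => k _.
    by rewrite addrC expiD; ring.
  under eq_bigr do rewrite sum_box_expi.
  rewrite (bigD1 l)//= big1 ?addr0 => [|j jl]; last by rewrite eq_sym (negbTE jl) mulr0.
  by rewrite eqxx mulrAC mulVf// mul1r.
by [].
Qed.

(** Quadrature on the grid is exact here, because a product of two modes of the box has degree at
    most [2 * N]. *)
Lemma trig_poly_fourier_grid d N (p : 'rV[R]_d -> R) k : trig_poly N p -> k \in box_seq d N ->
  fourier p k = ((2 * N).+1%:R ^+ d)^-1 * \sum_j (p (grid j))%:C%C * expi (- dotZ k (@grid R d N j)).
Proof.
move=> hp kN; have [pE _] := trig_poly_fourier hp.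
have n0 : (2 * N).+1%:R ^+ d != 0 :> R[i] by rewrite expf_neq0// pnatr_eq0.
apply: (mulfI n0); rewrite mulVKf//.
under [RHS]eq_bigr do rewrite pE mulr_suml.
rewrite exchange_big/=.
transitivity (\sum_(l <- box_seq d N) if l == k then (2 * N).+1%:R ^+ d * fourier p l else 0).
  by rewrite sum_box_seq1 kN.
rewrite big_seq [RHS]big_seq; apply: eq_bigr => l lN.
under eq_bigr do rewrite -mulrA -expiD -dotZN -dotZD.
rewrite -mulr_sumr sum_grid_expi => [|i].
  by rewrite subr_eq0; case: ifP => _; rewrite ?mulr0// mulrC.
move: kN lN; rewrite !mem_box_seq => /forallP/(_ i) h1 /forallP/(_ i) h2.
rewrite !mxE; move: (k 0 i) (l 0 i) h1 h2 => a b; lia.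
Qed.

Lemma normc_realC (a : R) : Normc.normc a%:C%C = `|a|.
Proof. by rewrite /Normc.normc/= expr0n addr0 sqrtr_sqr. Qed.

Lemma normc_sum (I : Type) (r : seq I) (F : I -> R[i]) :
  Normc.normc (\sum_(i <- r) F i) <= \sum_(i <- r) Normc.normc (F i).
Proof.
elim: r => [|i r IH]; first by rewrite !big_nil Normc.normc0.
by rewrite !big_cons (le_trans (le_normcD _ _))// lerD2l.
Qed.

(** A coefficient is an average of node values times phases. This converts accuracy at the nodes
    into accuracy in a Sobolev norm. *)
Lemma trig_poly_fourier_le d N (p : 'rV[R]_d -> R) B k : trig_poly N p -> 0 <= B ->
  (forall j, `|p (@grid R d N j)| <= B) -> Normc.normc (fourier p k) <= B.
Proof.
move=> hp B0 pB; have [kN|kN] := boolP (k \in box_seq d N); last first.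
  by rewrite (trig_poly_fourier hp).2// Normc.normc0.
rewrite (trig_poly_fourier_grid hp kN) Normc.normcM.
rewrite (_ : ((2 * N).+1%:R ^+ d)^-1 = (((2 * N).+1%:R ^+ d)^-1)%:C%C :> R[i]); last first.
  by rewrite fmorphV rmorphXn rmorph_nat.
have n0 : 0 < (2 * N).+1%:R ^+ d :> R by rewrite exprn_gt0.
have ni0 : 0 <= ((2 * N).+1%:R ^+ d)^-1 :> R by rewrite invr_ge0 ltW.
rewrite normc_realC (ger0_norm ni0) ler_pdivrMl//.
apply: le_trans (normc_sum _ _) _.
apply: (@le_trans _ _ (\sum_(j : 'rV['I_(2 * N).+1]_d) B)).
  by apply: ler_sum => j _; rewrite Normc.normcM normc_realC normc_expi mulr1.
by rewrite sumr_const card_mx card_ord mul1n -natrX mulr_natl.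
Qed.

Lemma interp1P d N (v : 'rV[R]_d -> R) :
  trig_poly N (interp1 N v) /\ forall j, interp1 N v (@grid R d N j) = v (grid j).
Proof.
have [p hp pE] := trig_poly_interpolation (fun j => v (@grid R d N j)).
have : ([set p | @trig_poly R d N p /\ forall j, p (@grid R d N j) = v (grid j)]) p by [].
by move=> /(xgetI (fun=> 0)).
Qed.

End trigonometric_polynomials.

(** * Sobolev spaces *)

Section continuity.
Context {R : realType} {T : topologicalType}.

Lemma continuous_sum (I : Type) (r : seq I) (F : I -> T -> R) :
  (forall i, continuous (F i)) -> continuous (fun x => \sum_(i <- r) F i x).
Proof.
move=> cF; elim: r => [|i r IH].
  by under eq_fun do rewrite big_nil; move=> x; exact: cvg_cst.
under eq_fun do rewrite big_cons.
by move=> x; apply: continuousD; [exact: cF|exact: IH].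
Qed.

Lemma continuous_lin (a b : R) (f g : T -> R) :
  continuous f -> continuous g -> continuous (fun x => a * f x - b * g x).
Proof.
move=> cf cg x; apply: cvgB; (apply: cvgM; first exact: cvg_cst); [exact: cf|exact: cg].
Qed.

Lemma continuous_scale (a : R) (f : T -> R) : continuous f -> continuous (fun x => a * f x).
Proof. by move=> cf x; apply: cvgM; [exact: cvg_cst|exact: cf]. Qed.

Lemma continuous_uniform_limit (V : T -> R) (S : nat -> T -> R) :
  (forall N, continuous (S N)) ->
  (forall e, 0 < e -> exists N, forall x, `|V x - S N x| <= e) -> continuous V.
Proof.
move=> cS VSe x; apply/cvgrPdist_le => e e0.
have e30 : 0 < e / 3 by rewrite divr_gt0.
have [N HN] := VSe _ e30.
have := cS N x => /cvgrPdist_le/(_ _ e30); apply: filterS => y xy.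
have -> : V x - V y = (V x - S N x) + (S N x - S N y) - (V y - S N y) by ring.
apply: le_trans (ler_normB _ _) _.
apply: le_trans (lerD (ler_normD _ _) (HN y)) _.
by apply: le_trans (lerD (lerD (HN x) xy) (lexx _)) _; lra.
Qed.

Lemma continuous_near_neq (v w : T -> R) y0 : continuous v -> continuous w ->
  v y0 != w y0 -> \forall y \near y0, v y != w y.
Proof.
move=> cv cw ny.
have cvw : (v y - w y) @[y --> y0] --> (v y0 - w y0) by apply: cvgB; [exact: cv|exact: cw].
have := cvgr_neq0 _ cvw; rewrite subr_eq0 => /(_ _ ny).
by apply: filterS => y; rewrite subr_eq0.
Qed.

Lemma continuous_col m (V : 'I_m -> T -> R) : (forall i, continuous (V i)) ->
  continuous (fun x => \col_i V i x).
Proof.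
move=> cV x; apply/cvg_ballP => e e0.
have : \forall y \near x, forall i, ball (V i x) e (V i y).
  by apply: filter_forall => i; have := cV i x => /cvg_ballP/(_ _ e0).
by apply: filterS => y H; split=> // i j; rewrite !mxE.
Qed.

Lemma continuous_entry m (z : T -> 'cV[R]_m) i : continuous z -> continuous (fun x => z x i 0).
Proof.
move=> cz x; apply: (@continuous_comp _ _ _ z (fun M : 'cV[R]_m => M i 0)); first exact: cz.
exact: coord_continuous.
Qed.

End continuity.

(** * Summability of the inverse Sobolev weights *)

Section weight_summability.
Context {R : realType}.

(** Comparison with the telescoping sum of [x ^ (1 - p) / (p - 1)], by the mean value theorem on
    each unit interval; the constant is [1 + 1 / (p - 1)], where 1 is the first term. *)
Lemma sum_powR_bound (p : R) : 1 < p ->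
  exists C, forall n, \sum_(j < n) (j.+1%:R `^ p)^-1 <= C.
Proof.
move=> p1; have p10 : 0 < p - 1 by rewrite subr_gt0.
have step (j : nat) : (j.+2%:R `^ p)^-1 <=
    ((j.+1%:R `^ (1 - p)) - (j.+2%:R `^ (1 - p))) / (p - 1).
  have jj : j.+1%:R < j.+2%:R :> R by rewrite ltr_nat.
  have j0 : 0 < j.+1%:R :> R by rewrite ltr0n.
  have D (x : R) : x \in `[j.+1%:R, j.+2%:R] ->
      is_derive x (1 : R) ((@powR R)^~ (1 - p)) ((1 - p) * x `^ (1 - p - 1)).
    rewrite in_itv/= => /andP[x1 _]; apply: is_derive1_powR.
    exact: lt_le_trans x1.
  have D' (x : R) : x \in `]j.+1%:R, j.+2%:R[ ->
      is_derive x (1 : R) ((@powR R)^~ (1 - p)) ((1 - p) * x `^ (1 - p - 1)).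
    by move=> xj; apply: D; exact: subset_itv_oo_cc.
  have cD : {within `[j.+1%:R, j.+2%:R], continuous ((@powR R)^~ (1 - p))}.
    by apply: derivable_within_continuous => x /D[].
  have [x] := MVT jj D' cD.
  rewrite in_itv/= => /andP[x1 x2] e.
  rewrite -opprB e -natr1 [_ + 1 - _]addrC addKr mulr1 -mulNr opprB.
  rewrite mulrAC divff ?gt_eqF// mul1r.
  have -> : 1 - p - 1 = - p by ring.
  have x0 : 0 < x by exact: lt_trans x1.
  rewrite powRN lef_pV2 ?posrE ?powR_gt0 ?ltr0n//.
  rewrite natr1; apply: ge0_ler_powR.
  - exact: ltW (lt_trans ltr01 p1).
  - by rewrite nnegrE ltW.
  - by rewrite nnegrE ler0n.
  - exact: ltW.
exists (1 + (p - 1)^-1) => -[|n].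
  by rewrite big_ord0 addr_ge0// invr_ge0 ltW.
apply: (@le_trans _ _ (1 + (1 - n.+1%:R `^ (1 - p)) / (p - 1))); last first.
  rewrite lerD2l -[leRHS]mul1r ler_wpM2r ?invr_ge0 ?(ltW p10)//.
elim: n => [|n IH].
  by rewrite big_ord_recr big_ord0/= !powR1 subrr mul0r addr0 add0r invr1.
rewrite big_ord_recr/=; apply: le_trans (lerD IH (step n)) _.
rewrite -addrA -mulrDl; lra.
Qed.

Lemma enorm_ge d (k : 'rV[int]_d) i : `|(k 0 i)%:~R| <= enorm k :> R.
Proof.
rewrite /enorm -sqrtr_sqr ler_sqrt ?sumr_ge0// => [|j _]; last exact: sqr_ge0.
by rewrite (bigD1 i)//= lerDl sumr_ge0// => j _; exact: sqr_ge0.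
Qed.

Lemma enorm_ge0 d (k : 'rV[int]_d) : 0 <= enorm k :> R.
Proof. exact: sqrtr_ge0. Qed.

Definition sobolev_weight d (s : R) (k : 'rV[int]_d) : R := 1 + enorm k `^ (2 * s).

Lemma sobolev_weight_ge1 d s (k : 'rV[int]_d) : 1 <= sobolev_weight s k.
Proof. by rewrite lerDl powR_ge0. Qed.

Lemma sobolev_weight_gt0 d s (k : 'rV[int]_d) : 0 < sobolev_weight s k.
Proof. exact: lt_le_trans (sobolev_weight_ge1 s k). Qed.

(** Each [1 + |k_i|] is at most [1 + |k|], and [(1 + |k|) ^ (2 s) <= 2 ^ (2 s) (1 + |k| ^ (2 s))].
    The product form splits sums over a box into one-dimensional sums, whose exponent [2 s / d]
    exceeds 1 exactly when [s > d / 2]. *)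
Lemma sobolev_weight_prod d s (k : 'rV[int]_d) : (0 < d)%N -> 0 <= s ->
  \prod_(i < d) (absz (k 0%R i)).+1%:R `^ (2 * s / d%:R) <= 2 `^ (2 * s) * sobolev_weight s k.
Proof.
move=> d0 s0; have dn0 : d%:R != 0 :> R by rewrite pnatr_eq0 -lt0n.
have e0 := enorm_ge0 k; have s20 : 0 <= 2 * s by rewrite mulr_ge0.
apply: (@le_trans _ _ (\prod_(i < d) (1 + enorm k) `^ (2 * s / d%:R))).
  apply: ler_prod => i _; rewrite powR_ge0/= ge0_ler_powR ?nnegrE ?addr_ge0//.
    by rewrite divr_ge0.
  rewrite -natr1 addrC lerD2l; apply: le_trans (enorm_ge k i).
  by rewrite -intr_norm -abszE.
rewrite prodr_const card_ord -powR_mulrn ?powR_ge0// -powRrM divfK//.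
have [e1|e1] := leP (enorm k : R) 1.
  apply: (@le_trans _ _ (2 `^ (2 * s))); last first.
    by rewrite ler_peMr ?powR_ge0// sobolev_weight_ge1.
  by rewrite ge0_ler_powR ?nnegrE ?addr_ge0//; lra.
apply: (@le_trans _ _ ((2 * enorm k) `^ (2 * s))).
  by rewrite ge0_ler_powR ?nnegrE ?addr_ge0 ?mulr_ge0//; lra.
by rewrite powRM// ler_wpM2l ?powR_ge0// /sobolev_weight lerDr.
Qed.

Lemma sum_box_prod d N (g : nat -> R) :
  \sum_(k <- box_seq d N) \prod_(i < d) g (absz (k 0%R i)) =
  (\sum_(j < (2 * N).+1) g (absz (Posz j - Posz N))) ^+ d.
Proof.
rewrite /box_seq big_map big_enum/=.
rewrite (reindex (fun f : {ffun 'I_d -> 'I_(2 * N).+1} => \row_i f i)) /=; last first.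
  exists (fun j : 'rV['I_(2 * N).+1]_d => [ffun i => j 0 i]) => x _.
    by apply/ffunP => i; rewrite ffunE mxE.
  by apply/rowP => i; rewrite mxE ffunE.
rewrite -[in RHS](card_ord d) -prodr_const.
rewrite (bigA_distr_bigA (fun (i : 'I_d) (j : 'I_(2 * N).+1) => g (absz (Posz j - Posz N)))).
by apply: eq_bigr => f _; apply: eq_bigr => i _; rewrite !mxE.
Qed.

Lemma sum_centered N (g : nat -> R) : (forall n, 0 <= g n) ->
  \sum_(j < (2 * N).+1) g (absz (Posz j - Posz N)) <= 2 * \sum_(j < N.+1) g j.
Proof.
move=> g0; elim: N => [|N IH].
  by rewrite !big_ord_recr !big_ord0/= !add0r mulr_natl mulr2n lerDl.
rewrite (_ : (2 * N.+1).+1 = (2 * N).+3)%N; last by lia.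
rewrite big_ord_recl big_ord_recr/= [X in _ <= _ * X]big_ord_recr/= mulrDr.
rewrite addrCA lerD//.
  apply: le_trans IH; rewrite le_eqVlt; apply/orP; left; apply/eqP.
  by apply: eq_bigr => i _; congr g; rewrite /bump /=; lia.
rewrite mulr_natl mulr2n le_eqVlt; apply/orP; left; apply/eqP.
by congr (g _ + g _); rewrite /bump /=; lia.
Qed.

Lemma sum_inv_sobolev_weight d (s : R) : (0 < d)%N -> d%:R / 2 < s ->
  exists2 C, 0 <= C & forall N, \sum_(k <- box_seq d N) (sobolev_weight s k)^-1 <= C.
Proof.
move=> d0 ds; have dn0 : 0 < d%:R :> R by rewrite ltr0n.
have s0 : 0 <= s by rewrite ltW// (le_lt_trans _ ds)// divr_ge0.
pose p := 2 * s / d%:R.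
have p1 : 1 < p by rewrite ltr_pdivlMr// mul1r mulrC -ltr_pdivrMr.
have [C0 HC0] := sum_powR_bound p1.
have C00 : 0 <= C0 by rewrite (le_trans _ (HC0 0%N))// big_ord0.
exists (2 `^ (2 * s) * (2 * C0) ^+ d).
  by rewrite mulr_ge0 ?powR_ge0// exprn_ge0// mulr_ge0.
move=> N; apply: (@le_trans _ _ (\sum_(k <- box_seq d N) 2 `^ (2 * s) *
    \prod_(i < d) ((absz (k 0%R i)).+1%:R `^ p)^-1)).
  apply: ler_sum => k _; have P0 : 0 < \prod_(i < d) (absz (k 0%R i)).+1%:R `^ p.
    by apply: prodr_gt0 => i _; rewrite powR_gt0.
  rewrite prodfV ler_pdivlMr// ler_pdivrMl ?sobolev_weight_gt0// mulrC.
  exact: sobolev_weight_prod.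
rewrite -mulr_sumr ler_wpM2l ?powR_ge0//.
rewrite (sum_box_prod d N (fun n => (n.+1%:R `^ p)^-1)).
have S0 : 0 <= \sum_(j < (2 * N).+1) ((absz (Posz j - Posz N)).+1%:R `^ p)^-1 :> R.
  by apply: sumr_ge0 => j _; rewrite invr_ge0 powR_ge0.
rewrite lerXn2r ?nnegrE ?mulr_ge0//.
have g0 n : 0 <= (n.+1%:R `^ p)^-1 :> R by rewrite invr_ge0 powR_ge0.
apply: le_trans (sum_centered N g0) _.
by rewrite ler_wpM2l// HC0.
Qed.

(* Cauchy-Schwarz in the form [2 c <= t / w + w c^2 / t]. *)
Lemma sum_weighted_le d (s C B t : R) N (c : 'rV[int]_d -> R) : 0 < t ->
  \sum_(k <- box_seq d N) (sobolev_weight s k)^-1 <= C ->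
  \sum_(k <- box_seq d N) sobolev_weight s k * c k ^+ 2 <= B ->
  \sum_(k <- box_seq d N) c k <= (t * C + B / t) / 2.
Proof.
move=> t0 hC hB.
apply: (@le_trans _ _ (\sum_(k <- box_seq d N)
   (t * (sobolev_weight s k)^-1 + sobolev_weight s k * c k ^+ 2 / t) / 2)).
  apply: ler_sum => k _; set w := sobolev_weight s k.
  have w0 : 0 < w := sobolev_weight_gt0 s k.
  rewrite -subr_ge0.
  have -> : (t / w + w * c k ^+ 2 / t) / 2 - c k = (t - w * c k) ^+ 2 / (2 * w * t).
    by field; rewrite !gt_eqF.
  by rewrite divr_ge0 ?sqr_ge0// !mulr_ge0// ltW.
rewrite -mulr_suml big_split/= -mulr_sumr -mulr_suml ler_wpM2r// lerD//.
  by rewrite ler_wpM2l// ltW.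
by rewrite ler_wpM2r// invr_ge0 ltW.
Qed.

End weight_summability.

(** * Absolutely convergent Fourier series *)

Section fourier_series.
Context {R : realType} {d : nat}.
Local Notation mu := (@torus_measure R d).

Lemma box_seq_le N M (k : 'rV[int]_d) : (N <= M)%N -> k \in box_seq d N -> k \in box_seq d M.
Proof.
move=> NM; rewrite !mem_box_seq => /forallP kN; apply/forallP => i.
exact: leq_trans (kN i) NM.
Qed.

Lemma sum_box_le (V : zmodType) N M (F : 'rV[int]_d -> V) : (N <= M)%N ->
  \sum_(k <- box_seq d M) F k =
  \sum_(k <- box_seq d N) F k + \sum_(k <- box_seq d M | k \notin box_seq d N) F k.
Proof.
move=> NM; rewrite (bigID (fun k => k \in box_seq d N))/=; congr (_ + _).
rewrite -big_filter; apply: perm_big; apply: uniq_perm.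
- by rewrite filter_uniq// box_seq_uniq.
- exact: box_seq_uniq.
- by move=> k; rewrite mem_filter; apply/andP/idP => [[]//|kN]; rewrite kN (box_seq_le NM).
Qed.

Lemma continuous_dotZ (k : 'rV[int]_d) : continuous (@dotZ R d k).
Proof.
apply: (@continuous_sum _ _ _ _ (fun i (x : 'rV[R]_d) => (k 0 i)%:~R * x 0 i)) => i.
by apply: continuous_scale; exact: coord_continuous.
Qed.

Lemma continuous_trig_sum N (c : 'rV[int]_d -> R[i]) : continuous (trig_sum N c).
Proof.
apply: (@continuous_sum _ _ _ _ (fun k (x : 'rV[R]_d) =>
  complex.Re (c k) * cos (dotZ k x) - complex.Im (c k) * sin (dotZ k x))) => k.
apply: (@continuous_lin _ _ _ _ (fun x => cos (dotZ k x)) (fun x => sin (dotZ k x))).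
  by move=> y; apply: (continuous_comp (@continuous_dotZ k y)); exact: continuous_cos.
by move=> y; apply: (continuous_comp (@continuous_dotZ k y)); exact: continuous_sin.
Qed.

Lemma dotZ_shift (k l : 'rV[int]_d) (x : 'rV[R]_d) :
  dotZ k (x + \row_i (2 * pi * (l 0 i)%:~R)) =
  dotZ k x + (\sum_i k 0 i * l 0 i)%:~R * (2 * pi).
Proof.
rewrite /dotZ rmorph_sum mulr_suml -big_split/=; apply: eq_bigr => i _.
by rewrite !mxE intrM; ring.
Qed.

Lemma trig_sum_periodic N (c : 'rV[int]_d -> R[i]) : torus_periodic (trig_sum N c).
Proof.
move=> x l; apply: eq_bigr => k _.
by rewrite dotZ_shift cosD sinD !sin_cos_2pi_int !mulr0 !mulr1 subr0 addr0.
Qed.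

Lemma trig_poly_continuous_periodic N (p : 'rV[R]_d -> R) : trig_poly N p ->
  continuous p /\ torus_periodic p.
Proof.
by move=> /trig_polyP[c ->]; split; [exact: continuous_trig_sum|exact: trig_sum_periodic].
Qed.

Lemma trig_term_le (c : R[i]) (t : R) :
  `|complex.Re c * cos t - complex.Im c * sin t| <= Normc.normc c.
Proof.
have -> : complex.Re c * cos t - complex.Im c * sin t = complex.Re (c * expi t).
  by case: c.
rewrite -[leRHS]mulr1 -(normc_expi t) -Normc.normcM.
case: (c * expi t) => a b; rewrite /Normc.normc/= -sqrtr_sqr ler_sqrt ?addr_ge0 ?sqr_ge0//.
by rewrite lerDl sqr_ge0.
Qed.

Lemma normc_ge0 (z : R[i]) : 0 <= Normc.normc z.
Proof. by case: z => a b; exact: sqrtr_ge0. Qed.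

Lemma trig_sum_le N (c : 'rV[int]_d -> R[i]) x :
  `|trig_sum N c x| <= \sum_(k <- box_seq d N) Normc.normc (c k).
Proof.
by apply: le_trans (ler_norm_sum _ _ _) _; apply: ler_sum => k _; exact: trig_term_le.
Qed.

Lemma fourier_herm (f : 'rV[R]_d -> R) k : mu.-integrable setT (EFin \o f) ->
  fourier f (- k) = conjc (fourier f k).
Proof.
move=> fi; rewrite !fourierE//.
have -> : \int[mu]_x (f x * cos (dotZ (- k) x)) = \int[mu]_x (f x * cos (dotZ k x)).
  by apply: eq_Rintegral => x _; rewrite dotZN cosN.
have -> : \int[mu]_x (f x * sin (dotZ (- k) x)) = - \int[mu]_x (f x * sin (dotZ k x)).
  rewrite -mulN1r -RintegralZl//; last exact: integrable_mul (bounded_measurable_sin _).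
  by apply: eq_Rintegral => x _; rewrite dotZN sinN mulrN mulN1r.
by rewrite /= mulrN.
Qed.

(** The partial sums over boxes converge uniformly, their increments being dominated by those of the
    convergent sequence [T]. The limit [V] has the Fourier coefficients of [f], so [V - f] is
    annihilated and vanishes almost everywhere. *)
Lemma absolutely_summable_fourier (f : 'rV[R]_d -> R) (B : R) :
  mu.-integrable setT (EFin \o f) ->
  (forall N, \sum_(k <- box_seq d N) Normc.normc (fourier f k) <= B) ->
  exists V : 'rV[R]_d -> R, [/\ continuous V, torus_periodic V,
    forall x, trig_sum N (fourier f) x @[N --> \oo] --> V x &
    \forall x \ae mu, V x = f x].
Proof.
move=> fi fB.
pose T N := \sum_(k <- box_seq d N) Normc.normc (fourier f k).
pose S N := @trig_sum R d N (fourier f).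
have Tdiff N M : (N <= M)%N -> forall x, `|S M x - S N x| <= T M - T N.
  move=> NM x; rewrite /S /T /trig_sum !(sum_box_le _ NM) !(addrC (\sum_(k <- box_seq d N) _)) !addrK.
  by apply: le_trans (ler_norm_sum _ _ _) _; apply: ler_sum => k _; exact: trig_term_le.
have Tmono : nondecreasing_seq T.
  move=> N M NM; rewrite /T (sum_box_le _ NM) lerDl sumr_ge0// => k _; exact: normc_ge0.
have Tcvg : cvgn T.
  by apply: nondecreasing_is_cvgn => //; exists B => _ [N _ <-]; exact: fB.
have Tle N : T N <= limn T by exact: nondecreasing_cvgn_le.
have Scvg x : cvgn (S ^~ x).
  apply: cauchy_cvg; apply: cauchy_exP => e e0.
  have [N _ HN] : \forall N \near \oo, `|limn T - T N| < e by apply: cvgr_dist_lt.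
  exists (S N x); exists N => // M /= NM; rewrite /ball/= distrC.
  apply: le_lt_trans (Tdiff _ _ NM x) _; apply: le_lt_trans (HN N (leqnn N)).
  by rewrite (le_trans _ (ler_norm _))// lerD2r.
pose V x := limn (S ^~ x).
have VS N x : `|V x - S N x| <= limn T - T N.
  apply: (@cvgr_to_le _ \oo _ _ (fun M => `|S M x - S N x|)).
    by apply: cvg_norm; apply: cvgB; [exact: Scvg|exact: cvg_cst].
  exists N => // M /= NM; apply: le_trans (Tdiff _ _ NM x) _.
  by rewrite lerD2r.
have VSe e : 0 < e -> exists N, forall x, `|V x - S N x| <= e.
  move=> e0; have [N _ HN] : \forall N \near \oo, `|limn T - T N| < e by apply: cvgr_dist_lt.
  exists N => x; apply: le_trans (VS N x) _.
  by apply: ltW; apply: le_lt_trans (HN N (leqnn N)); exact: ler_norm.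
have cV : continuous V.
  by apply: (continuous_uniform_limit _ VSe) => N; exact: continuous_trig_sum.
have SB N x : `|S N x| <= B.
  by apply: le_trans (trig_sum_le _ _ _) _; exact: fB.
have mS N : measurable_fun setT (S N) by exact: (bounded_measurable_trig_sum N (fourier f)).1.
have bV : bounded_measurable V.
  split; first by apply: (measurable_fun_cvg mS) => x _; exact: Scvg.
  by exists B => x; exact: (norm_lim_le (Scvg x)).
exists V; split=> //.
  move=> x l; rewrite /V (_ : S ^~ (x + _) = S ^~ x)//.
  by apply/funext => N; exact: trig_sum_periodic.
have fS N l : l \in box_seq d N -> fourier (S N) l = fourier f l.
  move=> lN; rewrite fourier_trig_sum lN /hermitian_part fourier_herm// conjcK.
  by rewrite mulrDl -splitr.
have V0 : (2 * pi) ^- d != 0 :> R by rewrite invr_eq0 expf_neq0// mulf_neq0// gt_eqF// pi_gt0.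
have mem_large (l : 'rV[int]_d) : exists N, l \in box_seq d N.
  exists (\max_(i < d) absz (l 0%R i)); rewrite mem_box_seq; apply/forallP => i.
  exact: (leq_bigmax i).
have ann : annihilated (fun x => V x + -1 * f x).
  have iV := bounded_measurable_integrable bV.
  have iNf : mu.-integrable setT (EFin \o (fun x => -1 * f x)).
    by have := integrableZl measurableT (-1) fi.
  split; first by have := integrableD measurableT iV iNf.
  have split_int g : bounded_measurable g -> \int[mu]_x ((V x + -1 * f x) * g x) =
      \int[mu]_x (g x * V x) - \int[mu]_x (f x * g x).
    move=> bg; under eq_Rintegral do rewrite mulrDl -mulrA.
    have ifg := integrable_mul fi bg.
    rewrite RintegralD//.
    - rewrite RintegralZl// mulN1r; congr (_ - _).
      by apply: eq_Rintegral => x _; rewrite mulrC.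
    - exact: integrable_mul iV bg.
    - by have := integrableZl measurableT (-1) ifg.
  (* Against a fixed mode the integrals of the partial sums are eventually constant, and dominated
     convergence identifies their limit. *)
  have lim_int g : bounded_measurable g -> (\forall N \near \oo, \int[mu]_x (g x * S N x) = \int[mu]_x (f x * g x)) ->
      \int[mu]_x (g x * V x) = \int[mu]_x (f x * g x).
    move=> bg ev.
    have [_] := Rintegral_cvg (bounded_measurable_integrable bg) mS SB Scvg.
    move=> H; apply: (@cvg_unique _ _ _ _ _ _ H) => //.
    exact: cvg_near_cst.
  move=> l; have [N0 lN0] := mem_large l.
  have ev : \forall N \near \oo, fourier (S N) l = fourier f l.
    by exists N0 => // N /= N0N; apply: fS; exact: box_seq_le lN0.
  have fE N : fourier (S N) l = fourier f l ->
    \int[mu]_x (cos (dotZ l x) * S N x) = \int[mu]_x (f x * cos (dotZ l x)) /\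
    \int[mu]_x (sin (dotZ l x) * S N x) = \int[mu]_x (f x * sin (dotZ l x)).
    have iS := bounded_measurable_integrable (bounded_measurable_trig_sum N (fourier f)).
    rewrite (fourierE l iS) (fourierE l fi) => -[/(mulfI V0) ec /oppr_inj/(mulfI V0) es].
    by rewrite -ec -es; split; apply: eq_Rintegral => x _; rewrite mulrC.
  rewrite !split_int; [|exact: bounded_measurable_sin|exact: bounded_measurable_cos].
  split; apply/eqP; rewrite subr_eq0; apply/eqP; apply: lim_int.
  - exact: bounded_measurable_cos.
  - by apply: filterS ev => N /fE[].
  - exact: bounded_measurable_sin.
  - by apply: filterS ev => N /fE[].
apply: filterS (annihilated_ae_eq0 ann) => x /eqP.
by rewrite mulN1r subr_eq0 => /eqP.
Qed.

Lemma continuous_periodic_ae_eq (v w : 'rV[R]_d -> R) : continuous v -> torus_periodic v ->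
  continuous w -> torus_periodic w -> (\forall x \ae mu, v x = w x) -> v = w.
Proof.
move=> cv pv cw pw vw; apply/funext => x0; apply: contrapT => nvw.
pose k : 'rV[int]_d := \row_i - Num.floor (x0 0 i / (2 * pi)).
pose y0 := x0 + \row_i (2 * pi * (k 0 i)%:~R) : 'rV[R]_d.
have p2 : 0 < 2 * pi :> R by rewrite mulr_gt0// pi_gt0.
have y0i i : 0 <= y0 0 i < 2 * pi.
  rewrite !mxE mulrNz; have := floor_itv (x0 0 i / (2 * pi)).
  rewrite intrD => /andP[]; rewrite ler_pdivlMr// ltr_pdivrMr// mulrDl => h1 h2.
  by apply/andP; split; lra.
have ny : v y0 != w y0 by rewrite /y0 pv pw; exact/eqP.
have near0 := continuous_near_neq cv cw ny.
have /nbhs_ballP[e /= e0 He] := near0.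
(* The box extends only to the right of [y0], whose coordinates may be 0 but are less than [2 * pi];
   it is cut at [2 * pi] to stay where the measure lives. *)
pose a i := y0 0 i; pose b i := Num.min (y0 0 i + e / 2) (2 * pi).
have a0 i : 0 <= a i by have /andP[] := y0i i.
have ab i : a i < b i.
  by rewrite lt_min ltrDl divr_gt0//=; have /andP[] := y0i i.
have b2 i : b i <= 2 * pi by rewrite ge_min lexx orbT.
have [N [mN N0 sN]] := vw.
have := torus_box_gt0 a0 ab b2; rewrite ltNge => /negP; apply.
rewrite -N0; apply: le_measure; rewrite ?inE//; first exact: measurable_rV_box.
move=> y /= yab; apply: sN => /= vwy.
have : v y != w y; last by rewrite vwy eqxx.
apply: He; split=> // i j; rewrite (ord1 i) /ball/=.
have /andP[ay] := yab j; rewrite le_min => /andP[yb _].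
rewrite distrC ger0_norm ?subr_ge0// ltrBlDl (le_lt_trans yb)// ltrD2l.
by rewrite ltr_pdivrMr// mulr_natr mulr2n ltrDl.
Qed.

End fourier_series.

(** * Sobolev norms through partial sums over boxes *)

Section sobolev_energy.
Context {R : realType} {d : nat}.
Local Notation mu := (@torus_measure R d).

Lemma mem_box_seq_large (l : 'rV[int]_d) : exists N, l \in box_seq d N.
Proof.
exists (\max_(i < d) absz (l 0%R i)); rewrite mem_box_seq; apply/forallP => i.
exact: (leq_bigmax i).
Qed.

Lemma esum_box_ge (a : 'rV[int]_d -> R) N : (forall k, 0 <= a k) ->
  ((\sum_(k <- box_seq d N) a k)%:E <= \esum_(k in [set: 'rV[int]_d]) (a k)%:E)%E.
Proof.
move=> a0; apply: ereal_sup_ubound; exists [set` box_seq d N].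
  by split=> //; exact: finite_seq.
rewrite -sumEFin; exact/esym/fsbig_seq/box_seq_uniq.
Qed.

Lemma esum_box_le (a : 'rV[int]_d -> R) B : (forall k, 0 <= a k) ->
  (forall N, \sum_(k <- box_seq d N) a k <= B) ->
  (\esum_(k in [set: 'rV[int]_d]) (a k)%:E <= B%:E)%E.
Proof.
move=> a0 aB; apply: ub_ereal_sup => _ [A [finA _] <-].
have [r ur Ar] : exists2 r : seq 'rV[int]_d, uniq r & A = [set` r].
  by move/finite_seqP : finA => [r ->]; exists (undup r); rewrite ?undup_uniq//;
    apply/seteqP; split=> k /=; rewrite mem_undup.
have [N rN] : exists N, forall k, k \in r -> k \in box_seq d N.
  elim: r {ur Ar} => [|k r [N rN]]; first by exists 0%N.
  have [M kM] := mem_box_seq_large k; exists (maxn N M) => l.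
  rewrite inE => /orP[/eqP->|/rN]; first by apply: box_seq_le kM; exact: leq_maxr.
  by apply: box_seq_le; exact: leq_maxl.
rewrite Ar -fsbig_seq// sumEFin lee_fin; apply: le_trans (aB N).
have -> : \sum_(i <- r) a i = \sum_(i <- box_seq d N | i \in r) a i.
  rewrite -[RHS]big_filter; apply: perm_big; apply: uniq_perm => //.
    by rewrite filter_uniq// box_seq_uniq.
  by move=> k; rewrite mem_filter; apply/idP/andP => [kr|[]//]; split=> //; exact: rN.
by rewrite big_mkcond/=; apply: ler_sum => k _; case: ifP.
Qed.

(** Real-valued truncation of the squared norm. The boxes exhaust the modes, so a bound on the norm
    amounts to a bound on all truncations, and estimates can stay in [R]. *)
Definition sobolev_energy m (s : R) N (c : 'rV[int]_d -> 'I_m -> R[i]) : R :=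
  (2 * pi) ^+ d / 2 *
  \sum_(k <- box_seq d N) sobolev_weight s k * \sum_i Normc.normc (c k i) ^+ 2.

Lemma torus_volume_gt0 : 0 < (2 * pi) ^+ d / 2 :> R.
Proof. by rewrite divr_gt0// exprn_gt0// mulr_gt0// pi_gt0. Qed.

Lemma energy_term_ge0 m (s : R) (c : 'rV[int]_d -> 'I_m -> R[i]) k :
  0 <= sobolev_weight s k * \sum_i Normc.normc (c k i) ^+ 2.
Proof. by rewrite mulr_ge0 ?sumr_ge0// ?ltW ?sobolev_weight_gt0// => i _; exact: sqr_ge0. Qed.

Lemma sobolev_norm_le m s (v : 'rV[R]_d -> 'cV[R]_m) e : 0 <= e ->
  (forall N, sobolev_energy s N (fun k i => fourier_vec v k i 0) <= e ^+ 2) ->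
  (sobolev_norm s v <= e%:E)%E.
Proof.
move=> e0 H; have V0 := torus_volume_gt0.
have : (((2 * pi) ^+ d / 2)%:E * (\esum_(k in [set: 'rV[int]_d])
    (sobolev_weight s k * \sum_i Normc.normc (fourier_vec v k i 0) ^+ 2)%:E) <= (e ^+ 2)%:E)%E.
  rewrite -lee_pdivlMl// -EFinM; apply: esum_box_le => [k|N]; first exact: (energy_term_ge0 s (fun k i => fourier_vec v k i 0)).
  by rewrite ler_pdivlMl//; exact: H.
rewrite /sobolev_norm -/(sobolev_weight s _); move: (_ * _)%E => -[r|//|//] /=.
  rewrite !lee_fin => re; rewrite -(ger0_norm e0) -sqrtr_sqr.
  by have [r0|r0] := leP 0 r; [rewrite ler_sqrt// sqr_ge0|rewrite ltr0_sqrtr// sqrtr_ge0].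
Qed.

Lemma sobolev_energy_le m s (v : 'rV[R]_d -> 'cV[R]_m) e :
  (sobolev_norm s v <= e%:E)%E ->
  forall N, sobolev_energy s N (fun k i => fourier_vec v k i 0) <= e ^+ 2.
Proof.
move=> ve N; have V0 := torus_volume_gt0.
have e0 : 0 <= e.
  by rewrite -lee_fin (le_trans _ ve)// /sobolev_norm sqrte_ge0.
have : ((sobolev_energy s N (fun k i => fourier_vec v k i 0))%:E <=
    ((2 * pi) ^+ d / 2)%:E * \esum_(k in [set: 'rV[int]_d])
    (sobolev_weight s k * \sum_i Normc.normc (fourier_vec v k i 0) ^+ 2)%:E)%E.
  rewrite /sobolev_energy EFinM lee_pmul2l//.
  apply: esum_box_ge => k.
  exact: (energy_term_ge0 s (fun k i => fourier_vec v k i 0)).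
move: ve; rewrite /sobolev_norm; set X := (_ * _)%E.
have : (0 <= X)%E.
  rewrite /X mule_ge0 ?lee_fin ?(ltW V0)//; apply: esum_ge0 => k _.
  by rewrite lee_fin; exact: (energy_term_ge0 s (fun k i => fourier_vec v k i 0)).
case: X => [r|//|//] /=; rewrite !lee_fin => r0 re ler; apply: le_trans ler _.
by rewrite -(sqr_sqrtr r0) lerXn2r// nnegrE sqrtr_ge0.
Qed.

Lemma sobolev_energy_bounded m s (v : 'rV[R]_d -> 'cV[R]_m) : (sobolev_norm s v < +oo)%E ->
  exists B, forall N, sobolev_energy s N (fun k i => fourier_vec v k i 0) <= B.
Proof.
move=> v_fin; have : (sobolev_norm s v <= (fine (sobolev_norm s v))%:E)%E.
  by rewrite fineK// ge0_fin_numE// sqrte_ge0.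
by move=> /sobolev_energy_le H; eexists; exact: H.
Qed.

Lemma fourierB (f g : 'rV[R]_d -> R) k : mu.-integrable setT (EFin \o f) ->
  mu.-integrable setT (EFin \o g) -> fourier (fun x => f x - g x) k = fourier f k - fourier g k.
Proof.
move=> fi gi; have fgi : mu.-integrable setT (EFin \o (fun x => f x - g x)).
  by have := integrableB measurableT fi gi.
rewrite (fourierE k fi) (fourierE k gi) (fourierE k fgi).
have bc := bounded_measurable_cos k; have bs := bounded_measurable_sin k.
have -> : \int[mu]_x ((f x - g x) * cos (dotZ k x)) =
    \int[mu]_x (f x * cos (dotZ k x)) - \int[mu]_x (g x * cos (dotZ k x)).
  under eq_Rintegral do rewrite mulrBl.
  by rewrite RintegralB//; exact: integrable_mul.
have -> : \int[mu]_x ((f x - g x) * sin (dotZ k x)) =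
    \int[mu]_x (f x * sin (dotZ k x)) - \int[mu]_x (g x * sin (dotZ k x)).
  under eq_Rintegral do rewrite mulrBl.
  by rewrite RintegralB//; exact: integrable_mul.
by congr Complex; ring.
Qed.

Lemma normc_energy_term m s (c : 'rV[int]_d -> 'I_m -> R[i]) k i :
  sobolev_weight s k * Normc.normc (c k i) ^+ 2 <=
  sobolev_weight s k * \sum_i Normc.normc (c k i) ^+ 2.
Proof.
apply: ler_wpM2l; first by rewrite ltW// sobolev_weight_gt0.
by rewrite (bigD1 i)//= lerDl; apply: sumr_ge0 => j _; exact: sqr_ge0.
Qed.

End sobolev_energy.

(** * Embedding of H^s in the continuous functions *)

Section sobolev_embedding.
Context {R : realType} {d m : nat} {s : R}.
Hypotheses (d_gt0 : (0 < d)%N) (s_gt : d%:R / 2 < s).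
Local Notation mu := (@torus_measure R d).

Lemma sobolev_class_integrable (u : sobolev d m s) i :
  mu.-integrable setT (EFin \o (sobolev_class u i : _ -> R)).
Proof.
set f := sobolev_class u i.
apply/Lfun1_integrable; apply: Lfun_subset12; first exact: fin_num_measure.
rewrite inE; apply/andP; split; rewrite inE /=.
  exact: (@measurable_funPT _ _ _ _ (repr (f : {mfun_ mu, _ >-> measurableTypeR R}))).
exact: Lebesgue_finite.
Qed.

Definition sobolev_coef (u : sobolev d m s) k i := fourier (sobolev_class u i) k.

Lemma fourier_vec_sobolev (u : sobolev d m s) k i : fourier_vec u k i 0 = sobolev_coef u k i.
Proof. by rewrite mxE; congr (fourier _ k); apply/funext => x; rewrite mxE. Qed.

Lemma fourier_vec_sobolevB (u : sobolev d m s) (g : 'rV[R]_d -> 'cV[R]_m) k i :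
  mu.-integrable setT (EFin \o (fun x => g x i 0)) ->
  fourier_vec (fun x => u x - g x) k i 0 = sobolev_coef u k i - fourier (fun x => g x i 0) k.
Proof.
move=> gi; rewrite mxE -(fourierB k (sobolev_class_integrable u i) gi).
by congr (fourier _ k); apply/funext => x; rewrite !mxE.
Qed.

Lemma sobolev_ball_energy (u v : sobolev d m s) e : ball u e v ->
  0 < e /\ forall N, sobolev_energy s N (fun k i => sobolev_coef u k i - sobolev_coef v k i) <= e ^+ 2.
Proof.
rewrite sobolev_ballE => uv; split.
  by rewrite -lte_fin; apply: le_lt_trans uv; exact: sqrte_ge0.
move=> N; apply: le_trans (sobolev_energy_le (ltW uv) N).
rewrite le_eqVlt; apply/orP; left; apply/eqP; congr (_ * _); apply: eq_bigr => k _.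
congr (_ * _); apply: eq_bigr => i _; congr (Normc.normc _ ^+ 2).
rewrite fourier_vec_sobolevB.
  by congr (_ - _); congr (fourier _ k); apply/funext => x; rewrite mxE.
rewrite (_ : (fun x => _) = sobolev_class v i); first exact: sobolev_class_integrable.
by apply/funext => x; rewrite mxE.
Qed.

Lemma sobolev_coef_energy_bounded (u : sobolev d m s) :
  exists B, forall N, sobolev_energy s N (sobolev_coef u) <= B.
Proof.
have [B HB] := sobolev_energy_bounded (sobolev_finite u); exists B => N.
apply: le_trans (HB N); rewrite le_eqVlt; apply/orP; left; apply/eqP.
congr (_ * _); apply: eq_bigr => k _; congr (_ * _); apply: eq_bigr => i _.
by congr (Normc.normc _ ^+ 2); exact/esym/fourier_vec_sobolev.
Qed.

(** The parameter [t] keeps Cauchy-Schwarz free of square roots: [t = 1] gives absolute convergence,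
    while [B = e ^+ 2] with [t = e] gives a bound linear in [e]. *)
Lemma sobolev_coef_sum_le : exists2 C, 0 <= C & forall (c : 'rV[int]_d -> 'I_m -> R[i]) B t i,
  0 < t -> (forall N, sobolev_energy s N c <= B) ->
  forall N, \sum_(k <- box_seq d N) Normc.normc (c k i) <= C * (t + B / t).
Proof.
have [C C0 HC] := sum_inv_sobolev_weight d_gt0 s_gt.
have V0 : 0 < (2 * pi) ^+ d / 2 :> R := torus_volume_gt0.
pose V : R := (2 * pi) ^+ d / 2.
exists (C + V^-1); first by rewrite addr_ge0// invr_ge0 ltW.
move=> c B t i t0 HB N.
have B0 : 0 <= B.
  apply: le_trans (HB 0%N); rewrite mulr_ge0 ?(ltW V0)//.
  by apply: sumr_ge0 => k _; exact: energy_term_ge0.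
have HcB : \sum_(k <- box_seq d N) sobolev_weight s k * Normc.normc (c k i) ^+ 2 <= B / V.
  rewrite ler_pdivlMr// mulrC; apply: le_trans (HB N); rewrite ler_pM2l//.
  by apply: ler_sum => k _; exact: normc_energy_term.
apply: le_trans (sum_weighted_le t0 (HC N) HcB) _.
have Vi : 0 <= V^-1 by rewrite invr_ge0 ltW.
have tV : 0 <= t * V^-1 by rewrite mulr_ge0// ltW.
have BtC : 0 <= B / t * C by rewrite mulr_ge0// divr_ge0// ltW.
have BtV : 0 <= B / t * V^-1 by rewrite mulr_ge0// divr_ge0// ltW.
have tC : 0 <= t * C by rewrite mulr_ge0// ltW.
rewrite (_ : B / V / t = B / t * V^-1); last by rewrite mulrAC.
by rewrite mulrDl !mulrDr; lra.
Qed.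

Theorem sobolev_continuous_repr (u : sobolev d m s) :
  [/\ continuous_torus (continuous_repr u),
    {ae mu, forall x, continuous_repr u x = u x} &
    forall i x, trig_sum N (fun k => sobolev_coef u k i) x @[N --> \oo] --> continuous_repr u x i 0].
Proof.
have [C C0 HC] := sobolev_coef_sum_le.
have [B HB] := sobolev_coef_energy_bounded u.
have /choice[V HV] : forall i, exists V : 'rV[R]_d -> R, [/\ continuous V, torus_periodic V,
    forall x, trig_sum N (fourier (sobolev_class u i)) x @[N --> \oo] --> V x &
    \forall x \ae mu, V x = sobolev_class u i x].
  move=> i; apply: (absolutely_summable_fourier (B := C * (1 + B / 1))).
    exact: sobolev_class_integrable.
  exact: (HC (sobolev_coef u) B 1 i ltr01 HB).
pose v (x : 'rV[R]_d) : 'cV[R]_m := \col_i V i x.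
have vP : continuous_torus v /\ {ae mu, forall x, v x = u x}.
  split; [split|].
  - by apply: continuous_col => i; have [] := HV i.
  - move=> x k; apply/colP => i; rewrite !mxE.
    by have [_ pV _ _] := HV i; exact: pV.
  have : \forall x \ae mu, forall i, V i x = sobolev_class u i x.
    by apply: filter_forall => i; have [] := HV i.
  by apply: filterS => x H; apply/colP => i; rewrite !mxE.
pose Q : set ('rV[R]_d -> 'cV[R]_m) :=
  [set v | @continuous_torus R d m v /\ {ae mu, forall x, v x = u x}].
(* The series [v] witnesses that the choice behind [continuous_repr] is not the default 0;
   uniqueness among continuous periodic functions then identifies the two. *)
have wP : Q (continuous_repr u) := @xgetI _ (fun=> 0) Q v vP.
have -> : continuous_repr u = v.
  move: wP; set w := continuous_repr u => -[[cw pw] aew].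
  have [[cv pv] aev] := vP.
  suff H i : (fun x => w x i 0) = (fun x => v x i 0).
    by apply/funext => x; apply/colP => i; exact: (congr1 (fun f => f x) (H i)).
  apply: continuous_periodic_ae_eq.
  - exact: continuous_entry.
  - by move=> x k; rewrite pw.
  - exact: continuous_entry.
  - by move=> x k; rewrite pv.
  by apply: filterS2 aew aev => x -> ->.
split; [exact: vP.1|exact: vP.2|].
by move=> i x; rewrite mxE; have [] := HV i.
Qed.

Theorem continuous_repr_lipschitz : exists2 C, 0 <= C & forall (u v : sobolev d m s) e x i,
  ball u e v -> `|continuous_repr u x i 0 - continuous_repr v x i 0| <= C * e.
Proof.
have [C C0 HC] := sobolev_coef_sum_le.
exists (C * 2); first by rewrite mulr_ge0.
move=> u v e x i /sobolev_ball_energy[e0 uv].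
have [_ _ cu] := sobolev_continuous_repr u; have [_ _ cv] := sobolev_continuous_repr v.
apply: (@norm_lim_le _ (fun N => trig_sum N (fun k => sobolev_coef u k i) x -
  trig_sum N (fun k => sobolev_coef v k i) x)); first by apply: cvgB; [exact: cu|exact: cv].
move=> N; rewrite !trig_sumE -raddfB -sumrB /=.
have -> : \sum_(k <- box_seq d N) (sobolev_coef u k i * expi (dotZ k x) -
     sobolev_coef v k i * expi (dotZ k x)) =
   \sum_(k <- box_seq d N) (sobolev_coef u k i - sobolev_coef v k i) * expi (dotZ k x).
  by apply: eq_bigr => k _; rewrite mulrBl.
rewrite -(trig_sumE N (fun k => sobolev_coef u k i - sobolev_coef v k i) x).
apply: le_trans (trig_sum_le _ _ _) _.
apply: le_trans (HC _ _ e i e0 uv N) _.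
by rewrite expr2 mulfK ?gt_eqF// -mulrA mulr_natl mulr2n.
Qed.

End sobolev_embedding.

(** * Continuity of the coefficients and uniformly small tails *)

Section sobolev_coefficients.
Context {R : realType} {d m : nat} {s : R}.
Local Notation mu := (@torus_measure R d).

Lemma ball_lipschitz_continuous (T : pseudoMetricType R) (f : T -> R) C :
  (forall u v e, ball u e v -> `|f u - f v| <= C * e) -> continuous f.
Proof.
move=> H u; apply/cvgrPdist_le => e e0.
have C1 : 0 < `|C| + 1 by rewrite ltr_wpDl.
have eC : 0 < e / (`|C| + 1) by rewrite divr_gt0.
have : \forall v \near u, ball u (e / (`|C| + 1)) v by exact: nbhsx_ballx.
apply: filterS => v /H; move=> /le_trans; apply.
apply: (@le_trans _ _ ((`|C| + 1) * (e / (`|C| + 1)))).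
  by rewrite ler_wpM2r ?(ltW eC)// (le_trans (ler_norm _))// lerDl.
by rewrite mulrC divfK// gt_eqF.
Qed.

Lemma continuous_repr_eval_continuous (x : 'rV[R]_d) i : (0 < d)%N -> d%:R / 2 < s ->
  continuous (fun u : sobolev d m s => continuous_repr u x i 0).
Proof.
move=> d0 ds; have [C C0 HC] := @continuous_repr_lipschitz R d m s d0 ds.
by apply: (@ball_lipschitz_continuous _ _ C) => u v e; exact: HC.
Qed.

Lemma sobolev_coef_lipschitz k i : exists C, forall (u v : sobolev d m s) e, ball u e v ->
  Normc.normc (sobolev_coef u k i - sobolev_coef v k i) <= C * e.
Proof.
have V0 : 0 < (2 * pi) ^+ d / 2 :> R := torus_volume_gt0.
set V : R := (2 * pi) ^+ d / 2 in V0.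
(* [1 + V^-1] dominates the square root of [V^-1], the constant that the energy bound yields. *)
exists (1 + V^-1) => u v e /sobolev_ball_energy[e0 uv].
have [N kN] := mem_box_seq_large k; have := uv N.
set c := (fun k i => _); set z := Normc.normc _ => E.
have : V * z ^+ 2 <= e ^+ 2.
  apply: le_trans E; rewrite /sobolev_energy ler_pM2l//.
  rewrite (perm_big _ (perm_to_rem kN)) big_cons.
  apply: (@le_trans _ _ (sobolev_weight s k * Normc.normc (c k i) ^+ 2)).
    by rewrite ler_peMl ?sqr_ge0// sobolev_weight_ge1.
  apply: le_trans (normc_energy_term s c k i) _; rewrite lerDl.
  by apply: sumr_ge0 => l _; exact: energy_term_ge0.
have z0 : 0 <= z by exact: normc_ge0.
rewrite -ler_pdivlMl// => zV; rewrite -(@ler_pXn2r _ 2) ?nnegrE//.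
  rewrite exprMn (le_trans zV)// ler_wpM2r ?sqr_ge0//.
  have Vi : 0 < V^-1 by rewrite invr_gt0.
  by rewrite expr2; nra.
by rewrite mulr_ge0 ?(ltW e0)// addr_ge0// invr_ge0 ltW.
Qed.

Lemma Re_Im_le_normc (z : R[i]) : `|complex.Re z| <= Normc.normc z /\ `|complex.Im z| <= Normc.normc z.
Proof.
case: z => a b; rewrite /Normc.normc/= -!(sqrtr_sqr _).
by split; rewrite ler_sqrt ?addr_ge0 ?sqr_ge0// ?lerDl ?lerDr sqr_ge0.
Qed.

Lemma sobolev_coef_continuous k i :
  continuous (fun u : sobolev d m s => complex.Re (sobolev_coef u k i) : R) /\
  continuous (fun u : sobolev d m s => complex.Im (sobolev_coef u k i) : R).
Proof.
have [C HC] := sobolev_coef_lipschitz k i.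
split; apply: (@ball_lipschitz_continuous _ _ C) => u v e /HC H; apply: le_trans H;
  rewrite -raddfB; [exact: (Re_Im_le_normc _).1|exact: (Re_Im_le_normc _).2].
Qed.

Lemma fourier_ae_eq (f g : 'rV[R]_d -> R) k : mu.-integrable setT (EFin \o f) ->
  mu.-integrable setT (EFin \o g) -> (\forall x \ae mu, f x = g x) -> fourier f k = fourier g k.
Proof.
move=> fi gi fg; rewrite (fourierE k fi) (fourierE k gi).
have key h : bounded_measurable h -> \int[mu]_x (f x * h x) = \int[mu]_x (g x * h x).
  move=> bh; rewrite /Rintegral; congr fine; apply: ae_eq_integral => //.
  - exact: (measurable_int _ (integrable_mul fi bh)).
  - exact: (measurable_int _ (integrable_mul gi bh)).
  by apply: filterS fg => x /= -> _.
by rewrite !key//; [exact: bounded_measurable_sin|exact: bounded_measurable_cos].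
Qed.

(** Equal representatives give equal Fourier coefficients, hence distance zero, expressed as
    membership in every ball. *)
Lemma continuous_repr_inj (u v : sobolev d m s) : (0 < d)%N -> d%:R / 2 < s ->
  (forall x, continuous_repr u x = continuous_repr v x) -> forall e, 0 < e -> ball u e v.
Proof.
move=> d0 ds uv e e0; rewrite sobolev_ballE.
have coefE k i : sobolev_coef u k i = sobolev_coef v k i.
  apply: fourier_ae_eq; [exact: sobolev_class_integrable|exact: sobolev_class_integrable|].
  have [_ au _] := sobolev_continuous_repr d0 ds u.
  have [_ av _] := sobolev_continuous_repr d0 ds v.
  apply: filterS2 au av => x; rewrite uv => -> /(congr1 (fun c : 'cV[R]_m => c i 0)).
  by rewrite !mxE.
apply: (@le_lt_trans _ _ 0%:E); last by rewrite lte_fin.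
apply: sobolev_norm_le => // N; rewrite expr0n/= /sobolev_energy big1 ?mulr0// => k _.
rewrite big1 ?mulr0// => i _; rewrite fourier_vec_sobolevB.
  rewrite (_ : (fun x => _) = sobolev_class v i); last by apply/funext => x; rewrite mxE.
  by rewrite coefE subrr Normc.normc0 expr0n.
rewrite (_ : (fun x => _) = sobolev_class v i); first exact: sobolev_class_integrable.
by apply/funext => x; rewrite mxE.
Qed.

Lemma normc_sqrD_le (z w : R[i]) :
  Normc.normc (z + w) ^+ 2 <= 2 * Normc.normc z ^+ 2 + 2 * Normc.normc w ^+ 2.
Proof.
have a0 := normc_ge0 z; have b0 := normc_ge0 w.
have : Normc.normc (z + w) ^+ 2 <= (Normc.normc z + Normc.normc w) ^+ 2.
  by rewrite lerXn2r ?nnegrE ?addr_ge0 ?normc_ge0//; exact: le_normcD.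
move/le_trans; apply; rewrite -subr_ge0.
have -> : 2 * Normc.normc z ^+ 2 + 2 * Normc.normc w ^+ 2 - (Normc.normc z + Normc.normc w) ^+ 2 =
  (Normc.normc z - Normc.normc w) ^+ 2 by ring.
exact: sqr_ge0.
Qed.

(** [M] is the cutoff; [N] truncates the sum to a finite one, so the full tail is controlled by a
    bound valid for all [N]. *)
Definition sobolev_tail M N (u : sobolev d m s) : R :=
  \sum_(k <- box_seq d N | k \notin box_seq d M)
    sobolev_weight s k * \sum_i Normc.normc (sobolev_coef u k i) ^+ 2.

Lemma sobolev_tail_small (u : sobolev d m s) e : 0 < e ->
  \forall M \near \oo, forall N, sobolev_tail M N u <= e.
Proof.
move=> e0; have V0 : 0 < (2 * pi) ^+ d / 2 :> R := torus_volume_gt0.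
pose T N := \sum_(k <- box_seq d N)
  sobolev_weight s k * \sum_i Normc.normc (sobolev_coef u k i) ^+ 2.
have t0 k := energy_term_ge0 s (sobolev_coef u) k.
have Tmono : nondecreasing_seq T.
  by move=> N M NM; rewrite /T (sum_box_le _ NM) lerDl sumr_ge0.
have Tcvg : cvgn T.
  have [B HB] := sobolev_coef_energy_bounded u.
  apply: nondecreasing_is_cvgn => //; exists (B / ((2 * pi) ^+ d / 2)) => _ [N _ <-].
  by rewrite ler_pdivlMr// mulrC; exact: HB.
have ev : \forall M \near \oo, `|limn T - T M| < e by apply: cvgr_dist_lt.
apply: filterS ev => M HM N.
have [MN|/ltnW NM] := leqP M N.
  have -> : sobolev_tail M N u = T N - T M by rewrite /T (sum_box_le _ MN) addrC addKr.
  apply: ltW; apply: le_lt_trans HM; rewrite (le_trans _ (ler_norm _))// lerD2r.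
  exact: nondecreasing_cvgn_le.
rewrite /sobolev_tail big_seq_cond big1 ?ltW// => k /andP[kN kM].
by rewrite (box_seq_le NM kN) in kM.
Qed.

Lemma sobolev_tail_ball M N (u v : sobolev d m s) e : ball u e v ->
  sobolev_tail M N v <= 2 * sobolev_tail M N u + 2 * (e ^+ 2 / ((2 * pi) ^+ d / 2)).
Proof.
move=> /sobolev_ball_energy[e0 uv].
have V0 : 0 < (2 * pi) ^+ d / 2 :> R := torus_volume_gt0.
pose c k i := sobolev_coef u k i - sobolev_coef v k i.
have t0 k := energy_term_ge0 s c k.
have pt k : sobolev_weight s k * (\sum_i Normc.normc (sobolev_coef v k i) ^+ 2) <=
    2 * (sobolev_weight s k * \sum_i Normc.normc (sobolev_coef u k i) ^+ 2) +
    2 * (sobolev_weight s k * \sum_i Normc.normc (c k i) ^+ 2).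
  have ptk i : Normc.normc (sobolev_coef v k i) ^+ 2 <=
      2 * Normc.normc (sobolev_coef u k i) ^+ 2 + 2 * Normc.normc (c k i) ^+ 2.
    have {1}-> : sobolev_coef v k i = sobolev_coef u k i + - c k i.
      by rewrite /c opprB addrC subrK.
    by apply: le_trans (normc_sqrD_le _ _) _; rewrite normcN.
  rewrite !(mulrCA 2) -mulrDr ler_wpM2l ?(ltW (sobolev_weight_gt0 _ _))//.
  by rewrite !mulr_sumr -big_split; apply: ler_sum => i _; exact: ptk.
apply: (@le_trans _ _ (2 * sobolev_tail M N u + 2 * \sum_(k <- box_seq d N)
   sobolev_weight s k * \sum_i Normc.normc (c k i) ^+ 2)).
  apply: (@le_trans _ _ (2 * sobolev_tail M N u + 2 *
      \sum_(k <- box_seq d N | k \notin box_seq d M)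
      sobolev_weight s k * \sum_i Normc.normc (c k i) ^+ 2)).
    rewrite /sobolev_tail !mulr_sumr -big_split; apply: ler_sum => k _.
    exact: pt.
  rewrite lerD2l ler_pM2l// [leRHS](bigID (fun k => k \in box_seq d M))/= lerDr.
  by apply: sumr_ge0.
rewrite lerD2l ler_pM2l// ler_pdivlMr// mulrC; exact: uv.
Qed.

(** Smallness of the tail at one [u] spreads to a ball around it by [sobolev_tail_ball], and
    compactness makes the cutoff uniform. *)
Lemma sobolev_tail_compact (K : set (sobolev d m s)) e : compact K -> 0 < e ->
  exists M, forall u, K u -> forall N, sobolev_tail M N u <= e.
Proof.
move=> /compact_near_coveringP cK e0.
have V0 : 0 < (2 * pi) ^+ d / 2 :> R := torus_volume_gt0.
set V : R := (2 * pi) ^+ d / 2 in V0.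
have e40 : 0 < e / 4 by rewrite divr_gt0.
have [|M _ /(_ M (leqnn M)) HM] := cK _ \oo
    (fun M u => forall N, sobolev_tail M N u <= e) _.
  (* Chosen so that [2 * (e / 4) + 2 * (dl ^+ 2 / V) <= e]; [dl <= 1] gives [dl ^+ 2 <= dl]. *)
  move=> u Ku; pose dl := Num.min 1 (e / 4 * V).
  have dl0 : 0 < dl by rewrite lt_min ltr01 mulr_gt0.
  have dl1 : dl <= 1 by rewrite ge_min lexx.
  have dlV : dl ^+ 2 / V <= e / 4.
    rewrite ler_pdivrMr//; apply: (@le_trans _ _ dl).
      by rewrite expr2 ler_piMr// ltW.
    by rewrite ge_min lexx orbT.
  exists (ball u dl, [set M | forall N, sobolev_tail M N u <= e / 4]).
    by split; [exact: nbhsx_ballx|exact: sobolev_tail_small].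
  move=> [v M] /= [uv uM] N; apply: le_trans (sobolev_tail_ball M N uv) _.
  by have := uM N; rewrite -/V; lra.
by exists M => u Ku; exact: HM.
Qed.

End sobolev_coefficients.

(** * Networks *)

Section network.
Context {R : realType} {d da du N : nat}.
Local Notation J := 'rV['I_(2 * N).+1]_d.
Variable sigma : R -> R.

(* One hidden unit: its weights in the output layer, the translates of the input
   components that it reads, and its bias on the grid. *)
Record neuron := Neuron {
  neuron_out : 'I_du -> R ;
  neuron_taps : seq (R * 'rV[R]_d * 'I_da) ;
  neuron_bias : J -> R }.

Definition neuron_input (w : seq (R * 'rV[R]_d * 'I_da)) (a : 'rV[R]_d -> 'cV[R]_da) (j : J) : R :=
  \sum_(p <- w) p.1.1 * interp1 N (fun y => a y p.2 0) (grid j + p.1.2).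

Definition neurons_eval (s : seq neuron) (a : 'rV[R]_d -> 'cV[R]_da) (j : J) (u : 'I_du) : R :=
  \sum_(n <- s) neuron_out n u * sigma (neuron_input (neuron_taps n) a j + neuron_bias n j).

Lemma trig_poly_lin (I : Type) (r : seq I) (a : I -> R) (p : I -> 'rV[R]_d -> R) :
  (forall i, trig_poly N (p i)) -> trig_poly N (fun x => \sum_(i <- r) a i * p i x).
Proof.
move=> /choice[c pE]; exists (fun k => \sum_(i <- r) (a i)%:C%C * c i k) => x.
rewrite rmorph_sum/= box_sumE.
transitivity (\sum_(k <- box_seq d N) \sum_(i <- r) (a i)%:C%C * c i k * expi (dotZ k x)).
  rewrite exchange_big/=; apply: eq_bigr => i _.
  by rewrite rmorphM/= pE box_sumE mulr_sumr; apply: eq_bigr => k _; rewrite mulrA.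
by apply: eq_bigr => k _; rewrite mulr_suml.
Qed.

Lemma sum_nth_default (T : Type) (x0 : T) (s : seq T) k (f : T -> R) : f x0 = 0 ->
  \sum_(i < size s + k) f (nth x0 s i) = \sum_(x <- s) f x.
Proof.
move=> f0; rewrite big_split_ord/= [X in _ + X]big1 ?addr0 => [|i _]; last first.
  by rewrite nth_default ?leq_addr.
by rewrite (big_nth x0) big_mkord.
Qed.

(** A single layer with [layer_W = 0]: [fno_R] copies the input components into the first [da]
    channels, unit [i] is channel [i] of the layer output, and [fno_Q] sums the units. Its node
    values determine the output, since the last interpolation discards everything else. *)
Theorem neurons_psi_fno (s : seq neuron) : exists net : psi_fno R d da du N,
  forall a, (forall u, trig_poly N (fun x => fno_eval sigma net a x u 0)) /\
    forall j u, fno_eval sigma net a (grid j) u 0 = neurons_eval s a j u.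
Proof.
pose n0 := Neuron (fun=> 0) [::] (fun=> 0).
(* Wide enough for the units, the [da] input channels and the bound [du <= dv]; surplus units are
   the default [n0], whose output weights are zero. *)
pose dv := (size s + (da + du))%N.
have da_dv : (da <= dv)%N by rewrite /dv; lia.
have du_dv : (du <= dv)%N by rewrite /dv; lia.
pose nn (i : 'I_dv) := nth n0 s i.
(* The biases are prescribed at the nodes; trigonometric interpolation extends them to continuous
   periodic functions. *)
have /choice[B HB] : forall i : 'I_dv, exists B : 'rV[R]_d -> R,
    trig_poly N B /\ forall j, B (grid j) = neuron_bias (nn i) j.
  by move=> i; have [B B1 B2] := trig_poly_interpolation (neuron_bias (nn i)); exists B.
pose b (x : 'rV[R]_d) : 'cV[R]_dv := \col_i B i x.
have cb : continuous_torus b.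
  split.
    by apply: continuous_col => i; have [/trig_poly_continuous_periodic[]] := HB i.
  move=> x k; apply/colP => i; rewrite !mxE.
  by have [/trig_poly_continuous_periodic[_ pB] _] := HB i; exact: pB.
(* Multiplying mode [k] by [expi (dotZ k tau)] translates a trigonometric polynomial by [tau];
   column [c] collects the taps that read component [c]. *)
pose P (k : 'rV[int]_d) : 'M[R[i]]_dv := \matrix_(i, c)
  \sum_(p <- neuron_taps (nn i))
    (if nat_of_ord p.2 == c then (p.1.1)%:C%C * expi (dotZ k p.1.2) else 0).
have hP k : box N k -> P (- k) = map_mx conjc (P k).
  move=> _; apply/matrixP => i c; rewrite !mxE (rmorph_sum (@conjc R)).
  apply: eq_bigr => p _; case: ifP => _; last by rewrite (rmorph0 (@conjc R)).
  by rewrite [RHS]conjcM conjc_real dotZN expiN.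
pose l : fno_layer R d dv N := FnoLayer 0 cb hP.
pose net : psi_fno R d da du N := @PsiFno R d da du N dv du_dv
  (\matrix_(i, c) (nat_of_ord i == nat_of_ord c)%:R) [:: l] isT (\matrix_(u, i) neuron_out (nn i) u).
exists net => a.
have evalE x u : fno_eval sigma net a x u 0 = \sum_(i < dv) neuron_out (nn i) u *
    interp1 N (fun y => layer_eval sigma l (interp N (fun y => fno_R net *m a y)) y i 0) x.
  by rewrite /fno_eval/= mxE; apply: eq_bigr => i _; rewrite !mxE.
split=> [u|j u].
  rewrite (_ : (fun x => _) = fun x => \sum_(i < dv) neuron_out (nn i) u *
      interp1 N (fun y => layer_eval sigma l (interp N (fun y => fno_R net *m a y)) y i 0) x).
    by apply: trig_poly_lin => i; exact: (interp1P N _).1.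
  by apply/funext => x; exact: evalE.
rewrite evalE.
rewrite /neurons_eval -(@sum_nth_default _ n0 s (da + du) (fun n => neuron_out n u *
  sigma (neuron_input (neuron_taps n) a j + neuron_bias n j))) ?mul0r//.
apply: eq_bigr => i _; congr (_ * _); rewrite (interp1P N _).2.
set V := interp N _.
have bj : layer_b l (grid j) i 0 = neuron_bias (nn i) j by rewrite mxE (HB i).2.
rewrite /layer_eval mxE; congr sigma; rewrite mxE addrC; congr (_ + _); last first.
  by rewrite mxE mul0mx mxE add0r bj.
rewrite mxE.
have fV k (c : 'I_da) : fourier_vec V k (widen_ord da_dv c) 0 = fourier (interp1 N (fun y => a y c 0)) k.
  rewrite mxE; congr (fourier _ k); apply/funext => x; rewrite /V mxE.
  congr (interp1 N _ x); apply/funext => y; rewrite mxE (bigD1 c)//= big1 ?addr0.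
    by rewrite mxE eqxx mul1r.
  move=> c' cc'; rewrite mxE (_ : (_ == _) = false) ?mul0r//.
  by apply/negbTE; rewrite eq_sym; exact: cc'.
have PV k : (P k *m fourier_vec V k) i 0 = \sum_(p <- neuron_taps (nn i))
    (p.1.1)%:C%C * expi (dotZ k p.1.2) * fourier (interp1 N (fun y => a y p.2 0)) k.
  rewrite mxE; under eq_bigr do rewrite mxE mulr_suml; rewrite exchange_big/=.
  apply: eq_bigr => p _; rewrite (bigD1 (widen_ord da_dv p.2))//= eqxx fV big1 ?addr0//.
  move=> c; rewrite -val_eqE/= eq_sym => /negbTE ->; rewrite mul0r//.
rewrite box_sumE summxE.
transitivity (complex.Re (\sum_(k <- box_seq d N) \sum_(p <- neuron_taps (nn i))
   (p.1.1)%:C%C * (fourier (interp1 N (fun y => a y p.2 0)) k * expi (dotZ k (grid j + p.1.2))))).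
  congr complex.Re; apply: eq_bigr => k _; rewrite mxE PV mulr_sumr; apply: eq_bigr => p _.
  have -> : dotZ k (grid j + p.1.2) = dotZ k (grid j) + dotZ k p.1.2.
    by rewrite /dotZ -big_split; apply: eq_bigr => i' _; rewrite mxE mulrDr.
  by rewrite expiD; ring.
rewrite exchange_big/= /neuron_input raddf_sum; apply: eq_bigr => p _.
rewrite -mulr_sumr -(trig_poly_fourier (interp1P N (fun y => a y p.2 0)).1).1.
by rewrite /= mul0r subr0.
Qed.

End network.

(** * Nested grids with dense union *)

Section grid_density.
Context {R : realType} {d : nat}.

(** Solves [2 * triadic n + 1 = 3 ^ (n + 1)]. The number of nodes per direction is always odd, so
    tripling it is the least refinement that contains the old grid. *)
Fixpoint triadic n : nat := if n is m.+1 then (3 * triadic m).+1 else 1%N.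

Definition on_grid n (x : 'rV[R]_d) := exists j, x = @grid R d (triadic n) j.

Lemma on_gridS n x : on_grid n x -> on_grid n.+1 x.
Proof.
move=> [j ->]; exists (\row_i inord (3 * j 0 i)).
have e : (2 * triadic n.+1).+1 = (3 * (2 * triadic n).+1)%N by rewrite /=; lia.
apply/rowP => i; rewrite !mxE inordK; last by rewrite e ltn_pmul2l.
rewrite e !natrM; have : (2 * triadic n).+1%:R != 0 :> R by rewrite pnatr_eq0.
by move: ((2 * triadic n).+1%:R : R) => g g0; field.
Qed.

Lemma on_grid_le n m x : (n <= m)%N -> on_grid n x -> on_grid m x.
Proof.
move=> nm xn; rewrite -(subnK nm); elim: (m - n)%N => [//|k IH]; exact: on_gridS.
Qed.

Lemma triadic_gt n : (n < triadic n)%N.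
Proof. by elim: n => [//|n IH] /=; lia. Qed.

Lemma torus_representative (x : 'rV[R]_d) : exists k : 'rV[int]_d,
  forall i, 0 <= (x + \row_i (2 * pi * (k 0 i)%:~R)) 0 i < 2 * pi.
Proof.
exists (\row_i - Num.floor (x 0 i / (2 * pi))) => i.
have p2 : 0 < 2 * pi :> R by rewrite mulr_gt0// pi_gt0.
rewrite !mxE mulrNz; have := floor_itv (x 0 i / (2 * pi)).
rewrite intrD => /andP[]; rewrite ler_pdivlMr// ltr_pdivrMr// mulrDl => h1 h2.
by apply/andP; split; lra.
Qed.

Lemma grid_dense (v w : 'rV[R]_d -> R) : continuous v -> torus_periodic v ->
  continuous w -> torus_periodic w -> (forall n x, on_grid n x -> v x = w x) -> v = w.
Proof.
move=> cv pv cw pw vw; apply/funext => x0; apply: contrapT => nvw.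
have [k] := torus_representative x0; set y0 := x0 + _ => y0i.
have p2 : 0 < 2 * pi :> R by rewrite mulr_gt0// pi_gt0.
have ny : v y0 != w y0 by rewrite /y0 pv pw; exact/eqP.
have /nbhs_ballP[e /= e0 He] := continuous_near_neq cv cw ny.
have [n _ /(_ n (leqnn n))/= Hn] := near_infty_natSinv_lt (PosNum (divr_gt0 e0 p2)).
pose q := (2 * triadic n).+1.
have q0 : 0 < q%:R :> R by rewrite ltr0n.
have qn : (q%:R)^-1 * (2 * pi) < e :> R.
  rewrite -ltr_pdivlMr//; apply: le_lt_trans Hn.
  rewrite lef_pV2 ?posrE ?ltr0n// ler_nat /q; have := triadic_gt n; lia.
(* The coordinate measured in grid steps; rounding it down moves the point by at most one step,
   which is less than [e]. *)
pose t i := y0 0 i * q%:R / (2 * pi).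
have t0 i : 0 <= t i by rewrite divr_ge0 ?(ltW p2)// mulr_ge0//; have /andP[] := y0i i.
pose f i := absz (Num.floor (t i)).
have fE i : (f i)%:R = (Num.floor (t i))%:~R :> R.
  by rewrite /f -[in RHS](gez0_abs (_ : 0 <= Num.floor (t i)))// floor_ge0.
have fle i : (f i)%:R <= t i < (f i)%:R + 1.
  by rewrite fE; have := floor_itv (t i); rewrite intrD.
have fq i : (f i < q)%N.
  have /andP[f1 _] := fle i; rewrite -(ltr_nat R); apply: le_lt_trans f1 _.
  by rewrite /t ltr_pdivrMr// mulrC ltr_pM2l//; have /andP[] := y0i i.
pose y := @grid R d (triadic n) (\row_i inord (f i)).
have : v y != w y; last by rewrite (vw n) ?eqxx//; exists (\row_i inord (f i)).
apply: He; split=> // i j; rewrite (ord1 i) /ball/=.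
have -> : y 0 j = (f j)%:R * (2 * pi) / q%:R by rewrite !mxE inordK// [2 * pi * _]mulrC.
have -> : y0 0 j = t j * (2 * pi) / q%:R.
  by rewrite /t divfK ?gt_eqF// mulfK// gt_eqF.
have /andP[f1 f2] := fle j.
rewrite -!mulrBl normrM normrM normfV (gtr0_norm p2) (gtr0_norm q0).
apply: le_lt_trans qn; rewrite mulrC ler_wpM2l ?invr_ge0 ?(ltW q0)//.
rewrite ger0_norm ?subr_ge0// -[leRHS]mul1r ler_wpM2r ?(ltW p2)//; lra.
Qed.

End grid_density.

(** * The algebra of exponentials of point values *)

Section exponential_sums.
Context {R : realType} {d da : nat} {s : R}.
Hypotheses (d_gt0 : (0 < d)%N) (s_gt : d%:R / 2 < s).
Local Notation T := (sobolev d da s).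
Local Notation taps := (seq (R * 'rV[R]_d * 'I_da)).

Definition point_sum (w : taps) (a : T) : R :=
  \sum_(p <- w) p.1.1 * continuous_repr a p.1.2 p.2 0.

Definition exp_sum (r : seq (R * taps)) (a : T) : R :=
  \sum_(p <- r) p.1 * expR (point_sum p.2 a).

Definition taps_on_grid n (w : taps) := forall p, List.In p w -> on_grid n p.1.2.

Definition exp_sum_on_grid n (r : seq (R * taps)) := forall p, List.In p r -> taps_on_grid n p.2.

Lemma point_sum_continuous w : continuous (point_sum w).
Proof.
apply: (@continuous_sum _ _ _ _ (fun p (a : T) => p.1.1 * continuous_repr a p.1.2 p.2 0)) => p.
apply: continuous_scale; exact: continuous_repr_eval_continuous.
Qed.

Lemma exp_sum_continuous r : continuous (exp_sum r).
Proof.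
apply: (@continuous_sum _ _ _ _ (fun p (a : T) => p.1 * expR (point_sum p.2 a))) => p.
apply: continuous_scale => a.
by apply: continuous_comp; [exact: point_sum_continuous|exact: continuous_expR].
Qed.

Lemma exp_sum_on_grid_le n m r : (n <= m)%N -> exp_sum_on_grid n r -> exp_sum_on_grid m r.
Proof. by move=> nm H p pr q /(H p pr); exact: on_grid_le. Qed.

Definition exp_sums : set (T -> R) :=
  [set f | exists n r, exp_sum_on_grid n r /\ f = exp_sum r].

Lemma exp_sum_approx (K : set T) (g : T -> R) : compact K -> continuous g ->
  forall e, 0 < e -> exists n r, exp_sum_on_grid n r /\
    forall a, K a -> `|g a - exp_sum r a| <= e.
Proof.
move=> cK cg e e0.
have [|||||_ [n [r [nr ->]]] H] := @stone_weierstrass R T K exp_sums cK _ _ _ _ g cg _ e e0.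
- by move=> _ [n [r [_ ->]]]; exact: exp_sum_continuous.
- move=> c; exists 0%N, [:: (c, [::])]; split.
    by move=> p /= [<-|//] q.
  by apply/funext => a; rewrite /exp_sum big_seq1 /point_sum big_nil expR0 mulr1.
- move=> _ _ [n [r [nr ->]]] [m [t [mt ->]]]; exists (maxn n m), (r ++ t); split.
    move=> p /List.in_app_iff[pr|pt].
      exact: (exp_sum_on_grid_le (leq_maxl n m) nr).
    exact: (exp_sum_on_grid_le (leq_maxr n m) mt).
  by apply/funext => a; rewrite /exp_sum big_cat.
- move=> _ _ [n [r [nr ->]]] [m [t [mt ->]]].
  exists (maxn n m), (flatten [seq [seq (p.1 * q.1, p.2 ++ q.2) | q <- t] | p <- r]); split.
    move=> p /List.in_concat[l []]; rewrite -/(@map _ _) => /List.in_map_iff[p' [<- pr]].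
    move=> /List.in_map_iff[q [<- qt]] x /= /List.in_app_iff[xp|xq].
      exact: (exp_sum_on_grid_le (leq_maxl n m) nr pr xp).
    exact: (exp_sum_on_grid_le (leq_maxr n m) mt qt xq).
  apply/funext => a; rewrite /exp_sum big_flatten/= big_map mulr_suml; apply: eq_bigr => p _.
  rewrite big_map mulr_sumr; apply: eq_bigr => q _ /=.
  by rewrite /point_sum big_cat expRD; ring.
- move=> p q Kp Kq.
  (* If the representatives agree on all grids, they agree everywhere by density, the two points are
     at distance zero and [g] agrees on them. Otherwise the exponential of a single point value
     separates them. *)
  have [H|H] := pselect (forall n x i, @on_grid R d n x ->
      continuous_repr p x i 0 = continuous_repr q x i 0).
    right; apply/eqP; rewrite -subr_eq0 -normr_le0; apply/ler_addgt0Pl => e' e'0.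
    rewrite addr0.
    have pq x : continuous_repr p x = continuous_repr q x.
      apply/colP => i.
      have [[cp pp] _ _] := sobolev_continuous_repr d_gt0 s_gt p.
      have [[cq pq] _ _] := sobolev_continuous_repr d_gt0 s_gt q.
      suff E : (fun x => continuous_repr p x i 0) = (fun x => continuous_repr q x i 0).
        exact: (congr1 (fun f => f x) E).
      apply: grid_dense.
      + exact: (@continuous_entry R _ _ (continuous_repr p) i cp).
      + by move=> y k; rewrite pp.
      + exact: (@continuous_entry R _ _ (continuous_repr q) i cq).
      + by move=> y k; rewrite pq.
      by move=> n y ny; exact: (H n).
    have /nbhs_ballP[dl /= dl0 Hdl] : \forall a \near p, `|g p - g a| <= e'.
      by have := cg p => /cvgrPdist_le; exact.
    exact: Hdl (continuous_repr_inj d_gt0 s_gt pq dl0).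
  left; have {H}[n [x [i [nx /eqP neq]]]] : exists n x i, @on_grid R d n x /\
      continuous_repr p x i 0 <> continuous_repr q x i 0.
    apply: contrapT => H'; apply: H => n x i nx; apply: contrapT => neq.
    by apply: H'; exists n, x, i.
  exists (exp_sum [:: (1, [:: (1, x, i)])]).
    exists n, [:: (1, [:: (1, x, i)])]; split=> //.
    by move=> _ /= [<-|//] _ /= [<-|//].
  rewrite /exp_sum !big_seq1 !mul1r /point_sum !big_seq1 !mul1r.
  by apply: contra_neq neq => /expR_inj.
by exists n, r.
Qed.

End exponential_sums.

(** * Realization of exponential sums by hidden units *)

Section realization.
Context {R : realType} {d da du : nat} {s : R}.
Hypotheses (d_gt0 : (0 < d)%N) (s_gt : d%:R / 2 < s).
Variable sigma : R -> R.
Hypothesis sigma_lip : lipschitz_fun sigma.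
Hypothesis sigma_nonaffine : ~ exists c0 c1, forall x, sigma x = c0 + c1 * x.
Variable K : set (sobolev d da s).
Hypothesis K_compact : compact K.
Variable n : nat.
Local Notation T := (sobolev d da s).
Local Notation J := 'rV['I_(2 * triadic n).+1]_d.
Local Notation neuron := (@neuron R d da du (triadic n)).

Definition realizable (F : T -> J -> 'I_du -> R) := forall e, 0 < e ->
  exists l : seq neuron, forall a, K a -> forall j u,
    `|F a j u - neurons_eval sigma l (continuous_repr a) j u| <= e.

Lemma realizable0 : realizable (fun _ _ _ => 0).
Proof.
by move=> e e0; exists [::] => a _ j u; rewrite /neurons_eval big_nil subrr normr0 ltW.
Qed.

Lemma realizableD F F' : realizable F -> realizable F' ->
  realizable (fun a j u => F a j u + F' a j u).
Proof.
move=> hF hF' e e0; have e2 : 0 < e / 2 by rewrite divr_gt0.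
have [l Hl] := hF _ e2; have [l' Hl'] := hF' _ e2; exists (l ++ l') => a Ka j u.
rewrite /neurons_eval big_cat opprD addrACA [leRHS]splitr.
by apply: le_trans (ler_normD _ _) _; apply: lerD; [exact: Hl|exact: Hl'].
Qed.

Lemma realizableZ c F : realizable F -> realizable (fun a j u => c * F a j u).
Proof.
move=> hF e e0; have c0 : 0 < `|c| + 1 by rewrite ltr_wpDl.
have [l Hl] := hF _ (divr_gt0 e0 c0).
exists [seq Neuron (fun u => c * neuron_out p u) (neuron_taps p) (neuron_bias p) | p <- l] => a Ka j u.
rewrite /neurons_eval big_map/=.
under eq_bigr do rewrite -mulrA.
rewrite -mulr_sumr -mulrBr normrM.
apply: le_trans (ler_wpM2l (normr_ge0 c) (Hl a Ka j u)) _.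
by rewrite mulrA ler_pdivrMr// mulrC ler_wpM2l ?(ltW e0)// lerDl.
Qed.

Lemma realizable_sum (I : eqType) (r : seq I) F : (forall i, i \in r -> realizable (F i)) ->
  realizable (fun a j u => \sum_(i <- r) F i a j u).
Proof.
elim: r => [_|i r IH H].
  rewrite (_ : (fun _ _ _ => _) = fun _ _ _ => 0); first exact: realizable0.
  by apply/funext => a; apply/funext => j; apply/funext => u; rewrite big_nil.
rewrite (_ : (fun _ _ _ => _) = fun a j u => F i a j u + \sum_(i <- r) F i a j u).
  apply: realizableD; first by apply: H; rewrite mem_head.
  by apply: IH => i' ir; apply: H; rewrite in_cons ir orbT.
by apply/funext => a; apply/funext => j; apply/funext => u; rewrite big_cons.
Qed.

(* Raising the bias by ln 2 at the node j0 only, and subtracting the same units without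
   this change, isolates e^(t + ln 2) - e^t = e^t at j0 and cancels at every other node,
   where the input is a value of the interpolant that is not controlled. *)
Lemma realizable_node j0 u0 w : taps_on_grid n w ->
  realizable (fun a j u => (j == j0)%:R * (u == u0)%:R * expR (point_sum w a)).
Proof.
move=> wn e e0.
have [A0 A00 HA0] := compact_fun_bounded K_compact (@point_sum_continuous _ _ _ _ d_gt0 s_gt w).
have l2 : 0 < ln 2 :> R by rewrite ln_gt0// ltr1n.
have e2 : 0 < e / 2 by rewrite divr_gt0.
(* The range covers both [t] and [t + ln 2] for [|t| <= A0]; each of the two evaluations gets half
   of [e]. *)
have [r Hr] := ridge_limit_expR sigma_lip sigma_nonaffine (addr_gt0 A00 l2) e2.
(* The translation by [- grid j0] makes node [j0] read the points of [w]. Scaling taps and bias by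
   the slope [p.1.2] makes the units compute the ridge sum at [z a j + b j]. *)
pose node (c : R) (b : J -> R) (p : R * R * R) : neuron :=
  Neuron (fun u => c * p.1.1 * (u == u0)%:R)
    [seq (p.1.2 * q.1.1, q.1.2 - grid j0, q.2) | q <- w] (fun j => p.1.2 * b j + p.2).
pose z (a : T) (j : J) := \sum_(q <- w)
  q.1.1 * interp1 (triadic n) (fun y => continuous_repr a y q.2 0) (grid j + (q.1.2 - grid j0)).
have nodeE c b a j u : neurons_eval sigma [seq node c b p | p <- r] (continuous_repr a) j u =
    c * (u == u0)%:R * ridge_sum sigma r (z a j + b j).
  rewrite /neurons_eval /ridge_sum big_map mulr_sumr; apply: eq_bigr => p _.
  have -> : neuron_input (neuron_taps (node c b p)) (continuous_repr a) j = p.1.2 * z a j.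
    rewrite /neuron_input big_map /z mulr_sumr; apply: eq_bigr => q _.
    by rewrite mulrA.
  rewrite /= addrA -mulrDr; ring.
pose bump j := ln 2 * (j == j0)%:R : R.
exists ([seq node 1 bump p | p <- r] ++ [seq node (-1) (fun=> 0) p | p <- r]) => a Ka j u.
have -> l l' : neurons_eval sigma (l ++ l') (continuous_repr a) j u =
    neurons_eval sigma l (continuous_repr a) j u + neurons_eval sigma l' (continuous_repr a) j u.
  by rewrite /neurons_eval big_cat.
rewrite !nodeE /bump addr0; have [jj0|_] := eqVneq j j0; last first.
  by rewrite mul0r mul0r mulr0 addr0 mulN1r mulNr mul1r subrr subr0 normr0 ltW.
have -> : z a j = point_sum w a.
  rewrite /z /point_sum jj0; elim: w wn {HA0 node z nodeE} => [|q w IH] wn; first by rewrite !big_nil.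
  rewrite !big_cons IH; last by move=> p pw; apply: wn; right.
  congr (_ * _ + _); rewrite addrC subrK.
  by have [i ->] := wn q (or_introl erefl); rewrite (interp1P _ _).2.
have := HA0 a Ka; set t := point_sum w a => tA.
rewrite mulr1 !mul1r; case: (u == u0); last first.
  by rewrite mulr0 !mul0r addr0 subr0 normr0 ltW.
rewrite mulr1 !mul1r mulN1r.
have h1 : `|t + ln 2| <= A0 + ln 2.
  by apply: le_trans (ler_normD _ _) _; rewrite (gtr0_norm l2) lerD2r.
have h2 : `|t| <= A0 + ln 2 by apply: le_trans tA _; rewrite lerDl ltW.
have -> : expR t = expR (t + ln 2) - expR t by rewrite expRD lnK ?posrE//; ring.
move: (Hr _ h1) (Hr _ h2).
rewrite !ler_norml => /andP[? ?] /andP[? ?]; apply/andP; split; lra.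
Qed.

Lemma realizable_exp_sum j0 u0 r : exp_sum_on_grid n r ->
  realizable (fun a j u => (j == j0)%:R * (u == u0)%:R * exp_sum r a).
Proof.
elim: r => [_|p r IH rn].
  rewrite (_ : (fun _ _ _ => _) = fun _ _ _ => 0); first exact: realizable0.
  by apply/funext => a; apply/funext => j; apply/funext => u; rewrite /exp_sum big_nil mulr0.
rewrite (_ : (fun _ _ _ => _) = fun a j u =>
    p.1 * ((j == j0)%:R * (u == u0)%:R * expR (point_sum p.2 a)) +
    (j == j0)%:R * (u == u0)%:R * exp_sum r a).
  apply: realizableD; last by apply: IH => q qr; apply: rn; right.
  by apply/realizableZ/realizable_node/rn; left.
apply/funext => a; apply/funext => j; apply/funext => u.
by rewrite /exp_sum big_cons mulrDr mulrCA.
Qed.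

(** At a fixed node the target combines the exponential sums with constant coefficients [cos] and
    [- sin], so it can be assembled node by node and output by output. *)
Lemma realizable_trig_sum M (fr fi : 'rV[int]_d -> 'I_du -> seq (R * seq (R * 'rV[R]_d * 'I_da))) :
  (forall k u, k \in box_seq d M -> exp_sum_on_grid n (fr k u) /\ exp_sum_on_grid n (fi k u)) ->
  realizable (fun a j u =>
    trig_sum M (fun k => Complex (exp_sum (fr k u) a) (exp_sum (fi k u) a)) (grid j)).
Proof.
move=> H.
rewrite (_ : (fun _ _ _ => _) = fun a j u =>
    \sum_j0 \sum_u0 \sum_(k <- box_seq d M)
      (cos (dotZ k (grid j0)) * ((j == j0)%:R * (u == u0)%:R * exp_sum (fr k u0) a) +
       (- sin (dotZ k (grid j0))) * ((j == j0)%:R * (u == u0)%:R * exp_sum (fi k u0) a))).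
  apply: realizable_sum => j0 _; apply: realizable_sum => u0 _; apply: realizable_sum => k kM.
  have [h1 h2] := H k u0 kM.
  by apply: realizableD; apply: realizableZ; exact: realizable_exp_sum.
apply/funext => a; apply/funext => j; apply/funext => u.
rewrite (bigD1 j)//= [X in _ = _ + X]big1 => [|j0 jj0]; last first.
  rewrite big1// => u0 _; rewrite big1// => k _.
  by rewrite eq_sym (negbTE jj0) !mul0r !mulr0 addr0.
rewrite addr0 (bigD1 u)//= [X in _ = _ + X]big1 => [|u0 uu0]; last first.
  rewrite big1// => k _.
  by rewrite (eq_sym u) (negbTE uu0) !mulr0 !mul0r !mulr0 addr0.
rewrite addr0; apply: eq_bigr => k _ /=.
by rewrite !eqxx !mul1r; ring.
Qed.

End realization.

(** * Error estimate and choice of the parameters *)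

Section approximation.
Context {R : realType} {d da du : nat} {s' : R}.

Lemma trig_poly_le M N (p : 'rV[R]_d -> R) : (M <= N)%N -> trig_poly M p -> trig_poly N p.
Proof.
move=> MN hp; exists (fourier p) => x; rewrite box_sumE (trig_poly_fourier hp).1 (sum_box_le _ MN).
rewrite [X in _ = _ + X]big1 ?addr0// => k kM.
by rewrite (trig_poly_fourier hp).2// mul0r.
Qed.

Lemma trig_polyB N (p q : 'rV[R]_d -> R) : trig_poly N p -> trig_poly N q ->
  trig_poly N (fun x => p x - q x).
Proof.
move=> hp hq; have := @trig_poly_lin R d N bool [:: true; false]
  (fun b => if b then 1 else -1) (fun b => if b then p else q).
rewrite (_ : (fun x => \sum_(_ <- _) _) = fun x => p x - q x).
  by apply; case.
by apply/funext => x; rewrite !big_cons big_nil addr0 mul1r mulN1r.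
Qed.

Lemma trig_poly_fourierB N (p q : 'rV[R]_d -> R) k : trig_poly N p -> trig_poly N q ->
  fourier (fun x => p x - q x) k = fourier p k - fourier q k.
Proof.
by move=> /bounded_measurable_trig_poly/bounded_measurable_integrable hp
  /bounded_measurable_trig_poly/bounded_measurable_integrable hq; exact: fourierB.
Qed.

Lemma normc_conjc (z : R[i]) : Normc.normc (conjc z) = Normc.normc z.
Proof. by case: z => x y /=; rewrite sqrrN. Qed.

Lemma normc_le_ReIm (z : R[i]) e : `|complex.Re z| <= e / 2 -> `|complex.Im z| <= e / 2 ->
  Normc.normc z <= e.
Proof.
case: z => x y; cbn [complex.Re complex.Im] => xe ye.
have e0 : 0 <= e by have := le_trans (normr_ge0 x) xe; lra.
rewrite -[e]ger0_norm// -sqrtr_sqr ler_wsqrtr// -(real_normK (num_real x)) -(real_normK (num_real y)).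
have x0 := normr_ge0 x; have y0 := normr_ge0 y; nra.
Qed.

(** [trig_sum] symmetrizes [c], and the coefficients of the real function [f] are already symmetric,
    so the new error at [k] averages the old one with the conjugate of that at [- k]. *)
Lemma fourier_trig_sum_near M (c : 'rV[int]_d -> R[i]) (f : 'rV[R]_d -> R) dl :
  (torus_measure d).-integrable setT (EFin \o f) ->
  (forall k, k \in box_seq d M -> Normc.normc (fourier f k - c k) <= dl) ->
  forall k, k \in box_seq d M -> Normc.normc (fourier f k - fourier (trig_sum M c) k) <= dl.
Proof.
move=> fi H k kM; rewrite fourier_trig_sum kM.
have kNM : - k \in box_seq d M by rewrite box_seqN.
have -> : fourier f k - hermitian_part c k =
    ((fourier f k - c k) + conjc (fourier f (- k) - c (- k))) * (2^-1)%:C%C.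
  have -> : (2^-1)%:C%C = 2^-1 :> R[i] by rewrite (fmorphV (real_complex R)) rmorph_nat.
  have -> : conjc (fourier f (- k) - c (- k)) = fourier f k - conjc (c (- k)).
    rewrite fourier_herm//; move: (fourier f k) (c (- k)) => [x y] [x' y'].
    by apply/eqP; rewrite eq_complex/= opprD !opprK !eqxx.
  by rewrite /hermitian_part; field.
rewrite Normc.normcM normc_realC gtr0_norm ?invr_gt0// ler_pdivrMr//.
apply: le_trans (le_normcD _ _) _; rewrite normc_conjc mulr_natr mulr2n.
by apply: lerD; exact: H.
Qed.

Lemma sum_weight_le (m : nat) N (c : 'rV[int]_d -> 'I_m -> R[i]) dl : 0 <= dl ->
  (forall k u, k \in box_seq d N -> Normc.normc (c k u) <= dl) ->
  \sum_(k <- box_seq d N) sobolev_weight s' k * \sum_u Normc.normc (c k u) ^+ 2 <=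
  (\sum_(k <- box_seq d N) sobolev_weight s' k) * m%:R * dl ^+ 2.
Proof.
move=> dl0 H; rewrite -mulrA mulr_suml big_seq [leRHS]big_seq; apply: ler_sum => k kN.
apply: ler_wpM2l; first exact/ltW/sobolev_weight_gt0.
apply: (@le_trans _ _ (\sum_(u < m) dl ^+ 2)).
  by apply: ler_sum => u _; rewrite lerXn2r ?nnegrE ?normc_ge0//; exact: H.
by rewrite sumr_const card_ord mulr_natl.
Qed.

(** Three errors, with [p] as intermediate polynomial: the coefficients of [v] on the box [M], the
    tail of [v] beyond it, and [p - t], a polynomial of degree [N] controlled by its node values.
    The factor 2 comes from [normc_sqrD_le]. *)
Lemma sobolev_energy_approx (v : sobolev d du s') M N (p t : 'I_du -> 'rV[R]_d -> R) dl dl' tau :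
  (M <= N)%N -> (forall u, trig_poly M (p u)) -> (forall u, trig_poly N (t u)) ->
  0 <= dl -> 0 <= dl' ->
  (forall k u, k \in box_seq d M -> Normc.normc (sobolev_coef v k u - fourier (p u) k) <= dl) ->
  (forall j u, `|p u (@grid R d N j) - t u (grid j)| <= dl') ->
  (forall N', sobolev_tail M N' v <= tau) ->
  forall N', sobolev_energy s' N' (fun k u => sobolev_coef v k u - fourier (t u) k) <=
  (2 * pi) ^+ d / 2 * (2 *
    ((\sum_(k <- box_seq d M) sobolev_weight s' k) * du%:R * dl ^+ 2 + tau +
     (\sum_(k <- box_seq d N) sobolev_weight s' k) * du%:R * dl' ^+ 2)).
Proof.
move=> MN hp ht dl0 dl'0 Hp Ht Htail N'.
apply: ler_wpM2l; first exact/ltW/torus_volume_gt0.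
(* A box containing both, so that the sums can be split at [M] and at [N]. *)
set Q := maxn N' N.
apply: (@le_trans _ _ (\sum_(k <- box_seq d Q) sobolev_weight s' k *
    \sum_u Normc.normc (sobolev_coef v k u - fourier (t u) k) ^+ 2)).
  rewrite (sum_box_le _ (leq_maxl N' N)) lerDl; apply: sumr_ge0 => k _.
  exact: (energy_term_ge0 s' (fun k u => sobolev_coef v k u - fourier (t u) k)).
pose E (c : 'rV[int]_d -> 'I_du -> R[i]) k :=
  sobolev_weight s' k * \sum_u Normc.normc (c k u) ^+ 2.
apply: (@le_trans _ _ (2 *
    (\sum_(k <- box_seq d Q) E (fun k u => sobolev_coef v k u - fourier (p u) k) k +
     \sum_(k <- box_seq d Q) E (fun k u => fourier (p u) k - fourier (t u) k) k))).
  rewrite mulrDr !mulr_sumr -big_split; apply: ler_sum => k _.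
  rewrite -[leRHS]/(2 * E _ k + 2 * E _ k) /E !(mulrCA 2) -mulrDr.
  apply: ler_wpM2l; first exact/ltW/sobolev_weight_gt0.
  rewrite !mulr_sumr -big_split; apply: ler_sum => u _.
  have -> : sobolev_coef v k u - fourier (t u) k =
    (sobolev_coef v k u - fourier (p u) k) + (fourier (p u) k - fourier (t u) k) by ring.
  exact: normc_sqrD_le.
rewrite ler_pM2l//; apply: lerD.
  rewrite (sum_box_le _ (leq_trans MN (leq_maxr N' N))); apply: lerD.
    exact: (@sum_weight_le du M (fun k u => sobolev_coef v k u - fourier (p u) k)).
  apply: le_trans (Htail Q); rewrite le_eqVlt; apply/orP; left; apply/eqP.
  apply: eq_bigr => k kM; congr (_ * _); apply: eq_bigr => u _.
  by rewrite (trig_poly_fourier (hp u)).2// subr0.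
rewrite (sum_box_le _ (leq_maxr N' N)) [X in _ + X]big1 ?addr0 => [|k kN]; last first.
  rewrite /E big1 ?mulr0// => u _.
  rewrite (trig_poly_fourier (trig_poly_le MN (hp u))).2// (trig_poly_fourier (ht u)).2//.
  by rewrite subrr Normc.normc0 expr0n.
apply: (@sum_weight_le du N (fun k u => fourier (p u) k - fourier (t u) k)) => // k u _.
have pN := trig_poly_le MN (hp u).
rewrite -(trig_poly_fourierB k pN (ht u)).
exact: (trig_poly_fourier_le k (trig_polyB pN (ht u)) dl'0 (fun j => Ht j u)).
Qed.

Lemma small_square (C e : R) : 0 <= C -> 0 < e -> exists2 dl, 0 < dl & C * dl ^+ 2 <= e.
Proof.
move=> C0 e0; have C1 : 0 < C + 1 by rewrite ltr_wpDl.
exists (Num.sqrt (e / (C + 1))); first by rewrite sqrtr_gt0 divr_gt0.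
rewrite sqr_sqrtr; last by apply/ltW/divr_gt0.
rewrite mulrA ler_pdivrMr// mulrC ler_wpM2l ?(ltW e0)// lerDl//.
Qed.

Context {s : R}.
Hypotheses (d_gt0 : (0 < d)%N) (s_gt : d%:R / 2 < s).

Lemma exp_sum_coefficients (G : sobolev d da s -> sobolev d du s') (K : set (sobolev d da s)) M dl :
  continuous G -> compact K -> 0 < dl ->
  exists m fr fi, forall k u, k \in box_seq d M ->
    [/\ exp_sum_on_grid m (fr k u), exp_sum_on_grid m (fi k u) & forall a, K a ->
      Normc.normc (sobolev_coef (G a) k u - Complex (exp_sum (fr k u) a) (exp_sum (fi k u) a)) <= dl].
Proof.
move=> cG cK dl0; have dl2 : 0 < dl / 2 by rewrite divr_gt0.
have H (q : 'rV[int]_d * 'I_du) : exists z : nat * (seq (R * seq (R * 'rV[R]_d * 'I_da)) *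
    seq (R * seq (R * 'rV[R]_d * 'I_da))),
    [/\ exp_sum_on_grid z.1 z.2.1, exp_sum_on_grid z.1 z.2.2 & forall a, K a ->
      Normc.normc (sobolev_coef (G a) q.1 q.2 - Complex (exp_sum z.2.1 a) (exp_sum z.2.2 a)) <= dl].
  have [cRe cIm] := @sobolev_coef_continuous R d du s' q.1 q.2.
  have cR : continuous (fun a => complex.Re (sobolev_coef (G a) q.1 q.2) : R).
    move=> a; apply: (@continuous_comp _ _ _ G (fun u => complex.Re (sobolev_coef u q.1 q.2) : R)).
      exact: cG.
    exact: cRe.
  have cI : continuous (fun a => complex.Im (sobolev_coef (G a) q.1 q.2) : R).
    move=> a; apply: (@continuous_comp _ _ _ G (fun u => complex.Im (sobolev_coef u q.1 q.2) : R)).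
      exact: cG.
    exact: cIm.
  have [n1 [r1 [h1 H1]]] := exp_sum_approx d_gt0 s_gt cK cR dl2.
  have [n2 [r2 [h2 H2]]] := exp_sum_approx d_gt0 s_gt cK cI dl2.
  exists (maxn n1 n2, (r1, r2)); split=> [||a Ka].
  - exact: exp_sum_on_grid_le (leq_maxl _ _) h1.
  - exact: exp_sum_on_grid_le (leq_maxr _ _) h2.
  apply: normc_le_ReIm; rewrite raddfB; [exact: H1|exact: H2].
have [z Hz] := choice H.
exists (\max_(k <- box_seq d M) \max_u (z (k, u)).1)%N, (fun k u => (z (k, u)).2.1),
  (fun k u => (z (k, u)).2.2) => k u kM.
have [h1 h2 h3] := Hz (k, u).
have zle : ((z (k, u)).1 <= \max_(k <- box_seq d M) \max_u (z (k, u)).1)%N.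
  apply: leq_trans (leq_bigmax_seq _ kM isT).
  exact: (@leq_bigmax 'I_du (fun u => (z (k, u)).1) u).
by split=> //; [exact: exp_sum_on_grid_le zle h1|exact: exp_sum_on_grid_le zle h2].
Qed.

Theorem psi_fno_approximation (sigma : R -> R) (G : sobolev d da s -> sobolev d du s')
    (K : set (sobolev d da s)) eps :
  lipschitz_fun sigma -> (~ exists c0 c1, forall x, sigma x = c0 + c1 * x) ->
  continuous G -> compact K -> 0 < eps ->
  exists N : nat, (0 < N)%N /\ exists net : psi_fno R d da du N, forall a, K a ->
    (sobolev_norm s' (fun x => G a x - fno_eval sigma net (continuous_repr a) x)%R <= eps%:E)%E.
Proof.
move=> lip nonaff cG cK eps0.
have V0 : 0 < (2 * pi) ^+ d / 2 :> R by exact: torus_volume_gt0.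
(* Three errors of size [tau], doubled, account for the factor 6. *)
pose tau := eps ^+ 2 / (((2 * pi) ^+ d / 2) * 6).
have tau0 : 0 < tau by apply: divr_gt0; [exact: exprn_gt0|exact: mulr_gt0].
have cGK : compact (G @` K).
  by apply: continuous_compact => //; exact: continuous_subspaceT.
have [M HM] := sobolev_tail_compact cGK tau0.
pose W N : R := (\sum_(k <- box_seq d N) sobolev_weight s' k) * du%:R.
have W0 N : 0 <= W N.
  by rewrite mulr_ge0// sumr_ge0// => k _; exact/ltW/sobolev_weight_gt0.
have [dl dl0 Hdl] := small_square (W0 M) tau0.
have [m [fr [fi Hm]]] := exp_sum_coefficients M cG cK dl0.
(* Level at least [m] makes the points of the exponential sums nodes; level at least [M] makes
   degree [M] fit in order [triadic n]. *)
pose n := maxn m M.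
have MN : (M <= triadic n)%N.
  exact: leq_trans (leq_maxr m M) (ltnW (triadic_gt n)).
(* The accuracy at the nodes is chosen after the order, since the weight sum [W (triadic n)] that
   multiplies its square depends on it. *)
have [dl' dl'0 Hdl'] := small_square (W0 (triadic n)) tau0.
have real : realizable sigma K (n := n) (fun a j u =>
    trig_sum M (fun k => Complex (exp_sum (fr k u) a) (exp_sum (fi k u) a)) (grid j)).
  apply: realizable_trig_sum => // k u /(Hm k u)[h1 h2 _].
  by split; [exact: exp_sum_on_grid_le (leq_maxl _ _) h1|exact: exp_sum_on_grid_le (leq_maxl _ _) h2].
have [l Hl] := real _ dl'0.
have [net Hnet] := neurons_psi_fno sigma l.
exists (triadic n); split; first exact: leq_ltn_trans (leq0n n) (triadic_gt n).
exists net => a Ka; apply: sobolev_norm_le; first exact: ltW.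
move=> N'; have [tp te] := Hnet (continuous_repr a).
rewrite (_ : (fun k u => _) = fun k u => sobolev_coef (G a) k u -
    fourier (fun x => fno_eval sigma net (continuous_repr a) x u 0) k); last first.
  apply/funext => k; apply/funext => u; apply: fourier_vec_sobolevB.
  exact/bounded_measurable_integrable/bounded_measurable_trig_poly/tp.
apply: le_trans (@sobolev_energy_approx (G a) M (triadic n)
  (fun u => trig_sum M (fun k => Complex (exp_sum (fr k u) a) (exp_sum (fi k u) a)))
  (fun u x => fno_eval sigma net (continuous_repr a) x u 0) dl dl' tau
  MN _ tp (ltW dl0) (ltW dl'0) _ _ _ N') _.
- by move=> u; apply/trig_polyP; eexists.
- move=> k u kM; apply: fourier_trig_sum_near kM; first exact: sobolev_class_integrable.
  by move=> k' /(Hm k' u)[_ _]; exact.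
- by move=> j u; rewrite te; exact: Hl.
- by apply: HM; exists a.
rewrite (_ : eps ^+ 2 = (2 * pi) ^+ d / 2 * (2 * (tau + tau + tau))); last first.
  by rewrite /tau; move: V0; move: ((2 * pi) ^+ d / 2 : R) => V V0; field; rewrite gt_eqF.
by rewrite ler_pM2l// ler_pM2l//; apply: lerD => //; rewrite lerD2r.
Qed.

End approximation.

Unset Implicit Arguments.

Theorem theorem2p15 (R : realType) (d da du : nat) (s s' : R)
    (d_gt0 : (0 < d)%N) (da_gt0 : (0 < da)%N) (du_gt0 : (0 < du)%N)
    (s_gt : d%:R / 2 < s) (s'_ge0 : 0 <= s')
    (sigma : R -> R)
    (sigma_nonpoly : ~ exists p : {poly R}, forall x, sigma x = p.[x])
    (sigma_lip : exists L : R, L.-lipschitz sigma)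
    (sigma_C3 : class_C 3 sigma)
    (G : sobolev d da s -> sobolev d du s') (G_continuous : continuous G)
    (K : set (sobolev d da s)) (K_compact : compact K)
    (eps : R) (eps_gt0 : 0 < eps) :
  exists N : nat, (0 < N)%N /\ exists net : psi_fno R d da du N,
    (ereal_sup [set sobolev_norm s'
        (fun x => G a x - fno_eval sigma net (continuous_repr a) x)%R | a in K]
      <= eps%:E)%E.
Proof.
have lip : lipschitz_fun sigma.
  by have [L HL] := sigma_lip; exists L => x y; exact: (HL (x, y)).
have nonaffine : ~ exists c0 c1, forall x, sigma x = c0 + c1 * x.
  move=> [c0 [c1 E]]; apply: sigma_nonpoly; exists (c0%:P + c1%:P * 'X) => x.
  by rewrite E !hornerE.
have [N [N0 [net H]]] := psi_fno_approximation d_gt0 s_gt lip nonaffine G_continuous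
  K_compact eps_gt0.
exists N; split=> //; exists net; apply: ub_ereal_sup => _ [a Ka <-]; exact: H.
Qed.
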